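(* Let $T>0$, let $\{W(t,A)\}$ be a white-noise family on $\mathbb{R}^d$ (sets $A\in\mathcal{B}(\mathbb{R}^d)$ of finite Lebesgue measure) with respect to a filtration $(\mathcal{F}_t)$, and let $W(t)$ be the corresponding cylindrical Wiener process in $L^2(\mathbb{R}^d)$ (with covariance operator $Q=I$). Then $$\int_0^T\phi(t)\,dW(t)=\int_0^T\int_{\mathbb{R}^d}\phi(t)(x)\,W(dt,dx)\quad\text{almost surely}$$ for every $\phi\in\widetilde P_T$, where the left-hand side is the stochastic integral with respect to the cylindrical Wiener process and the right-hand side is the Walsh integral.
   Context: **White noise.** $(\Omega,\mathcal{F},(\mathcal{F}_t)_{t\ge0},P)$ is a filtered probability space with right-continuous filtration. $\{W(t,A): t\ge0,\ A\in\mathcal{B}(\mathbb{R}^d),\ \mathrm{mes}(A)<\infty\}$, where $\mathrm{mes}$ is Lebesgue measure, is a centered Gaussian family such that for each fixed $A$ the process $W(\cdot,A)$ is a real-valued (continuous) Wiener process adapted to $(\mathcal{F}_t)$, where $(\mathcal{F}_t)$ does not depend on $A$; the increments $\{W(t,A)-W(s,A)\}_{t\ge s,\,A}$ are independent of $\mathcal{F}_s$; and $\mathbb{E}(W(t,A)W(s,B))=(t\wedge s)\,\mathrm{mes}(A\cap B)$. **Integrands.** $\widetilde P_T$ is the class of functions $\phi:[0,T]\times\Omega\to L^2(\mathbb{R}^d)$ such that $\phi$ is measurable, $\phi(t)$ is $\mathcal{F}_t$-measurable for each $t$, and $\mathbb{E}\int_0^T|\phi(t)|^2_{L^2(\mathbb{R}^d)}\,dt<+\infty$.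 It is identified with the class $P_T$ of measurable functions $\phi:[0,T]\times\mathbb{R}^d\times\Omega\to\mathbb{R}$ with $\phi(t,x)$ $\mathcal{F}_t$-measurable and $\mathbb{E}\int_0^T\int_{\mathbb{R}^d}|\phi(t,x)|^2\,dx\,dt<+\infty$, via $\phi(t)(x)=\phi(t,x)$. **Walsh integral.** For an elementary function $\phi(s,x,\omega)=I_{(a,b]}(s)I_A(x)X(\omega)$, with $0\le a<b\le T$, $X$ bounded and $\mathcal{F}_a$-measurable, and $\mathrm{mes}(A)<\infty$, set $\int_0^T\int_{\mathbb{R}^d}\phi\,W(dt,dx)=X\,(W(b,A)-W(a,A))$; extend by linearity to finite sums of elementary functions (simple functions), and then to all of $P_T$ as the $L^2(\Omega)$-limit along simple functions converging in $L^2([0,T]\times\mathbb{R}^d\times\Omega)$. The integral over $[0,t]$ is obtained by replacing $T$ by $t$. **Cylindrical Wiener process and its integral.** For an orthonormal basis $\{e_k\}_{k\ge1}$ of $L^2(\mathbb{R}^d)$ put $\beta_k(t)=\int_0^t\int_{\mathbb{R}^d}e_k(x)\,W(ds,dx)$; these are independent standard real Wiener processes with respect to $(\mathcal{F}_t)$, and the cylindrical Wiener process corresponding to $\{W(t,A)\}$ is $W(t)=\sum_{k=1}^\infty e_k\beta_k(t)$ (the series converging in $L^2(\Omega;U_1)$ for any Hilbert space $U_1$ into which $L^2(\mathbb{R}^d)$ embeds by a Hilbert--Schmidt embedding). Identifying $\phi(t)\in L^2(\mathbb{R}^d)$ with the Hilbert--Schmidt operator $h\mapsto(\phi(t),h)_{L^2(\mathbb{R}^d)}$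 from $L^2(\mathbb{R}^d)$ to $\mathbb{R}$, the stochastic integral with respect to $W$ is $$\int_0^T\phi(t)\,dW(t)=\lim_{m\to\infty}\sum_{k=1}^m\int_0^T(\phi(t),e_k)_{L^2(\mathbb{R}^d)}\,d\beta_k(t)\quad\text{in }L^2(\Omega),$$ the summands being ordinary real It\^o integrals. *)

(* Defs.v *)
From HB Require Import structures.
From mathcomp Require Import all_boot all_order all_algebra.
From mathcomp Require Import all_classical all_reals all_analysis.

Set Implicit Arguments.
Unset Strict Implicit.
Unset Printing Implicit Defensive.

Import Order.TTheory GRing.Theory Num.Theory.
Import numFieldNormedType.Exports.

Local Open Scope classical_set_scope.
Local Open Scope ring_scope.

(* R^n as n-tuples, whose canonical sigma-algebra is the product one, that is,
   the Borel sigma-algebra of R^n. *)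
Notation Rn R n := (n.-tuple (measurableTypeR R)).

Section lebesgue_tuple_step.
Context (R : realType) (n : nat).

Definition tcons (p : measurableTypeR R * Rn R n) : Rn R n.+1 :=
  [tuple of p.1 :: p.2].

Lemma measurable_tcons : measurable_fun [set: measurableTypeR R * Rn R n] tcons.
Proof.
apply: (measurable_cons (f := fst) (g := snd));
  [exact: measurable_fst|exact: measurable_snd].
Qed.

Variable m : {sigma_finite_measure set (Rn R n) -> \bar R}.

Definition lebesgue_tupleS : set (Rn R n.+1) -> \bar R :=
  pushforward (@lebesgue_measure R \x m)%E tcons.

Let lebesgue_tupleS0 : lebesgue_tupleS set0 = 0%E.
Proof. by rewrite /lebesgue_tupleS /pushforward preimage_set0 measure0. Qed.

Let lebesgue_tupleS_ge0 A : (0 <= lebesgue_tupleS A)%E.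
Proof. by rewrite /lebesgue_tupleS /pushforward; exact: measure_ge0. Qed.

Let lebesgue_tupleS_sigma_additive : semi_sigma_additive lebesgue_tupleS.
Proof.
move=> A mA tA mUA; rewrite /lebesgue_tupleS /pushforward preimage_bigcup.
apply: measure_semi_sigma_additive.
- by move=> i; rewrite -[X in measurable X]setTI; exact: measurable_tcons.
- apply/trivIsetP => i j _ _ ij; rewrite -preimage_setI.
  by move/trivIsetP : tA => /(_ _ _ Logic.I Logic.I ij) ->; rewrite preimage_set0.
- rewrite -preimage_bigcup -[X in measurable X]setTI.
  exact: measurable_tcons.
Qed.

HB.instance Definition _ := isMeasure.Build _ _ _ lebesgue_tupleS
  lebesgue_tupleS0 lebesgue_tupleS_ge0 lebesgue_tupleS_sigma_additive.

Let tuncons (x : Rn R n.+1) : measurableTypeR R * Rn R n :=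
  (thead x, [tuple of behead x]).

Let measurable_tuncons : measurable_fun [set: Rn R n.+1] tuncons.
Proof.
by apply/measurable_fun_pair; [exact: measurable_tnth|exact: measurable_behead].
Qed.

Let tconsK : cancel tcons tuncons.
Proof. by case=> x y; congr pair; apply/val_inj. Qed.

Let lebesgue_tupleS_sigma_finite : sigma_finite setT lebesgue_tupleS.
Proof.
have /sigma_finiteP[A [TA ndA Aoo]] := sigma_finiteT (@lebesgue_measure R).
have /sigma_finiteP[B [TB ndB Boo]] := sigma_finiteT m.
exists (fun i => tuncons @^-1` (A i `*` B i)).
  rewrite -preimage_bigcup; apply/esym/seteqP; split => // x _ /=.
  have [i _ Ai] : (\bigcup_i A i) (thead x) by rewrite -TA.
  have [j _ Bj] : (\bigcup_i B i) [tuple of behead x] by rewrite -TB.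
  exists (maxn i j) => //; split => /=.
  - by move: Ai; exact/subsetPset/ndA/leq_maxl.
  - by move: Bj; exact/subsetPset/ndB/leq_maxr.
move=> i; have [[mA Ai] [mB Bi]] := (Aoo i, Boo i); split.
  rewrite -[X in measurable X]setTI.
  by apply: measurable_tuncons => //; exact: measurableX.
rewrite /lebesgue_tupleS /pushforward -comp_preimage.
rewrite (_ : _ \o _ = id) ?preimage_id; last by apply/funext => p; exact: tconsK.
by rewrite product_measure1E// lte_mul_pinfty// ge0_fin_numE.
Qed.

HB.instance Definition _ := Measure_isSigmaFinite.Build _ _ _ lebesgue_tupleS
  lebesgue_tupleS_sigma_finite.

End lebesgue_tuple_step.

Fixpoint lebesgue_tuple (R : realType) (n : nat) :
    {sigma_finite_measure set (Rn R n) -> \bar R} :=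
  match n with
  | 0 => \d_ ([tuple] : Rn R 0)
  | n'.+1 => lebesgue_tupleS (lebesgue_tuple R n')
  end.

Arguments lebesgue_tuple R n : clear implicits.

Lemma lebesgue_tuple_box (R : realType) (n : nat)
    (A : 'I_n -> set (measurableTypeR R)) : (forall i, measurable (A i)) ->
  lebesgue_tuple R n [set x | forall i, A i (tnth x i)] =
  (\prod_(i < n) lebesgue_measure (A i))%E.
Proof.
elim: n A => [|n IHn] A mA /=.
  by rewrite big_ord0 diracE mem_set// => -[].
pose B i := A (lift ord0 i).
have mB : measurable [set x : Rn R n | forall i, B i (tnth x i)].
  rewrite (_ : [set x | _] = \bigcap_(i in [set: 'I_n]) ((@tnth n _)^~ i @^-1` B i)).
    apply: fin_bigcap_measurable => // i _; rewrite -[X in measurable X]setTI.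
    by apply: measurable_tnth => //; exact: mA.
  by apply/seteqP; split => x /= xB i; [move=> _|]; exact: xB.
rewrite big_ord_recl -IHn; last by move=> i; exact: mA.
rewrite -product_measure1E// /lebesgue_tupleS /pushforward; congr (_ _).
apply/seteqP; split => -[x y] /=.
  by move=> xyA; split => [|i]; [exact: (xyA ord0)|have := xyA (lift ord0 i); rewrite tnthS].
move=> [Ax yB] i; case: (unliftP ord0 i) => [j|] ->; last by [].
by rewrite tnthS; exact: yB.
Qed.

Definition measurable_wrt (Om U : Type) (G : set (set Om)) (C : set (set U))
    (X : Om -> U) : Prop :=
  forall B, C B -> G (X @^-1` B).

Section square_integrable.
Context (R : realType) (d : nat).
Local Notation mes := (lebesgue_tuple R d).

Definition L2 : Type := LspaceType2 mes.

(* [f : L2] is an almost-everywhere class, and coerces to a representative;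
   none of the following depends on which one. *)
Definition L2norm (f : Rn R d -> R) : \bar R := 'N[mes]_2%:E[EFin \o f]%E.

Definition L2dot (f g : L2) : R := \int[mes]_x (f x * g x).

Definition L2open (U : set L2) : Prop :=
  forall f, U f -> exists2 r : R, 0 < r &
    forall g : L2, (L2norm (f \- g)%R < r%:E)%E -> U g.

Definition L2borel : set (set L2) := <<s [set U | L2open U] >>.

Definition orthonormal_basis (e : nat -> L2) : Prop :=
  (forall i j, L2dot (e i) (e j) = (i == j)%:R) /\
  (forall f : L2,
     L2norm (fun x => f x - \sum_(k < m) L2dot f (e k) * e k x) @[m --> \oo]
       --> 0%E).

End square_integrable.
Arguments L2 R d : clear implicits.
Arguments L2norm {R d} f.
Arguments L2borel R d : clear implicits.

Section stochastic.
Context (R : realType) (d : nat) (dO : measure_display)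
  (Om : measurableType dO) (P : probability Om R).

Local Notation mes := (lebesgue_tuple R d).

Definition L2_limit (u : nat -> Om -> R) (X : Om -> R) : Prop :=
  X \in Lfun P 2%:E /\
  'N[P]_2%:E[EFin \o (u n \- X)%R]%E @[n --> \oo] --> 0%E.

(* Only times [t >= 0] are meaningful. *)
Record filtration (F : R -> set (set Om)) : Prop := {
  filtration_sigma : forall t : R, 0 <= t -> sigma_algebra setT (F t) ;
  filtration_sub : forall t : R, 0 <= t -> F t `<=` measurable ;
  filtration_mono : forall s t : R, 0 <= s -> s <= t -> F s `<=` F t ;
  filtration_right : forall t : R, 0 <= t ->
    \bigcap_(s in [set s | t < s]) F s `<=` F t
}.

Definition independent_systems (G H : set (set Om)) : Prop :=
  forall A B, G A -> H B -> P (A `&` B) = (P A * P B)%E.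

(* [normal_prob 0 0] is not the Dirac mass, whence the separate case. *)
Definition centered_normal (s : R) (X : Om -> R) : Prop :=
  measurable_fun setT X /\
  if s == 0 then X = cst 0 %[ae P]
  else forall B : set (measurableTypeR R), measurable B ->
    P (X @^-1` B) = normal_prob 0 s B.

(* A real Wiener process with variance [v * t] at time [t]. *)
Record wiener (F : R -> set (set Om)) (v : R) (B : R -> Om -> R) : Prop := {
  wiener_adapted : forall t : R, 0 <= t -> measurable_wrt (F t) measurable (B t) ;
  wiener_0 : B 0 = cst 0 %[ae P] ;
  wiener_continuous :
    {ae P, forall w, {within [set t | 0 <= t], continuous (B ^~ w)}} ;
  wiener_normal : forall s t : R, 0 <= s -> s <= t ->
    centered_normal (Num.sqrt (v * (t - s))) (B t \- B s) ;
  wiener_indep : forall s t : R, 0 <= s -> s <= t ->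
    independent_systems (preimage_set_system setT (B t \- B s) measurable) (F s)
}.

Definition finite_borel (A : set (Rn R d)) : Prop :=
  measurable A /\ (mes A < +oo)%E.

(* The values [W t A] with [t < 0] or [~ finite_borel A] are irrelevant. *)
Record white_noise (F : R -> set (set Om)) (W : R -> set (Rn R d) -> Om -> R)
    : Prop := {
  wn_gaussian : forall n (c t : 'I_n -> R) (A : 'I_n -> set (Rn R d)),
    (forall i, 0 <= t i /\ finite_borel (A i)) ->
    exists s : R, centered_normal s (fun w => \sum_(i < n) c i * W (t i) (A i) w) ;
  wn_wiener : forall A, finite_borel A -> wiener F (fine (mes A)) (W ^~ A) ;
  wn_indep : forall s : R, 0 <= s ->
    independent_systems
      <<s [set E | exists (t : R) A (B : set R), [/\ s <= t, finite_borel A, measurable B &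
                   E = (W t A \- W s A) @^-1` B]] >>
      (F s) ;
  wn_covariance : forall (s t : R) A B, 0 <= s -> 0 <= t ->
    finite_borel A -> finite_borel B ->
    'E_P[W t A \* W s B]%E = ((Num.min t s)%:E * mes (A `&` B))%E
}.

Definition PT_tilde (F : R -> set (set Om)) (T : R) (phi : R -> Om -> L2 R d)
    : Prop :=
  [/\ forall B, L2borel R d B ->
        measurable (`[0, T] `*` setT `&`
                    [set p : measurableTypeR R * Om | B (phi p.1 p.2)]),
      forall t : R, 0 <= t <= T -> measurable_wrt (F t) (L2borel R d) (phi t) &
      (\int[P]_w \int[lebesgue_measure]_(t in `[0%R, T]) (L2norm (phi t w) ^+ 2)
        < +oo)%E].

Definition PT (F : R -> set (set Om)) (T : R)
    (psi : R -> Rn R d -> Om -> R) : Prop :=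
  [/\ measurable_fun (`[0, T] `*` setT `*` setT)
        (fun p : measurableTypeR R * Rn R d * Om => psi p.1.1 p.1.2 p.2),
      forall (t : R) x, 0 <= t <= T -> measurable_wrt (F t) measurable (psi t x) &
      (\int[P]_w \int[lebesgue_measure]_(t in `[0%R, T]) \int[mes]_x
        ((psi t x w) ^+ 2)%:E < +oo)%E].

Definition represents (T : R) (phi : R -> Om -> L2 R d)
    (psi : R -> Rn R d -> Om -> R) : Prop :=
  forall (t : R) w, 0 <= t <= T -> psi t ^~ w = phi t w %[ae mes].

(* The elementary function I_(a, b](s) I_A(x) X(w). *)
Record elementary := Elementary {
  el_start : R ; el_end : R ; el_set : set (Rn R d) ; el_coef : Om -> R }.
HB.instance Definition _ := gen_eqMixin elementary.

Definition elementary_on (F : R -> set (set Om)) (T : R) (u : elementary)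
    : Prop :=
  [/\ 0 <= el_start u < el_end u, el_end u <= T,
      finite_borel (el_set u),
      (exists M : R, forall w, `|el_coef u w| <= M) &
      measurable_wrt (F (el_start u)) measurable (el_coef u)].

(* A simple function is given by a list of elementary ones, to be summed. *)
Definition simple_value (us : seq elementary) (t : R) (x : Rn R d) (w : Om)
    : R :=
  \sum_(u <- us)
    \1_(`]el_start u, el_end u]) t * \1_(el_set u) x * el_coef u w.

Definition simple_walsh (W : R -> set (Rn R d) -> Om -> R)
    (us : seq elementary) (w : Om) : R :=
  \sum_(u <- us)
    el_coef u w * (W (el_end u) (el_set u) w - W (el_start u) (el_set u) w).

(* [J] is a version of the integral of [psi] over [0, T] x R^d. *)
Definition is_walsh_integral (F : R -> set (set Om))
    (W : R -> set (Rn R d) -> Om -> R) (T : R) (psi : R -> Rn R d -> Om -> R)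
    (J : Om -> R) : Prop :=
  exists us : nat -> seq elementary,
    [/\ forall n u, u \in us n -> elementary_on F T u,
        (\int[P]_w \int[lebesgue_measure]_(t in `[0%R, T]) \int[mes]_x
          ((simple_value (us n) t x w - psi t x w) ^+ 2)%:E)%E
          @[n --> \oo] --> 0%E &
        L2_limit (fun n => simple_walsh W (us n)) J].

(* The Walsh integral of an L^2(R^d)-valued process, through the element of PT
   it is identified with. *)
Definition is_walsh_integral_L2 (F : R -> set (set Om))
    (W : R -> set (Rn R d) -> Om -> R) (T : R) (phi : R -> Om -> L2 R d)
    (J : Om -> R) : Prop :=
  exists psi, [/\ PT F T psi, represents T phi psi &
                  is_walsh_integral F W T psi J].

Record ito_elementary := ItoElementary {
  ie_start : R ; ie_end : R ; ie_coef : Om -> R }.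
HB.instance Definition _ := gen_eqMixin ito_elementary.

Definition ito_elementary_on (F : R -> set (set Om)) (T : R)
    (u : ito_elementary) : Prop :=
  [/\ 0 <= ie_start u < ie_end u, ie_end u <= T,
      (exists M : R, forall w, `|ie_coef u w| <= M) &
      measurable_wrt (F (ie_start u)) measurable (ie_coef u)].

Definition ito_simple_value (us : seq ito_elementary) (t : R) (w : Om) : R :=
  \sum_(u <- us) \1_(`]ie_start u, ie_end u]) t * ie_coef u w.

Definition ito_simple_integral (B : R -> Om -> R) (us : seq ito_elementary)
    (w : Om) : R :=
  \sum_(u <- us) ie_coef u w * (B (ie_end u) w - B (ie_start u) w).

Definition is_ito_integral (F : R -> set (set Om)) (B : R -> Om -> R) (T : R)
    (X : R -> Om -> R) (J : Om -> R) : Prop :=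
  exists us : nat -> seq ito_elementary,
    [/\ forall n u, u \in us n -> ito_elementary_on F T u,
        (\int[P]_w \int[lebesgue_measure]_(t in `[0%R, T])
          ((ito_simple_value (us n) t w - X t w) ^+ 2)%:E)%E
          @[n --> \oo] --> 0%E &
        L2_limit (fun n => ito_simple_integral B (us n)) J].

(* The cylindrical Wiener process sum_k e_k beta_k, whose series does not
   converge in L^2(R^d), is given by its coordinates [beta]; each [beta k t] is
   an arbitrary version of the Walsh integral of e_k over [0, t] x R^d. *)
Definition cylindrical_wiener_of (F : R -> set (set Om))
    (W : R -> set (Rn R d) -> Om -> R) (e : nat -> L2 R d)
    (beta : nat -> R -> Om -> R) : Prop :=
  orthonormal_basis e /\
  forall k (t : R), 0 <= t -> is_walsh_integral F W t (fun _ x _ => e k x) (beta k t).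

Definition is_cylindrical_integral (F : R -> set (set Om)) (e : nat -> L2 R d)
    (beta : nat -> R -> Om -> R) (T : R) (phi : R -> Om -> L2 R d)
    (J : Om -> R) : Prop :=
  exists I : nat -> Om -> R,
    (forall k,
       is_ito_integral F (beta k) T (fun t w => L2dot (phi t w) (e k)) (I k)) /\
    L2_limit (fun m w => \sum_(k < m) I k w) J.

End stochastic.

(* Main.v *)
From HB Require Import structures.
Require Import Defs.
From mathcomp Require Import all_boot all_order all_algebra.
From mathcomp Require Import ring lra.
From mathcomp Require Import all_classical all_reals all_analysis.
From mathcomp Require Import measurable_realfun.

Set Implicit Arguments.
Unset Strict Implicit.
Unset Printing Implicit Defensive.

Import Order.TTheory GRing.Theory Num.Theory.
Import numFieldNormedType.Exports.

Local Open Scope classical_set_scope.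
Local Open Scope ring_scope.

(** Both stochastic integrals are limits of sums of white noise increments, and
    both turn the squared norm of the integrand, its energy
    E \int_0^T \int psi(t, x)^2 dx dt, into the second moment of the integral.  It
    is therefore enough to match the two integrals on a total family of integrands,
    and the products c(t) e_k(x), with c a coordinate of phi, form one.

    - On simple functions the Walsh integral is an isometry [simple_isometry]: in
      the double sum of covariances, past and future increments are uncorrelated,
      because the noise has independent centered increments.  Consequently the
      integral is well defined, linear, closed and exists for every limit of
      integrable fields [walsh_contraction], [walsh_closed], [walsh_exists].
      Completeness of the space of square integrable random variables is used here.
    - The Ito integral of a process c against beta_k is the Walsh integral of
      c(t) e_k(x) [ito_walsh].  For elementary c this needs a simultaneous
      approximation of beta_k at two instants, since beta_k(t) is only some version
      of the Walsh integral of e_k over [0, t]; it is obtained by approximating e_k by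
      a step function in space, which itself is a slice of the simple functions
      approximating e_k in the definition of beta_k(1) [walsh_step_dense].
    - The coordinate processes c_k(t) = (phi(t), e_k) have Ito integrals, because
      bounded adapted measurable processes are limits of simple ones.  The process is
      sampled along a grid of mesh h, the sampling time in each cell being chosen so
      that the error does not exceed its average over the cell; by Lebesgue
      differentiation the average tends to zero with h [simple_process_dense].
    - An L^2-valued integrand comes from a measurable adapted field.  Its partial
      expansions converge only in mean square, but along numbers of terms chosen,
      measurably in the coefficients, so that the squared tails are summable, they
      converge almost everywhere in x [assemble_ae], [assembled_PT].
    - Partial expansions sum_(k < m) c_k(t) e_k(x) converge to phi for the energy, by
      Parseval and dominated convergence [energy_expansion_cvg0].  Their Walsh
      integrals are the partial sums of the series defining the cylindrical integral,
      so both integrals are the limit of the same sequence. *)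

(** * Integrals of nonnegative functions *)

Lemma cvge0P (R : realType) (u : nat -> \bar R) : (forall n, (0 <= u n)%E) ->
  u n @[n --> \oo] --> 0%E <->
  (forall e : R, 0 < e -> \forall n \near \oo, (u n <= e%:E)%E).
Proof.
move=> u0; split.
  move=> /fine_cvgP[ufin /cvgrPdist_le u_0] e e0.
  have ue := u_0 e e0.
  near=> n.
  have un : u n \is a fin_num by near: n.
  rewrite -(fineK un) lee_fin.
  have : `|0 - (fine \o u) n| <= e by near: n.
  by rewrite sub0r normrN /= ger0_norm// fine_ge0.
move=> ue; apply/fine_cvgP; split.
  near=> n; rewrite ge0_fin_numE//.
  by apply: (@le_lt_trans _ _ 1%:E); [near: n; exact: ue|exact: ltry].
apply/cvgrPdist_le => e e0; near=> n.
have une : (u n <= e%:E)%E by near: n; exact: ue.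
have un : u n \is a fin_num by rewrite ge0_fin_numE// (le_lt_trans une) ?ltry.
by rewrite sub0r normrN /= ger0_norm ?fine_ge0// -lee_fin fineK.
Unshelve. all: by end_near. Qed.

Lemma cvge0_inv (R : realType) (u : nat -> \bar R) : (forall n, (0 <= u n)%E) ->
  (forall n, (u n <= (n.+1%:R^-1 : R)%:E)%E) -> u n @[n --> \oo] --> 0%E.
Proof.
move=> u0 un; apply/cvge0P => // e e0; near=> n.
rewrite (le_trans (un n))// lee_fin.
apply: ltW; near: n; exact: (near_infty_natSinv_lt (PosNum e0)).
Unshelve. all: by end_near. Qed.

Lemma integral_mulindic (d : measure_display) (T : measurableType d) (R : realType)
    (m : {measure set T -> \bar R}) (D : set T) (g : T -> \bar R) :
  (\int[m]_(x in D) g x = \int[m]_x ((\1_D x)%:E * g x))%E.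
Proof.
rewrite integral_mkcond; apply: eq_integral => x _.
by rewrite patchE indicE; case: ifPn => _; rewrite ?mul1e ?mul0e.
Qed.

(** The integral of a nonnegative function is a supremum over the simple functions
    below it, hence monotone even among nonmeasurable functions. *)
Lemma ge0_integral_mono (d : measure_display) (T : measurableType d) (R : realType)
    (m : {measure set T -> \bar R}) (D : set T) (f g : T -> \bar R) :
  (forall x, D x -> 0 <= f x <= g x)%E ->
  (\int[m]_(x in D) f x <= \int[m]_(x in D) g x)%E.
Proof.
move=> fg; rewrite integral_mkcond [leRHS]integral_mkcond.
have fg' x : (0 <= (f \_ D) x <= (g \_ D) x)%E.
  by rewrite !patchE; case: ifPn => [/set_mem Dx|_]; [exact: fg|rewrite lexx].
rewrite ge0_integralTE; last by move=> x; case/andP: (fg' x).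
rewrite ge0_integralTE; last by move=> x; case/andP: (fg' x) => /le_trans; exact.
apply: ereal_sup_le => _ [h hf <-]; exists h => // x.
by rewrite (le_trans (hf x))//; case/andP: (fg' x).
Qed.

Lemma probability_integral_cst (d : measure_display) (T : measurableType d)
    (R : realType) (P : probability T R) (c : \bar R) : (\int[P]_w c = c)%E.
Proof.
transitivity (c * P setT)%E; first exact: (integral_cst P measurableT c).
by rewrite probability_setT mule1.
Qed.

Lemma dominated_cvg0 (d : measure_display) (T : measurableType d) (R : realType)
    (m : {measure set T -> \bar R}) (D : set T) (u : nat -> T -> \bar R)
    (g : T -> \bar R) : measurable D ->
  (forall n, measurable_fun D (u n)) -> m.-integrable D g ->
  (forall n x, D x -> 0 <= u n x <= g x)%E ->
  {ae m, forall x, D x -> u n x @[n --> \oo] --> 0%E} ->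
  (\int[m]_(x in D) u n x)%E @[n --> \oo] --> 0%E.
Proof.
move=> mD mu ig ug u0; rewrite -[X in _ --> X](integral0 m D).
have [//||_ _] := dominated_convergence mD mu (f := cst 0%E) _ u0 ig; last exact.
by apply: aeW => x n Dx; have /andP[h1 h2] := ug n x Dx; rewrite gee0_abs.
Qed.

Lemma sigma_finite_prod (d1 d2 : measure_display) (T1 : measurableType d1)
    (T2 : measurableType d2) (R : realType)
    (m1 : {sigma_finite_measure set T1 -> \bar R})
    (m2 : {sigma_finite_measure set T2 -> \bar R}) : sigma_finite setT (m1 \x m2)%E.
Proof.
have [A TA mA] := sigma_finiteT m1; have [B TB mB] := sigma_finiteT m2.
pose C (p : nat * nat) := A p.1 `*` B p.2.
exists (fun n => if unpickle n is Some p then C p else set0).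
  apply/esym/seteqP; split => // -[x y] _.
  have [i _ Ai] : (\bigcup_i A i) x by rewrite -TA.
  have [j _ Bj] : (\bigcup_i B i) y by rewrite -TB.
  by exists (pickle (i, j)) => //; rewrite pickleK.
move=> n; case: unpickle => [[i j]|]; last by rewrite measure0.
have [mAi fAi] := mA i; have [mBj fBj] := mB j.
split; first exact: measurableX.
by rewrite product_measure1E// lte_mul_pinfty// ge0_fin_numE.
Qed.

(** The product of two sigma-finite measures, with sigma-finiteness as part of the
    structure, so that it can be a factor of a further product. *)
Lemma sigma_finite_product_measure (d1 d2 : measure_display) (T1 : measurableType d1)
    (T2 : measurableType d2) (R : realType)
    (m1 : {sigma_finite_measure set T1 -> \bar R})
    (m2 : {sigma_finite_measure set T2 -> \bar R}) :
  exists m : {sigma_finite_measure set (T1 * T2)%type -> \bar R},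
    forall f : T1 * T2 -> \bar R, measurable_fun setT f -> (forall p, 0 <= f p)%E ->
    (\int[m]_p f p = \int[m1]_x \int[m2]_y f (x, y))%E.
Proof.
pose m : {sigma_finite_measure set (T1 * T2)%type -> \bar R} :=
  HB.pack (m1 \x m2)%E (Measure_isSigmaFinite.Build _ _ _ (m1 \x m2)%E
    (sigma_finite_prod m1 m2)).
by exists m => f mf f0; exact: fubini_tonelli1.
Qed.

(** A product space with three factors is integrated in either order by grouping the
    first two factors. *)
Lemma tonelli3 (d1 d2 d3 : measure_display) (T1 : measurableType d1)
    (T2 : measurableType d2) (T3 : measurableType d3) (R : realType)
    (m1 : {sigma_finite_measure set T1 -> \bar R})
    (m2 : {sigma_finite_measure set T2 -> \bar R})
    (m3 : {sigma_finite_measure set T3 -> \bar R})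
    (g : T1 * T2 * T3 -> \bar R) : measurable_fun setT g -> (forall p, 0 <= g p)%E ->
  (\int[m1]_x \int[m2]_y \int[m3]_z g (x, y, z) =
   \int[m3]_z \int[m1]_x \int[m2]_y g (x, y, z))%E /\
  measurable_fun setT (fun z => \int[m1]_x \int[m2]_y g (x, y, z))%E.
Proof.
move=> mg g0.
have [m mE] := sigma_finite_product_measure m1 m2.
have mgz z : measurable_fun setT (fun p => g (p, z)) by exact: measurable_fun_pair1.
have E z : (\int[m1]_x \int[m2]_y g (x, y, z) = \int[m]_p g (p, z))%E.
  by rewrite (mE _ (mgz z)).
have mF : measurable_fun setT (fun p => \int[m3]_z g (p, z))%E.
  exact: (measurable_fun_fubini_tonelli_F (m2 := m3) _ mg g0).
have F0 p : (0 <= \int[m3]_z g (p, z))%E by apply: integral_ge0.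
split.
  transitivity (\int[m]_p \int[m3]_z g (p, z))%E; first by rewrite (mE _ mF F0).
  rewrite (fubini_tonelli (m1 := m) (m2 := m3) _ mg g0).
  by apply: eq_integral => z _; rewrite E.
under eq_fun do rewrite E.
exact: (measurable_fun_fubini_tonelli_G (m1 := m) _ mg g0).
Qed.

(** Otherwise the function would exceed its mean value everywhere. *)
Lemma exists_le_mean (d : measure_display) (T : measurableType d) (R : realType)
    (m : {measure set T -> \bar R}) (A : set T) (g : T -> \bar R) (h b del : R) :
  measurable A -> m A = h%:E -> 0 < h -> 0 < del -> 0 <= b ->
  (\int[m]_(x in A) ((h^-1)%:E * g x) <= b%:E)%E ->
  exists2 x, A x & (g x <= (b + del)%:E)%E.
Proof.
move=> mA mAh h0 del0 b0; apply: contraPP => /forall2NP H; apply/negP.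
have c0 : 0 <= h^-1 * (b + del) by rewrite mulr_ge0 ?invr_ge0 ?addr_ge0// ltW.
rewrite -ltNge; apply: (@lt_le_trans _ _ ((h^-1 * (b + del))%:E * m A)%E).
  by rewrite mAh -EFinM lte_fin mulrAC mulVf ?gt_eqF// mul1r ltrDl.
rewrite -(integral_cst m mA (h^-1 * (b + del))%:E); apply: ge0_integral_mono => x Ax.
rewrite lee_fin c0 EFinM lee_pmul2l ?lte_fin ?invr_gt0//.
by have [//|/negP] := H x; rewrite -ltNge => /ltW.
Qed.

(** * Mean-square calculus *)

Section sqint.
Context (d : measure_display) (T : measurableType d) (R : realType).
Variable mu : {measure set T -> \bar R}.
Implicit Types (D : set T) (f g h : T -> R).

Definition sqint D f : \bar R := (\int[mu]_(x in D) (f x ^+ 2)%:E)%E.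

Lemma sqint_ge0 D f : (0 <= sqint D f)%E.
Proof. by apply: integral_ge0 => x _; rewrite lee_fin sqr_ge0. Qed.

Lemma measurable_sqr D f : measurable_fun D f ->
  measurable_fun D (fun x => (f x ^+ 2)%:E).
Proof.
by move=> mf; apply/measurable_EFinP; exact: measurable_funX.
Qed.

Lemma eq_sqint D f g : (forall x, D x -> f x ^+ 2 = g x ^+ 2) -> sqint D f = sqint D g.
Proof. by move=> fg; apply: eq_integral => x /set_mem Dx; rewrite fg. Qed.

Lemma le_sqint D f g : (forall x, D x -> f x ^+ 2 <= g x ^+ 2) ->
  (sqint D f <= sqint D g)%E.
Proof.
by move=> fg; apply: ge0_integral_mono => x Dx; rewrite !lee_fin sqr_ge0 fg.
Qed.

Lemma sqintZ D f (c : R) : measurable D -> measurable_fun D f ->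
  sqint D (fun x => c * f x) = ((c ^+ 2)%:E * sqint D f)%E.
Proof.
move=> mD mf; rewrite /sqint -ge0_integralZl_EFin ?sqr_ge0//.
- by apply: eq_integral => x _; rewrite -EFinM exprMn.
- by move=> x _; rewrite lee_fin sqr_ge0.
- exact: measurable_sqr.
Qed.

Lemma sqint_bounded_mul D f (c : T -> R) (M : R) : measurable D ->
  measurable_fun D f -> (forall x, D x -> `|c x| <= M) ->
  (sqint D (fun x => c x * f x)%R <= (M ^+ 2)%:E * sqint D f)%E.
Proof.
move=> mD mf cM; rewrite -sqintZ//; apply: le_sqint => x Dx.
rewrite !exprMn ler_wpM2r ?sqr_ge0//.
rewrite -(real_normK (num_real (c x))) lerXn2r ?nnegrE ?cM//.
exact: le_trans (normr_ge0 _) (cM x Dx).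
Qed.

Lemma sqintD D f g : measurable D -> measurable_fun D f -> measurable_fun D g ->
  (sqint D (fun x => f x + g x)%R <= 2%:E * sqint D f + 2%:E * sqint D g)%E.
Proof.
move=> mD mf mg.
rewrite /sqint -!ge0_integralZl_EFin//; do ?exact: measurable_sqr;
  do ?by move=> x _; rewrite lee_fin sqr_ge0.
rewrite -ge0_integralD//.
- apply: ge0_le_integral => //.
  + by move=> x _; rewrite lee_fin sqr_ge0.
  + by apply: measurable_sqr; exact: measurable_funD.
  + by apply: emeasurable_funD; apply: emeasurable_funM => //; exact: measurable_sqr.
  + move=> x _; rewrite -!EFinM -EFinD lee_fin.
    have := sqr_ge0 (f x - g x); rewrite sqrrB sqrrD.
    set a := f x ^+ 2; set b := g x ^+ 2; set c := f x * g x *+ 2; lra.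
- by move=> x _; rewrite -EFinM lee_fin mulr_ge0 ?sqr_ge0.
- by apply: emeasurable_funM => //; exact: measurable_sqr.
- by move=> x _; rewrite -EFinM lee_fin mulr_ge0 ?sqr_ge0.
- by apply: emeasurable_funM => //; exact: measurable_sqr.
Qed.

Lemma sqint_sym D f g : sqint D (fun x => f x - g x) = sqint D (fun x => g x - f x).
Proof. by apply: eq_sqint => x _; rewrite -sqrrN opprB. Qed.

Lemma sqint_triangle D f g h : measurable D ->
  measurable_fun D f -> measurable_fun D g -> measurable_fun D h ->
  (sqint D (fun x => f x - h x)%R <=
   2%:E * sqint D (fun x => f x - g x)%R + 2%:E * sqint D (fun x => g x - h x)%R)%E.
Proof.
move=> mD mf mg mh; rewrite (@eq_sqint D (fun x => f x - h x)
  (fun x => (f x - g x) + (g x - h x))); last by move=> x _; rewrite subrKA.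
by apply: sqintD => //; exact: measurable_funB.
Qed.

Lemma sqint_triangle_le D f g h (a b : R) : measurable D ->
  measurable_fun D f -> measurable_fun D g -> measurable_fun D h ->
  (sqint D (fun x => f x - g x)%R <= a%:E)%E ->
  (sqint D (fun x => g x - h x)%R <= b%:E)%E ->
  (sqint D (fun x => f x - h x)%R <= (2 * a + 2 * b)%:E)%E.
Proof.
move=> mD mf mg mh fga ghb.
apply: (le_trans (sqint_triangle mD mf mg mh)).
have -> : (2 * a + 2 * b)%:E = (2%:E * a%:E + 2%:E * b%:E)%E by [].
by apply: leeD; rewrite lee_wpmul2l// lee_fin.
Qed.

Lemma sqint_eq0 f g : measurable_fun setT f -> measurable_fun setT g ->
  sqint setT (fun x => f x - g x)%R = 0%E -> f = g %[ae mu].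
Proof.
move=> mf mg fg0.
have : (\int[mu]_(x in setT) `|((f x - g x) ^+ 2)%:E| = 0)%E.
  rewrite -fg0; apply: eq_integral => x _.
  by rewrite abse_EFin ger0_norm// sqr_ge0.
move=> /(ae_eq_integral_abs mu measurableT) h.
have : ae_eq mu setT (fun x => ((f x - g x) ^+ 2)%:E) (cst 0%E).
  by apply: h; apply: measurable_sqr; exact: measurable_funB.
apply: filterS => x /(_ Logic.I) /= [] /eqP.
by rewrite sqrf_eq0 subr_eq0 => /eqP.
Qed.

Lemma ae_eq_sqint f g : measurable_fun setT f -> measurable_fun setT g ->
  f = g %[ae mu] -> sqint setT f = sqint setT g.
Proof.
move=> mf mg fg; apply: ge0_ae_eq_integral => //.
- exact: measurable_sqr.
- exact: measurable_sqr.
- by move=> x _; rewrite lee_fin sqr_ge0.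
- by move=> x _; rewrite lee_fin sqr_ge0.
- by apply: filterS fg => x fgx _ /=; rewrite fgx.
Qed.

Lemma Lnorm2_sqr f : ('N[mu]_2%:E[EFin \o f] ^+ 2)%E = sqint setT f.
Proof.
have -> : sqint setT f = ('N[mu]_2%:E[EFin \o f] `^ 2)%E.
  rewrite poweR_Lnorm//; apply: eq_integral => x _ /=.
  by rewrite powR_mulrn// real_normK// num_real.
have := Lnorm_ge0 mu 2%:E (EFin \o f).
case: ('N[mu]_2%:E[EFin \o f])%E => [a| |//].
- by rewrite lee_fin => a0; rewrite poweR_EFin powR_mulrn.
- by move=> _; rewrite poweRyr// expe2 mulyy.
Qed.

Lemma Lnorm2_le f (r : R) : 0 <= r ->
  ('N[mu]_2%:E[EFin \o f] <= r%:E)%E = (sqint setT f <= (r ^+ 2)%:E)%E.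
Proof.
move=> r0; rewrite -Lnorm2_sqr.
have := Lnorm_ge0 mu 2%:E (EFin \o f).
case: ('N[mu]_2%:E[EFin \o f])%E => [a| |//].
- rewrite lee_fin => a0; rewrite -EFin_expe !lee_fin.
  by rewrite ler_sqr.
- by move=> _; rewrite expe2 mulyy !leye_eq.
Qed.

Lemma Lnorm2_lty f : ('N[mu]_2%:E[EFin \o f] < +oo)%E = (sqint setT f < +oo)%E.
Proof.
rewrite -Lnorm2_sqr.
have := Lnorm_ge0 mu 2%:E (EFin \o f).
case: ('N[mu]_2%:E[EFin \o f])%E => [a| |//] _; first by rewrite -EFin_expe !ltry.
by rewrite expe2 mulyy.
Qed.

Lemma Lnorm2_cvg0 (f : nat -> T -> R) :
  ('N[mu]_2%:E[EFin \o f n])%E @[n --> \oo] --> 0%E <->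
  sqint setT (f n) @[n --> \oo] --> 0%E.
Proof.
split => /cvge0P h; apply/cvge0P => [n|e e0]; first exact: sqint_ge0.
- have := h (fun=> Lnorm_ge0 _ _ _) (Num.sqrt e).
  rewrite sqrtr_gt0 => /(_ e0); apply: filterS => n.
  by rewrite Lnorm2_le ?sqrtr_ge0// sqr_sqrtr// ltW.
- exact: Lnorm_ge0.
- have := h (fun=> sqint_ge0 _ _) (e ^+ 2).
  rewrite exprn_gt0// => /(_ isT); apply: filterS => n.
  by rewrite Lnorm2_le// ltW.
Qed.

Lemma Lfun2P f : f \in Lfun mu 2%:E <->
  measurable_fun setT f /\ (sqint setT f < +oo)%E.
Proof.
split.
  case/andP; rewrite !inE/= => mf.
  by rewrite /finite_norm Lnorm2_lty.
move=> [mf ff]; rewrite inE; apply/andP; split; rewrite inE//=.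
by rewrite /finite_norm Lnorm2_lty.
Qed.

End sqint.
Arguments sqint {d T R} mu D f.

Lemma limn_einf_le (R : realType) (u : nat -> \bar R) (c : \bar R) :
  (\forall n \near \oo, (u n <= c)%E) -> (limn_einf u <= c)%E.
Proof.
move=> [K _ uc]; rewrite limn_einf_lim; apply: lime_le; first exact: is_cvg_einfs.
apply: nearW => n; apply: (le_trans _ (uc (maxn n K) (leq_maxr _ _))).
by apply: ereal_inf_lbound; exists (maxn n K) => //=; exact: leq_maxl.
Qed.

Lemma limn_einf_ge0 (R : realType) (u : nat -> \bar R) :
  (forall n, (0 <= u n)%E) -> (0 <= limn_einf u)%E.
Proof.
move=> u0; rewrite limn_einf_lim; apply: lime_ge; first exact: is_cvg_einfs.
by apply: nearW => n; apply: le_ereal_inf_tmp => _ [k _ <-].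
Qed.

Lemma measurable_limn_einf (d : measure_display) (T : measurableType d)
    (R : realType) (D : set T) (f : nat -> T -> \bar R) :
  (forall n, measurable_fun D (f n)) ->
  measurable_fun D (fun x => limn_einf (f ^~ x)).
Proof.
move=> mf.
rewrite (_ : (fun x => _) = (fun x => - limn_esup (fun n => - f n x))%E); last first.
  apply/funext => x; rewrite -[LHS]oppeK -limn_esupN.
  by [].
apply: measurableT_comp => //; apply: measurable_fun_limn_esup => n.
exact: measurableT_comp.
Qed.

(** By |f| <= c / 2 + f^2 / (2 c), which follows from (|f| - c)^2 >= 0. *)
Lemma mean_abs_le (d : measure_display) (T : measurableType d) (R : realType)
    (P : probability T R) (f : T -> R) (c s : R) : 0 < c ->
  measurable_fun setT f -> (sqint P setT f <= s%:E)%E ->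
  (\int[P]_w `|f w|%:E <= ((c + s / c) / 2)%:E)%E.
Proof.
move=> c0 mf fs; pose a := c / 2; pose b := (2 * c)^-1.
have a0 : 0 <= a by rewrite divr_ge0// ltW.
have b0 : 0 <= b by rewrite invr_ge0 mulr_ge0// ltW.
have mb : measurable_fun setT (fun w => b%:E * (f w ^+ 2)%:E)%E.
  by apply: emeasurable_funM => //; exact: measurable_sqr.
apply: (@le_trans _ _ (\int[P]_w (cst a%:E w + b%:E * (f w ^+ 2)%:E))%E).
  apply: ge0_le_integral => //.
  - by apply/measurable_EFinP; exact: measurableT_comp.
  - exact: emeasurable_funD.
  - move=> w _ /=; rewrite -EFinM -EFinD lee_fin.
    rewrite -(real_normK (num_real (f w))); move: `|f w| => x; rewrite -subr_ge0.
    have -> : a + b * x ^+ 2 - x = b * (c - x) ^+ 2.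
      by rewrite /a /b; field; rewrite gt_eqF.
    by rewrite mulr_ge0 ?sqr_ge0.
rewrite ge0_integralD//; last by move=> w _; rewrite -EFinM lee_fin mulr_ge0// sqr_ge0.
rewrite integral_cst// [X in (_ * X + _)%E]probability_setT mule1.
rewrite ge0_integralZl_EFin//; first last.
- exact: measurable_sqr.
- by move=> w _; rewrite lee_fin sqr_ge0.
apply: (@le_trans _ _ (a%:E + b%:E * s%:E)%E).
  by apply: leeD2l; apply: lee_wpmul2l.
rewrite -EFinM -EFinD lee_fin (_ : a + b * s = (c + s / c) / 2)//.
by rewrite /a /b; field; rewrite gt_eqF.
Qed.

(** A mean-square Cauchy sequence has a subsequence whose successive increments
    have summable means; it converges almost surely, and Fatou's lemma turns the
    almost sure limit into a mean-square limit of the whole sequence. *)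
Lemma L2_complete (d : measure_display) (T : measurableType d) (R : realType)
    (P : probability T R) (X : nat -> T -> R) :
  (forall n, measurable_fun setT (X n)) ->
  (forall e : R, 0 < e -> exists N, forall n m, (N <= n)%N -> (N <= m)%N ->
    (sqint P setT (fun w => X n w - X m w)%R <= e%:E)%E) ->
  exists J : T -> R, measurable_fun setT J /\
    sqint P setT (fun w => X n w - J w)%R @[n --> \oo] --> 0%E.
Proof.
move=> mX cX.
have q0 k : 0 < (4^-1 : R) ^+ k by rewrite exprn_gt0.
(* Increments of squared norm 4^-k have mean absolute value at most 2^-k. *)
pose N k := sval (cid (cX _ (q0 k))).
have NP k n m : (N k <= n)%N -> (N k <= m)%N ->
    (sqint P setT (fun w => X n w - X m w)%R <= ((4^-1 : R) ^+ k)%:E)%E.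
  by rewrite /N; case: cid => /= n0; exact.
pose ph k := \max_(i < k.+1) N i.
have Nph k j : (k <= j)%N -> (N k <= ph j)%N.
  move=> kj; rewrite /ph.
  exact: (leq_bigmax (Ordinal (kj : (k < j.+1)%N))).
pose D k w := X (ph k.+1) w - X (ph k) w.
have mDD k : measurable_fun setT (D k) by exact: measurable_funB.
have sD k : (sqint P setT (D k) <= ((4^-1 : R) ^+ k)%:E)%E.
  by apply: NP; exact: Nph.
have iD k : (\int[P]_w `|D k w|%:E <= ((2^-1 : R) ^+ k)%:E)%E.
  have c0 : 0 < (2^-1 : R) ^+ k by rewrite exprn_gt0.
  have := mean_abs_le c0 (mDD k) (sD k).
  have -> : (4^-1 : R) ^+ k / 2^-1 ^+ k = 2^-1 ^+ k.
    by rewrite -expr_div_n; congr (_ ^+ k); field.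
  by rewrite (_ : _ / 2 = 2^-1 ^+ k)//; field.
have sumD : (\int[P]_w (\sum_(k <oo) `|D k w|%:E) < +oo)%E.
  rewrite integral_nneseries//; last first.
    by move=> k; apply/measurable_EFinP; exact: measurableT_comp.
  apply: (@le_lt_trans _ _ (\sum_(k <oo) ((2^-1 : R) ^+ k)%:E)%E).
    by apply: lee_nneseries => // k _; rewrite integral_ge0.
  apply: (@le_lt_trans _ _ (2 : R)%:E); last exact: ltry.
  apply: lime_le; first by apply: is_cvg_nneseries => k _ _; rewrite lee_fin exprn_ge0.
  apply: nearW => n; rewrite sumEFin lee_fin.
  have := @geometric_le_lim R n 1 2^-1 ltac:(lra) ltac:(lra).
  rewrite (ger0_norm (_ : 0 <= 2^-1)) ?invr_ge0//.
  move=> /(_ ltac:(lra)); rewrite [X in X <= _](_ : _ = \sum_(0 <= k < n) 2^-1 ^+ k).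
    by rewrite (_ : 1 / (1 - 2^-1) = 2 :> R)//; field.
  by rewrite /series /=; apply: eq_bigr => i _; rewrite mul1r.
have msum : measurable_fun setT (fun w => \sum_(k <oo) `|D k w|%:E)%E.
  apply: ge0_emeasurable_sum => // k _.
  by apply/measurable_EFinP; exact: measurableT_comp.
have cvgX : {ae P, forall w, cvgn (fun k => X (ph k) w)}.
  have : {ae P, forall w, setT w -> (\sum_(k <oo) `|D k w|%:E \is a fin_num)%E}.
    apply: integrable_ae => //; apply/integrableP; split => //.
    under eq_integral do rewrite gee0_abs ?nneseries_ge0//.
    by [].
  apply: filterS => w /(_ Logic.I).
  rewrite ge0_fin_numE ?nneseries_ge0// => sw.
  have /normed_cvg : cvgn [normed series (fun k => D k w)].
    exact: (nnseries_is_cvg _ sw).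
  rewrite (_ : series _ = [sequence X (ph n) w - X (ph 0%N) w]_n); last first.
    by rewrite -telescopeK.
  move=> /(is_cvgD) /(_ (is_cvg_cst (X (ph 0%N) w))).
  by congr (cvgn _); apply/funext => k /=; rewrite fctE /= subrK.
pose J w := fine (limn_esup (fun k => (X (ph k) w)%:E)).
have mJ : measurable_fun setT J.
  apply: (measurableT_comp (@fine_measurable R setT measurableT)) => //.
  apply: measurable_fun_limn_esup => k; exact/measurable_EFinP.
have JE w : cvgn (fun k => X (ph k) w) -> X (ph k) w @[k --> \oo] --> J w.
  move=> cw; have : (X (ph k) w)%:E @[k --> \oo] --> (limn (fun k => X (ph k) w))%:E.
    by apply: cvg_EFin; [exact: nearW|exact: cw].
  by move=> /cvg_limn_einf_sup[_ h]; rewrite /J h.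
exists J; split => //; apply/cvge0P => [n|e e0]; first exact: sqint_ge0.
have [k ke] : exists k, (4^-1 : R) ^+ k <= e.
  have := @cvg_expr R 4^-1.
  rewrite (ger0_norm (_ : 0 <= 4^-1)) ?invr_ge0//.
  move=> /(_ ltac:(lra)) /cvgrPdist_le /(_ _ e0) [k _ /(_ k (leqnn k))].
  rewrite sub0r normrN ger0_norm ?exprn_ge0 ?invr_ge0//.
  by exists k.
exists (N k) => // n /= Nn.
have -> : sqint P setT (fun w => X n w - J w) =
    (\int[P]_w limn_einf (fun j => ((X n w - X (ph j) w) ^+ 2)%:E))%E.
  apply: ge0_ae_eq_integral => //.
  - by apply: measurable_sqr; exact: measurable_funB.
  - apply: measurable_limn_einf => j.
    by apply: measurable_sqr; exact: measurable_funB.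
  - by move=> w _; rewrite lee_fin sqr_ge0.
  - move=> w _; apply: limn_einf_ge0 => j; by rewrite lee_fin sqr_ge0.
  apply: filterS cvgX => w cw _; apply/esym.
  have : ((X n w - X (ph j) w) ^+ 2)%:E @[j --> \oo] --> ((X n w - J w) ^+ 2)%:E.
    apply: cvg_EFin; first exact: nearW.
    have cB : X n w - X (ph j) w @[j --> \oo] --> X n w - J w.
      by apply: cvgB; [exact: cvg_cst|exact: JE].
    exact: (cvgM cB cB).
  by move=> /cvg_limn_einf_sup[].
apply: (le_trans (fatou _ _ _ _)) => //.
- by move=> j; apply: measurable_sqr; exact: measurable_funB.
- by move=> j w _; rewrite lee_fin sqr_ge0.
apply: limn_einf_le; exists k => // j /= kj.
by rewrite (le_trans (NP k n (ph j) Nn (Nph _ _ kj)))// lee_fin.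
Qed.

(** * Integration of finite sums *)

Section has_int.
Context (d : measure_display) (T : measurableType d) (R : realType).
Variables (mu : {measure set T -> \bar R}) (D : set T).
Hypothesis mD : measurable D.
Implicit Types f g : T -> R.

(** Integrability together with the value: the form in which finite double sums
    can be integrated term by term without leaving the real numbers. *)
Definition has_int f (r : R) :=
  mu.-integrable D (EFin \o f) /\ (\int[mu]_(x in D) (f x)%:E = r%:E)%E.

Lemma integrable_has_int f : mu.-integrable D (EFin \o f) ->
  has_int f (fine (\int[mu]_(x in D) (f x)%:E)%E).
Proof. by move=> fi; split => //; rewrite fineK//; exact: integrable_fin_num. Qed.

Lemma eq_has_int f g r : (forall x, D x -> f x = g x) -> has_int f r -> has_int g r.
Proof.
move=> fg [fi fr]; split.
  by apply: eq_integrable fi => // x /set_mem Dx /=; rewrite fg.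
by rewrite -fr; apply: eq_integral => x /set_mem Dx; rewrite fg.
Qed.

Lemma has_int0 : has_int (fun=> 0) 0.
Proof.
split; first exact: integrable0.
by rewrite integral0_eq.
Qed.

Lemma has_intD f g r s : has_int f r -> has_int g s ->
  has_int (fun x => f x + g x) (r + s).
Proof.
move=> [fi fr] [gi gs]; split.
  by apply: eq_integrable (integrableD mD fi gi).
by rewrite (integralD_EFin mD fi gi) fr gs.
Qed.

Lemma has_intZ f (c r : R) : has_int f r -> has_int (fun x => c * f x) (c * r).
Proof.
move=> [fi fr]; split; first exact: (integrableZl mD c fi).
by rewrite (integralZl mD fi c) fr.
Qed.

Lemma has_intB f g r s : has_int f r -> has_int g s ->
  has_int (fun x => f x - g x) (r - s).
Proof.
move=> fr /(has_intZ (-1)) gs; have := has_intD fr gs.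
by rewrite mulN1r; apply: eq_has_int => x _; rewrite mulN1r.
Qed.

Lemma has_int_sum (I : eqType) (s : seq I) (f : I -> T -> R) (r : I -> R) :
  (forall i, i \in s -> has_int (f i) (r i)) ->
  has_int (fun x => \sum_(i <- s) f i x) (\sum_(i <- s) r i).
Proof.
elim: s => [|i s IH] H.
  by rewrite big_nil; apply: eq_has_int has_int0 => x _; rewrite big_nil.
rewrite big_cons.
apply: eq_has_int (has_intD (H i (mem_head _ _)) (IH _)) => [x _|j js].
  by rewrite big_cons.
by apply: H; rewrite inE js orbT.
Qed.

Lemma has_int_indic (A : set T) : measurable A -> A `<=` D -> (mu A < +oo)%E ->
  has_int \1_A (fine (mu A)).
Proof.
move=> mA AD Afin.
have Af : mu A \is a fin_num by rewrite ge0_fin_numE.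
have Ai : (\int[mu]_(x in D) (\1_A x)%:E = mu A)%E.
  by rewrite integral_indic// setIidl.
split; last by rewrite fineK.
apply/integrableP; split; first by apply/measurable_EFinP; exact: measurable_indic.
rewrite (eq_integral (fun x => (\1_A x)%:E)) ?Ai// => x _.
by rewrite /= ger0_norm.
Qed.

End has_int.
Arguments has_int {d T R} mu D f r.

Lemma sqr_sum (R : realType) (I : Type) (s : seq I) (a : I -> R) :
  (\sum_(i <- s) a i) ^+ 2 = \sum_(i <- s) \sum_(j <- s) a i * a j.
Proof.
rewrite expr2 mulr_suml; apply: eq_bigr => i _.
by rewrite mulr_sumr.
Qed.

(** * Independence and Gaussian increments *)

(** The joint law of an independent pair is the product of the laws, so Fubini's
    theorem computes the mean of the product. *)
Lemma independent_mean (d : measure_display) (Om : measurableType d)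
    (R : realType) (P : probability Om R) (Y Z : {mfun Om >-> R}) (y z : R) :
  (forall A B : set R, measurable A -> measurable B ->
    P (Y @^-1` A `&` Z @^-1` B) = (P (Y @^-1` A) * P (Z @^-1` B))%E) ->
  has_int P setT Y y -> has_int P setT Z z ->
  has_int P setT (fun w => Y w * Z w) (y * z).
Proof.
move=> YZ [Yi Yy] [Zi Zz].
have mYZ : measurable_fun setT (fun w => (Y w, Z w)).
  by apply: measurable_fun_pair.
pose V : {mfun Om >-> (R * R)%type} := HB.pack (fun w => (Y w, Z w))
  (isMeasurableFun.Build _ _ _ _ (fun w => (Y w, Z w)) mYZ).
pose g (p : R * R) := (p.1 * p.2)%:E.
have mg : measurable_fun setT g.
  by apply/measurable_EFinP; apply: measurable_funM.
have E (X : set (R * R)) : measurable X ->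
    (distribution P Y \x distribution P Z)%E X = distribution P V X.
  apply: product_measure_unique => A B mA mB.
  by rewrite -YZ.
have SW (h : R * R -> \bar R) : (\int[distribution P Y \x distribution P Z]_p h p =
    \int[distribution P V]_p h p)%E.
  by apply: eq_measure_integral => A mA _; exact: E.
have iabs (X : {mfun Om >-> R}) : P.-integrable setT (EFin \o X) ->
    (\int[distribution P X]_x `|x%:E| < +oo)%E.
  move=> /integrableP[_]; rewrite ge0_integral_distribution//.
  exact: measurableT_comp.
have Vabs : (\int[P]_w `|g (V w)| =
    \int[distribution P Y]_x `|x%:E| * \int[distribution P Z]_x `|x%:E|)%E.
  have mag : measurable_fun setT (abse \o g) by exact: measurableT_comp.
  rewrite -(ge0_integral_distribution V (f := abse \o g))//; last by move=> p; exact: abse_ge0.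
  rewrite -SW fubini_tonelli1//; last by move=> p; exact: abse_ge0.
  rewrite /fubini_F /g /= -ge0_integralZr//; last 2 first.
  - exact: measurableT_comp.
  - by apply: integral_ge0.
  apply: eq_integral => x _.
  rewrite -ge0_integralZl//; last exact: measurableT_comp.
  by apply: eq_integral => t _; rewrite normrM EFinM.
have gi : P.-integrable setT (g \o V).
  apply/integrableP; split; first exact: measurableT_comp.
  rewrite /= Vabs lte_mul_pinfty//; last exact: iabs.
  - by apply: integral_ge0.
  - by rewrite ge0_fin_numE ?integral_ge0//; exact: iabs.
split; first exact: gi.
have gi2 : (distribution P Y \x distribution P Z)%E.-integrable setT g.
  apply/integrableP; split => //.
  rewrite SW.
  move/integrableP : gi => [_].
  by rewrite ge0_integral_distribution//; exact: measurableT_comp.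
rewrite -[LHS]/(\int[P]_w (g \o V) w)%E -integral_distribution//.
rewrite -SW.
rewrite -integral12_prod_meas1// /fubini_F /g /=.
have dZ : (distribution P Z).-integrable setT EFin.
  apply/integrableP; split; first exact/measurable_EFinP.
  exact: iabs.
have dY : (distribution P Y).-integrable setT EFin.
  apply/integrableP; split; first exact/measurable_EFinP.
  exact: iabs.
under eq_integral do under eq_integral do rewrite EFinM.
under eq_integral do rewrite integralZl//.
have -> : (\int[distribution P Z]_x x%:E = z%:E)%E.
  by rewrite integral_distribution//; exact/measurable_EFinP.
rewrite integralZr//.
have -> : (\int[distribution P Y]_x x%:E = y%:E)%E.
  by rewrite integral_distribution//; exact/measurable_EFinP.
by [].
Qed.

Lemma normal_prob_sym (R : realType) (s : R) (B : set R) : s != 0 -> measurable B ->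
  normal_prob 0 s (-%R @^-1` B) = normal_prob 0 s B.
Proof.
move=> s0 mB; rewrite /normal_prob.
transitivity (\int[pushforward lebesgue_measure (-%R : R -> measurableTypeR R)]_(x in B)
    (normal_pdf 0 s x)%:E)%E; last first.
  by apply: eq_measure_integral => A mA _; exact: lebesgue_measureN.
rewrite ge0_integral_pushforward//; last 2 first.
- by apply/measurable_EFinP; apply: measurable_funTS; exact: measurable_normal_pdf.
- by move=> y _; rewrite lee_fin normal_pdf_ge0.
apply: eq_integral => x _ /=; congr EFin.
by rewrite !normal_pdfE// /normal_fun !subr0 sqrrN.
Qed.

(** A centered normal variable and its opposite have the same law, hence the same
    mean. *)
Lemma centered_normal_mean (d : measure_display) (Om : measurableType d)
    (R : realType) (P : probability Om R) (s : R) (X : Om -> R) :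
  centered_normal P s X -> P.-integrable setT (EFin \o X) ->
  (\int[P]_w (X w)%:E = 0)%E.
Proof.
move=> [mX]; case: ifPn => [_ X0 Xi|s0 XN Xi].
  rewrite (ae_eq_integral (cst 0%E))//; first by rewrite integral_cst// mul0e.
  - exact: measurable_int Xi.
  - by apply: filterS X0 => w Xw _ /=; rewrite Xw.
pose X' : {mfun Om >-> R} := HB.pack X (isMeasurableFun.Build _ _ _ _ X mX).
have mN : measurable_fun setT (\- X)%R by exact: measurable_funN.
pose N : {mfun Om >-> R} := HB.pack (\- X)%R (isMeasurableFun.Build _ _ _ _ (\- X)%R mN).
have Ni : P.-integrable setT (EFin \o N) by apply: (integrableN Xi).
have XN' : (\int[P]_w (X w)%:E = \int[P]_w (N w)%:E)%E.
  rewrite -(integral_distribution (X := X') (f := EFin))//.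
  rewrite -(integral_distribution (X := N) (f := EFin))//.
  apply: eq_measure_integral => B mB _.
  change (P (X @^-1` B) = P (X @^-1` (-%R @^-1` B))).
  rewrite XN// XN ?normal_prob_sym//.
  by rewrite -[X in measurable X]setTI; exact: oppr_measurable.
have : (\int[P]_w (X w)%:E = - \int[P]_w (X w)%:E)%E.
  rewrite {1}XN' -integralN//.
  by rewrite fin_num_adde_defl// fin_numN; exact: integrable_neg_fin_num.
have := integrable_fin_num measurableT Xi.
rewrite /=; case: (\int[P]_w (X w)%:E)%E => // r _ [] /eqP.
by rewrite -addr_eq0 -mulr2n mulrn_eq0/= => /eqP ->.
Qed.

(** * The isometry on simple functions *)

Section measurable_wrt.
Context (d : measure_display) (Om : measurableType d) (R : realType).
Implicit Types (G H : set (set Om)) (X Y : Om -> R).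

Lemma measurable_wrtP G X : sigma_algebra setT G ->
  measurable_wrt G measurable X <->
  measurable_fun (setT : set (g_sigma_algebraType G)) X.
Proof.
move=> sG; split => [GX _ B mB|mX B mB].
  by rewrite setTI; apply: sub_sigma_algebra; exact: GX.
have := mX measurableT B mB; rewrite setTI.
by rewrite /measurable /= sigma_algebra_id.
Qed.

Lemma measurable_wrt_sub G H X : G `<=` H ->
  measurable_wrt G measurable X -> measurable_wrt H measurable X.
Proof. by move=> GH GX B mB; exact/GH/GX. Qed.

Lemma measurable_wrt_fun G X : G `<=` measurable ->
  measurable_wrt G measurable X -> measurable_fun setT X.
Proof. by move=> Gm GX _ B mB; rewrite setTI; exact/Gm/GX. Qed.

Lemma measurable_wrtM G X Y : sigma_algebra setT G ->
  measurable_wrt G measurable X -> measurable_wrt G measurable Y ->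
  measurable_wrt G measurable (fun w => X w * Y w).
Proof.
move=> sG /(measurable_wrtP _ sG) mX /(measurable_wrtP _ sG) mY.
by apply/(measurable_wrtP _ sG); exact: measurable_funM.
Qed.

Lemma measurable_wrtB G X Y : sigma_algebra setT G ->
  measurable_wrt G measurable X -> measurable_wrt G measurable Y ->
  measurable_wrt G measurable (fun w => X w - Y w).
Proof.
move=> sG /(measurable_wrtP _ sG) mX /(measurable_wrtP _ sG) mY.
by apply/(measurable_wrtP _ sG); exact: measurable_funB.
Qed.

End measurable_wrt.

Section Lfun2.
Context (d : measure_display) (Om : measurableType d) (R : realType).
Variable P : probability Om R.
Implicit Types X Y : Om -> R.

Lemma Lfun2B X Y : X \in Lfun P 2%:E -> Y \in Lfun P 2%:E ->
  (fun w => X w - Y w) \in Lfun P 2%:E.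
Proof.
move=> /Lfun2P[mX fX] /Lfun2P[mY fY]; apply/Lfun2P; split.
  exact: measurable_funB.
have := sqint_triangle P measurableT mX (measurable_cst (0 : R)) mY.
move=> /le_lt_trans; apply.
rewrite (eq_sqint P (D := setT) (g := X)); last by move=> w _; rewrite subr0.
rewrite [X in (_ + _ * X)%E](eq_sqint P (D := setT) (g := Y)); last first.
  by move=> w _; rewrite sub0r sqrrN.
by rewrite lte_add_pinfty// lte_mul_pinfty.
Qed.

Lemma Lfun2D X Y : X \in Lfun P 2%:E -> Y \in Lfun P 2%:E ->
  (fun w => X w + Y w) \in Lfun P 2%:E.
Proof.
move=> X2 Y2; have := Lfun2B X2 (Lfun2B (Lfun_cst P 0 2) Y2).
rewrite (_ : (fun w => _) = (fun w => X w + Y w))//.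
by apply/funext => w; rewrite /= sub0r opprK.
Qed.

Lemma Lfun2_bounded_mul X Y (M : R) : measurable_fun setT X ->
  (forall w, `|X w| <= M) -> Y \in Lfun P 2%:E ->
  (fun w => X w * Y w) \in Lfun P 2%:E.
Proof.
move=> mX XM /Lfun2P[mY fY]; apply/Lfun2P; split; first exact: measurable_funM.
apply: le_lt_trans (sqint_bounded_mul P (M := M) _ _ _) _ => //.
by rewrite lte_mul_pinfty// lee_fin sqr_ge0.
Qed.

Lemma Lfun2_bounded X (M : R) : measurable_fun setT X ->
  (forall w, `|X w| <= M) -> X \in Lfun P 2%:E.
Proof.
move=> mX XM; have := Lfun2_bounded_mul mX XM (Lfun_cst P 1 2).
rewrite (_ : (fun w => X w * cst 1 w) = X)//.
by apply/funext => w; rewrite mulr1.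
Qed.

Lemma Lfun2_has_int X : X \in Lfun P 2%:E -> exists r, has_int P setT X r.
Proof.
move=> X2; eexists; apply: integrable_has_int => //.
apply/Lfun1_integrable; apply: (Lfun_subset12 _ X2).
exact: fin_num_measure.
Qed.

End Lfun2.

(** The length of the intersection of two intervals. *)
Definition overlap (R : realType) (a b a' b' : R) : R :=
  Num.max 0 (Num.min b b' - Num.max a a').

Lemma overlapC (R : realType) (a b a' b' : R) : overlap a b a' b' = overlap a' b' a b.
Proof. by rewrite /overlap minC (maxC a). Qed.

Section white_noise.
Context (R : realType) (d : nat) (dO : measure_display)
  (Om : measurableType dO) (P : probability Om R).
Variables (F : R -> set (set Om)) (W : R -> set (Rn R d) -> Om -> R).
Hypotheses (hF : filtration F) (hW : white_noise P F W).
Local Notation mes := (lebesgue_tuple R d).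
Implicit Types (A B : set (Rn R d)) (X Y : Om -> R) (s t a b c : R).

Lemma wn_adapted t A : 0 <= t -> finite_borel A ->
  measurable_wrt (F t) measurable (W t A).
Proof. by move=> t0 hA; exact: (wiener_adapted (wn_wiener hW hA)). Qed.

Lemma wn_measurable t A : 0 <= t -> finite_borel A -> measurable_fun setT (W t A).
Proof.
move=> t0 hA; apply: measurable_wrt_fun (wn_adapted t0 hA).
exact: (filtration_sub hF).
Qed.

Lemma finite_borelI A B : finite_borel A -> finite_borel B -> finite_borel (A `&` B).
Proof.
move=> [mA fA] [mB fB]; split; first exact: measurableI.
by rewrite (le_lt_trans _ fA)// le_measure// ?inE//; exact: measurableI.
Qed.

Lemma finite_borel_fin A : finite_borel A -> mes A \is a fin_num.
Proof. by move=> [_ fA]; rewrite ge0_fin_numE. Qed.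

Lemma wn_Lfun2 t A : 0 <= t -> finite_borel A -> W t A \in Lfun P 2%:E.
Proof.
move=> t0 hA; apply/Lfun2P; split; first exact: wn_measurable.
have := wn_covariance hW t0 t0 hA hA; rewrite unlock setIid => e.
rewrite /sqint (eq_integral (fun w => ((W t A \* W t A) w)%:E)).
  by rewrite e -(fineK (finite_borel_fin hA)) -EFinM ltry.
by move=> w _; rewrite /= expr2.
Qed.

Lemma wn_cov s t A B : 0 <= s -> 0 <= t -> finite_borel A -> finite_borel B ->
  has_int P setT (fun w => W t A w * W s B w)
    (Num.min t s * fine (mes (A `&` B))).
Proof.
move=> s0 t0 hA hB; split.
  by apply/Lfun1_integrable; apply: Lfun2_mul_Lfun1; exact: wn_Lfun2.
have := wn_covariance hW s0 t0 hA hB; rewrite unlock => ->.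
by rewrite EFinM fineK// finite_borel_fin//; exact: finite_borelI.
Qed.

Lemma wn_incr_Lfun2 a b A : 0 <= a -> 0 <= b -> finite_borel A ->
  (fun w => W b A w - W a A w) \in Lfun P 2%:E.
Proof. by move=> a0 b0 hA; apply: Lfun2B; exact: wn_Lfun2. Qed.

Lemma wn_incr_mean a b A : 0 <= a -> a <= b -> finite_borel A ->
  has_int P setT (fun w => W b A w - W a A w) 0.
Proof.
move=> a0 ab hA; have b0 := le_trans a0 ab.
have [r ri] := Lfun2_has_int (wn_incr_Lfun2 a0 b0 hA).
split; first exact: ri.1.
exact: centered_normal_mean (wiener_normal (wn_wiener hW hA) a0 ab) ri.1.
Qed.

Lemma wn_incr_cov c b b' A B : 0 <= c -> c <= b -> c <= b' ->
  finite_borel A -> finite_borel B ->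
  has_int P setT (fun w => (W b A w - W c A w) * (W b' B w - W c B w))
    ((Num.min b b' - c) * fine (mes (A `&` B))).
Proof.
move=> c0 cb cb' hA hB; have [b0 b'0] := (le_trans c0 cb, le_trans c0 cb').
set m := fine _.
have h1 := wn_cov b'0 b0 hA hB; have h2 := wn_cov c0 b0 hA hB.
have h3 := wn_cov b'0 c0 hA hB; have h4 := wn_cov c0 c0 hA hB.
have -> : (Num.min b b' - c) * m = Num.min b b' * m - Num.min b c * m
    - (Num.min c b' * m - Num.min c c * m).
  rewrite (min_idPr cb) (min_idPl cb') minxx; ring.
by apply: eq_has_int (has_intB measurableT (has_intB measurableT h1 h2)
  (has_intB measurableT h3 h4)) => // w _; ring.
Qed.

Let future c := <<s [set E | exists (t : R) A (B : set R),
  [/\ c <= t, finite_borel A, measurable B & E = (W t A \- W c A) @^-1` B]] >>.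

Let future_incr c b A : c <= b -> finite_borel A ->
  measurable_wrt (future c) measurable (fun w => W b A w - W c A w).
Proof.
by move=> cb hA B mB; apply: sub_sigma_algebra; exists b, A, B; split.
Qed.

Let future_measurable c : 0 <= c -> future c `<=` measurable.
Proof.
move=> c0; apply: smallest_sub.
  by split=> [|A mA|A mA]; [exact: measurable0|rewrite setTD; exact: measurableC|
    exact: bigcup_measurable].
move=> _ [t [A [B [ct hA mB ->]]]].
rewrite -[X in measurable X]setTI; apply: measurable_funB => //.
- by apply: wn_measurable => //; exact: le_trans ct.
- exact: wn_measurable.
Qed.

(** The past at time c and the later increments are independent, so the mean of a
    product factors. *)
Lemma adapted_future_mean c Y Z y z : 0 <= c ->
  measurable_wrt (F c) measurable Y -> measurable_wrt (future c) measurable Z ->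
  has_int P setT Y y -> has_int P setT Z z ->
  has_int P setT (fun w => Y w * Z w) (y * z).
Proof.
move=> c0 FY HZ Yy Zz.
have mY := measurable_wrt_fun (filtration_sub hF c0) FY.
have mZ := measurable_wrt_fun (future_measurable c0) HZ.
pose Y' : {mfun Om >-> R} := HB.pack Y (isMeasurableFun.Build _ _ _ _ Y mY).
pose Z' : {mfun Om >-> R} := HB.pack Z (isMeasurableFun.Build _ _ _ _ Z mZ).
apply: (@independent_mean _ _ _ P Y' Z') => // A B mA mB.
rewrite setIC muleC; apply: (wn_indep hW c0); [exact: HZ|exact: FY].
Qed.

Let future_sigma c : sigma_algebra setT (future c).
Proof. exact: smallest_sigma_algebra. Qed.

Let Fsigma t (t0 : 0 <= t) := filtration_sigma hF t0.

(** The last increment is centered and independent of the other three factors, which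
    are known when it starts. *)
Lemma walsh_cov_disjoint a b a' b' A A' X X' (M M' : R) :
  0 <= a -> a <= b -> b <= a' -> a' <= b' -> finite_borel A -> finite_borel A' ->
  measurable_wrt (F a) measurable X -> measurable_wrt (F a') measurable X' ->
  (forall w, `|X w| <= M) -> (forall w, `|X' w| <= M') ->
  has_int P setT (fun w => X w * (W b A w - W a A w) *
                           (X' w * (W b' A' w - W a' A' w))) 0.
Proof.
move=> a0 ab ba' ab' hA hA' FX FX' XM XM'.
have b0 := le_trans a0 ab; have a'0 := le_trans b0 ba'.
have aa' := le_trans ab ba'.
have FaX := measurable_wrt_sub (filtration_mono hF a0 aa') FX.
have mX := measurable_wrt_fun (filtration_sub hF a0) FX.
have mX' := measurable_wrt_fun (filtration_sub hF a'0) FX'.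
pose Y w := X' w * (X w * (W b A w - W a A w)).
have Y2 : Y \in Lfun P 2%:E.
  apply: Lfun2_bounded_mul XM' _ => //; apply: Lfun2_bounded_mul XM _ => //.
  exact: wn_incr_Lfun2.
have [y Yy] := Lfun2_has_int Y2.
have FY : measurable_wrt (F a') measurable Y.
  apply: measurable_wrtM => //; first exact: Fsigma.
  apply: measurable_wrtM => //; first exact: Fsigma.
  apply: measurable_wrtB => //; first exact: Fsigma.
  - exact: measurable_wrt_sub (filtration_mono hF b0 ba') (wn_adapted b0 hA).
  - exact: measurable_wrt_sub (filtration_mono hF a0 aa') (wn_adapted a0 hA).
have := adapted_future_mean a'0 FY (future_incr ab' hA') Yy (wn_incr_mean a'0 ab' hA').
by rewrite mulr0; apply: eq_has_int => // w _; rewrite /Y; ring.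
Qed.

(** Cut the first interval where the second one starts.  The part before the cut is
    disjoint from the second interval; over the part after it both increments belong
    to the future and both coefficients to the past. *)
Lemma walsh_cov_ordered a b a' b' A A' X X' (M M' q : R) :
  0 <= a -> a <= b -> a <= a' -> a' <= b' -> finite_borel A -> finite_borel A' ->
  measurable_wrt (F a) measurable X -> measurable_wrt (F a') measurable X' ->
  (forall w, `|X w| <= M) -> (forall w, `|X' w| <= M') ->
  has_int P setT (fun w => X w * X' w) q ->
  has_int P setT (fun w => X w * (W b A w - W a A w) *
                           (X' w * (W b' A' w - W a' A' w)))
    (q * (overlap a b a' b' * fine (mes (A `&` A')))).
Proof.
move=> a0 ab aa' ab' hA hA' FX FX' XM XM' qi.
have a'0 := le_trans a0 aa'.
have [ba'|a'b] := leP b a'.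
  rewrite /overlap (max_idPr aa') (max_idPl _).
    by rewrite mul0r mulr0; exact: walsh_cov_disjoint XM XM'.
  by rewrite subr_le0 ge_min ba'.
have {}a'b := ltW a'b.
have h1 := walsh_cov_disjoint a0 aa' (lexx _) ab' hA hA' FX FX' XM XM'.
have FXX' : measurable_wrt (F a') measurable (fun w => X w * X' w).
  apply: measurable_wrtM => //; first exact: Fsigma.
  exact: measurable_wrt_sub (filtration_mono hF a0 aa') FX.
have Hprod : measurable_wrt (future a') measurable
    (fun w => (W b A w - W a' A w) * (W b' A' w - W a' A' w)).
  by apply: measurable_wrtM => //; exact: future_incr.
have h2 := adapted_future_mean a'0 FXX' Hprod qi (wn_incr_cov a'0 a'b ab' hA hA').
have -> : overlap a b a' b' = Num.min b b' - a'.
  by rewrite /overlap (max_idPr aa') (max_idPr _)// subr_ge0 le_min a'b.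
rewrite -[X in has_int _ _ _ X]addr0.
by apply: eq_has_int (has_intD measurableT h2 h1) => // w _; ring.
Qed.

Lemma elementary_coef_measurable T (u : elementary R d Om) : elementary_on F T u ->
  measurable_fun setT (el_coef u).
Proof.
move=> [/andP[a0 _] _ _ _]; apply: measurable_wrt_fun.
exact: (filtration_sub hF).
Qed.

(** The value is the integral of the product of the two elementary functions, which
    is what the polarized isometry requires. *)
Lemma elementary_walsh_cov T u v q : elementary_on F T u -> elementary_on F T v ->
  has_int P setT (fun w => el_coef u w * el_coef v w) q ->
  has_int P setT (fun w =>
    el_coef u w * (W (el_end u) (el_set u) w - W (el_start u) (el_set u) w) *
    (el_coef v w * (W (el_end v) (el_set v) w - W (el_start v) (el_set v) w)))
    (q * (overlap (el_start u) (el_end u) (el_start v) (el_end v) *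
          fine (mes (el_set u `&` el_set v)))).
Proof.
move=> [/andP[a0 /ltW ab] _ hA [M XM] FX] [/andP[a'0 /ltW ab'] _ hA' [M' XM'] FX'] qi.
have [aa'|/ltW aa'] := leP (el_start u) (el_start v).
  exact: walsh_cov_ordered XM XM' qi.
have qi' : has_int P setT (fun w => el_coef v w * el_coef u w) q.
  by apply: eq_has_int qi => // w _; rewrite mulrC.
rewrite overlapC setIC.
by apply: eq_has_int (walsh_cov_ordered _ _ _ _ _ _ FX' FX XM' XM qi') => // w _; rewrite mulrC.
Qed.

(** The squared norm in L^2([0, T] x R^d x Om). *)
Definition energy T (psi : R -> Rn R d -> Om -> R) : \bar R :=
  (\int[P]_w \int[lebesgue_measure]_(t in `[0%R, T]) \int[mes]_x
    ((psi t x w) ^+ 2)%:E)%E.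

Lemma has_int_overlap T a b a' b' : 0 <= a -> b <= T ->
  has_int lebesgue_measure `[0, T] (fun t => \1_(`]a, b]) t * \1_(`]a', b']) t)
    (overlap a b a' b').
Proof.
move=> a0 bT.
have E : `]a, b] `&` `]a', b'] = `]Num.max a a', Num.min b b']%classic :> set R.
  apply/seteqP; split => x /=; rewrite !in_itv/= gt_max le_min.
    by move=> [/andP[-> ->] /andP[-> ->]].
  by move=> /andP[/andP[-> ->] /andP[-> ->]].
have mE : (lebesgue_measure (`]a, b] `&` `]a', b']) = (overlap a b a' b')%:E :> \bar R)%E.
  rewrite E lebesgue_measure_itv/= lte_fin /overlap.
  have [h|h] := ltP (Num.max a a') (Num.min b b').
    by rewrite -EFinB (max_idPr (_ : 0 <= _ - _)) ?subr_ge0 ?ltW.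
  by rewrite (max_idPl (_ : _ - _ <= 0)) ?subr_le0.
have -> : overlap a b a' b' = fine (lebesgue_measure (`]a, b] `&` `]a', b'])).
  by rewrite mE.
have sub : (`]a, b] `&` `]a', b'] : set R) `<=` (`[0, T]%classic : set R).
  move=> t /= []; rewrite !in_itv/= => /andP[at_ tb] _.
  by rewrite (ltW (le_lt_trans a0 at_)) (le_trans tb bT).
have mfin : (lebesgue_measure (`]a, b] `&` `]a', b']) < +oo)%E by rewrite mE ltry.
have H : has_int lebesgue_measure `[0, T] \1_(`]a, b] `&` `]a', b'])
    (fine (lebesgue_measure (`]a, b] `&` `]a', b']))).
  apply: has_int_indic => //.
  - exact: measurableI.
by apply: eq_has_int H => // t _; rewrite indicI.
Qed.

(** After expansion of the squares both sides are the same double sum: a pair of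
    elementary functions contributes the mean of the product of the coefficients,
    times the overlap of the time intervals, times the measure of the intersection of
    the sets. *)
Lemma simple_isometry T (us : seq (elementary R d Om)) :
  (forall u, u \in us -> elementary_on F T u) ->
  sqint P setT (simple_walsh W us) = energy T (simple_value us).
Proof.
move=> hus.
pose m (u v : elementary R d Om) := fine (mes (el_set u `&` el_set v)).
pose o (u v : elementary R d Om) :=
  overlap (el_start u) (el_end u) (el_start v) (el_end v).
pose q (u v : elementary R d Om) :=
  fine (\int[P]_w (el_coef u w * el_coef v w)%:E)%E.
have el2 u : u \in us -> el_coef u \in Lfun P 2%:E.
  move=> /hus hu; have := elementary_coef_measurable hu.
  by case: hu => _ _ _ [M XM] _ mX; exact: Lfun2_bounded XM.
have qi u v : u \in us -> v \in us ->
    has_int P setT (fun w => el_coef u w * el_coef v w) (q u v).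
  move=> uus vus; apply: integrable_has_int => //.
  by apply/Lfun1_integrable; apply: Lfun2_mul_Lfun1; exact: el2.
rewrite {1}/sqint.
have [_ ->] : has_int P setT (fun w => simple_walsh W us w ^+ 2)
    (\sum_(u <- us) \sum_(v <- us) q u v * (o u v * m u v)).
  apply: eq_has_int (has_int_sum measurableT (fun u uus =>
    has_int_sum measurableT (fun v vus =>
      elementary_walsh_cov (hus u uus) (hus v vus) (qi u v uus vus)))) => // w _.
  by rewrite sqr_sum.
have step1 t w : (\int[mes]_x ((simple_value us t x w) ^+ 2)%:E =
    (\sum_(u <- us) \sum_(v <- us)
      (el_coef u w * el_coef v w * m u v) *
      (\1_(`]el_start u, el_end u]) t * \1_(`]el_start v, el_end v]) t))%:E)%E.
  have [_ <-] : has_int mes setT (fun x => \sum_(u <- us) \sum_(v <- us)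
      (el_coef u w * el_coef v w *
      (\1_(`]el_start u, el_end u]) t * \1_(`]el_start v, el_end v]) t)) *
      \1_(el_set u `&` el_set v) x)
    (\sum_(u <- us) \sum_(v <- us)
      (el_coef u w * el_coef v w * m u v) *
      (\1_(`]el_start u, el_end u]) t * \1_(`]el_start v, el_end v]) t)).
    apply: has_int_sum => // u uus; apply: has_int_sum => // v vus.
    have [_ _ hA _ _] := hus u uus; have [_ _ hB _ _] := hus v vus.
    have [mAB fAB] := finite_borelI hA hB.
    have H : has_int mes setT \1_(el_set u `&` el_set v) (m u v) by exact: has_int_indic.
    rewrite [X in has_int _ _ _ X]mulrAC; exact: (has_intZ measurableT _ H).
  apply: eq_integral => x _; congr EFin; rewrite /simple_value sqr_sum.
  apply: eq_bigr => u _; apply: eq_bigr => v _.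
  by rewrite indicI /=; ring.
rewrite /energy.
under eq_integral do under eq_integral do rewrite step1.
have step2 w : (\int[lebesgue_measure]_(t in `[0%R, T])
    (\sum_(u <- us) \sum_(v <- us)
      (el_coef u w * el_coef v w * m u v) *
      (\1_(`]el_start u, el_end u]) t * \1_(`]el_start v, el_end v]) t))%:E =
    (\sum_(u <- us) \sum_(v <- us) (o u v * m u v) * (el_coef u w * el_coef v w))%:E)%E.
  have [_ <-] : has_int lebesgue_measure `[0, T] (fun t => \sum_(u <- us) \sum_(v <- us)
      (el_coef u w * el_coef v w * m u v) *
      (\1_(`]el_start u, el_end u]) t * \1_(`]el_start v, el_end v]) t))
    (\sum_(u <- us) \sum_(v <- us) (o u v * m u v) * (el_coef u w * el_coef v w)) => //.
  apply: has_int_sum => // u uus; apply: has_int_sum => // v vus.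
  have -> : o u v * m u v * (el_coef u w * el_coef v w) =
    el_coef u w * el_coef v w * m u v * o u v by ring.
  apply: has_intZ => //; apply: has_int_overlap.
  - by have [/andP[]] := hus u uus.
  - by have [] := hus u uus.
under [RHS]eq_integral do rewrite step2.
have [_ ->] : has_int P setT (fun w => \sum_(u <- us) \sum_(v <- us)
      (o u v * m u v) * (el_coef u w * el_coef v w))
    (\sum_(u <- us) \sum_(v <- us) (o u v * m u v) * q u v).
  apply: has_int_sum => // u uus; apply: has_int_sum => // v vus.
  by apply: has_intZ => //; exact: qi.
congr EFin; apply: eq_bigr => u _; apply: eq_bigr => v _; exact: mulrC.
Qed.

End white_noise.

(** * The Walsh integral as a closed linear relation *)

(** As an integral over a single space, an iterated square integral inherits the
    triangle inequality and the other properties of [sqint]. *)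
Lemma iterated_sqint (d1 d2 d3 : measure_display) (T1 : measurableType d1)
    (T2 : measurableType d2) (T3 : measurableType d3) (R : realType)
    (m1 : {sigma_finite_measure set T1 -> \bar R})
    (m2 : {sigma_finite_measure set T2 -> \bar R})
    (m3 : {sigma_finite_measure set T3 -> \bar R})
    (A : set T1) : measurable A ->
  exists M : {measure set (T1 * T2 * T3)%type -> \bar R},
    forall f : T1 -> T2 -> T3 -> R,
    measurable_fun (A `*` setT `*` setT) (fun p : T1 * T2 * T3 => f p.1.1 p.1.2 p.2) ->
    (\int[m3]_w \int[m1]_(t in A) \int[m2]_x (f t x w ^+ 2)%:E)%E =
    sqint M (A `*` setT `*` setT) (fun p : T1 * T2 * T3 => f p.1.1 p.1.2 p.2).
Proof.
move=> mA.
have [m12 m12E] := sigma_finite_product_measure m1 m2.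
exists (m12 \x m3)%E => f mf; rewrite /sqint integral_mkcond; set g := _ \_ _.
have mD : measurable (A `*` setT `*` setT : set (T1 * T2 * T3)).
  by apply: measurableX => //; exact: measurableX.
have mg : measurable_fun setT g.
  exact: (measurable_restrictT _ mD).1 (measurable_sqr mf).
have g0 p : (0 <= g p)%E.
  by apply: erestrict_ge0 => q _; rewrite lee_fin sqr_ge0.
rewrite [RHS](fubini_tonelli2 _ mg g0).
apply: eq_integral => w _; rewrite /fubini_G.
have mgw : measurable_fun setT (fun p => g (p, w)).
  exact: measurable_fun_pair1.
rewrite [RHS](m12E _ mgw)// integral_mkcond; apply: eq_integral => t _.
rewrite patchE; case: ifPn => tT.
  apply: eq_integral => x _; rewrite /g patchE ifT// inE.
  by split => //; split => //; exact: set_mem.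
rewrite integral0_eq// => x _; rewrite /g patchE ifF//.
by apply: contraNF tT; rewrite !inE => -[[+ _] _].
Qed.

Section walsh.
Context (R : realType) (d : nat) (dO : measure_display)
  (Om : measurableType dO) (P : probability Om R).
Variables (F : R -> set (set Om)) (W : R -> set (Rn R d) -> Om -> R).
Hypotheses (hF : filtration F) (hW : white_noise P F W).
Local Notation mes := (lebesgue_tuple R d).
Local Notation field := (R -> Rn R d -> Om -> R).
Implicit Types (psi chi : field) (J : Om -> R) (T : R).
Implicit Types (u : elementary R d Om) (us : seq (elementary R d Om)).

Definition measurable_field T psi :=
  measurable_fun (`[0, T] `*` setT `*` setT)
    (fun p : measurableTypeR R * Rn R d * Om => psi p.1.1 p.1.2 p.2).

Lemma measurable_domain T : measurable
  (`[0, T] `*` setT `*` setT : set (measurableTypeR R * Rn R d * Om)).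
Proof. by apply: measurableX => //; exact: measurableX. Qed.

Lemma energy_sqint T :
  exists M : {measure set (measurableTypeR R * Rn R d * Om)%type -> \bar R},
    forall psi, measurable_field T psi ->
    energy P T psi = sqint M (`[0, T] `*` setT `*` setT)
      (fun p : measurableTypeR R * Rn R d * Om => psi p.1.1 p.1.2 p.2).
Proof.
by apply: (iterated_sqint (@lebesgue_measure R) (lebesgue_tuple R d) P).
Qed.

Lemma energy_ge0 T psi : (0 <= energy P T psi)%E.
Proof.
apply: integral_ge0 => w _; apply: integral_ge0 => t _.
by apply: integral_ge0 => x _; rewrite lee_fin sqr_ge0.
Qed.

Lemma eq_energy T psi chi : (forall t x w, psi t x w = chi t x w) ->
  energy P T psi = energy P T chi.
Proof. by move=> e; congr energy; apply/funext => t; apply/funext => x; apply/funext. Qed.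

Lemma energy_sym T psi chi :
  energy P T (fun t x w => psi t x w - chi t x w) =
  energy P T (fun t x w => chi t x w - psi t x w).
Proof.
apply: eq_integral => w _; apply: eq_integral => t _; apply: eq_integral => x _.
by rewrite -sqrrN opprB.
Qed.

Lemma measurable_fieldB T psi chi : measurable_field T psi -> measurable_field T chi ->
  measurable_field T (fun t x w => psi t x w - chi t x w).
Proof. by move=> mp mc; exact: measurable_funB. Qed.

Lemma measurable_fieldD T psi chi : measurable_field T psi -> measurable_field T chi ->
  measurable_field T (fun t x w => psi t x w + chi t x w).
Proof. by move=> mp mc; exact: measurable_funD. Qed.

Lemma energy_triangle_le T psi chi eta (a b : R) :
  measurable_field T psi -> measurable_field T chi -> measurable_field T eta ->
  (energy P T (fun t x w => psi t x w - chi t x w)%R <= a%:E)%E ->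
  (energy P T (fun t x w => chi t x w - eta t x w)%R <= b%:E)%E ->
  (energy P T (fun t x w => psi t x w - eta t x w)%R <= (2 * a + 2 * b)%:E)%E.
Proof.
move=> mp mc me; have [M ME] := energy_sqint T.
rewrite !ME; do ?exact: measurable_fieldB.
exact: (sqint_triangle_le (measurable_domain T) mp mc me).
Qed.

Lemma energyD_le T psi chi (a b : R) :
  measurable_field T psi -> measurable_field T chi ->
  (energy P T psi <= a%:E)%E -> (energy P T chi <= b%:E)%E ->
  (energy P T (fun t x w => psi t x w + chi t x w)%R <= (2 * a + 2 * b)%:E)%E.
Proof.
move=> mp mc; have [M ME] := energy_sqint T.
rewrite !ME; do ?exact: measurable_fieldD; move=> //.
move=> pa cb; apply: (le_trans (sqintD _ (measurable_domain T) mp mc)).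
have -> : (2 * a + 2 * b)%:E = (2%:E * a%:E + 2%:E * b%:E)%E by [].
by apply: leeD; rewrite lee_wpmul2l// lee_fin.
Qed.

Lemma simple_value_cat us vs t x w :
  simple_value (us ++ vs) t x w = simple_value us t x w + simple_value vs t x w.
Proof. by rewrite /simple_value big_cat. Qed.

Lemma simple_walsh_cat us vs w :
  simple_walsh W (us ++ vs) w = simple_walsh W us w + simple_walsh W vs w.
Proof. by rewrite /simple_walsh big_cat. Qed.

Definition elementary_mul (c : Om -> R) u : elementary R d Om :=
  Elementary (el_start u) (el_end u) (el_set u) (fun w => c w * el_coef u w).

Lemma simple_value_mul c us t x w :
  simple_value (map (elementary_mul c) us) t x w = c w * simple_value us t x w.
Proof.
rewrite /simple_value big_map mulr_sumr; apply: eq_bigr => u _ /=.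
by rewrite mulrCA.
Qed.

Lemma simple_walsh_mul c us w :
  simple_walsh W (map (elementary_mul c) us) w = c w * simple_walsh W us w.
Proof.
rewrite /simple_walsh big_map mulr_sumr; apply: eq_bigr => u _ /=.
by rewrite mulrA.
Qed.

Lemma elementary_on_cst T (c : R) u : elementary_on F T u ->
  elementary_on F T (elementary_mul (fun=> c) u).
Proof.
move=> [/andP[a0 ab] bT hA [M XM] FX]; split => //=.
- by rewrite a0 ab.
- by exists (`|c| * M) => w; rewrite normrM ler_wpM2l.
- apply: measurable_wrtM => //; first exact: (filtration_sigma hF).
  apply/(measurable_wrtP _ (filtration_sigma hF a0)); exact: measurable_cst.
Qed.

Lemma measurable_simple_value T us :
  (forall u, u \in us -> elementary_on F T u) -> measurable_field T (simple_value us).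
Proof.
elim: us => [|u us IH] hus.
  rewrite /measurable_field (_ : (fun p => _) = cst 0); first exact: measurable_cst.
  by apply/funext => p; rewrite /simple_value big_nil.
rewrite /measurable_field (_ : (fun p => _) =
    (fun p => \1_(`]el_start u, el_end u]) p.1.1 * \1_(el_set u) p.1.2 * el_coef u p.2 +
      simple_value us p.1.1 p.1.2 p.2)); last first.
  by apply/funext => p; rewrite /simple_value big_cons.
have hu := hus u (mem_head _ _).
apply: measurable_funD; last by apply: IH => v vus; apply: hus; rewrite inE vus orbT.
apply: measurable_funTS; apply: measurable_funM; first apply: measurable_funM.
- by apply: measurableT_comp => //; exact: measurableT_comp.
- have mA : measurable_fun setT (\1_(el_set u) : Rn R d -> R).
    by apply: measurable_indic; case: hu => _ _ [].
  exact: (measurableT_comp mA (measurableT_comp measurable_snd measurable_fst)).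
- by apply: measurableT_comp => //; exact: elementary_coef_measurable hu.
Qed.

Lemma simple_walsh_Lfun2 T us :
  (forall u, u \in us -> elementary_on F T u) -> simple_walsh W us \in Lfun P 2%:E.
Proof.
elim: us => [|u us IH] hus.
  rewrite (_ : simple_walsh W [::] = cst 0); first exact: Lfun_cst.
  by apply/funext => w; rewrite /simple_walsh big_nil.
rewrite (_ : simple_walsh W _ = (fun w =>
    el_coef u w * (W (el_end u) (el_set u) w - W (el_start u) (el_set u) w) +
    simple_walsh W us w)); last first.
  by apply/funext => w; rewrite /simple_walsh big_cons.
have hu := hus u (mem_head _ _).
apply: Lfun2D; last by apply: IH => v vus; apply: hus; rewrite inE vus orbT.
have mX := elementary_coef_measurable hF hu.
case: hu => /andP[a0 ab] _ hA [M XM] _.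
apply: Lfun2_bounded_mul XM _ => //.
by apply: (wn_incr_Lfun2 hF hW a0 _ hA); exact: le_trans (ltW ab).
Qed.

(** The approximation property defining the integral, with an arbitrary tolerance
    in place of a sequence: in this form it is visibly closed under limits. *)
Definition walsh T psi J :=
  [/\ measurable_field T psi, measurable_fun setT J &
      forall e : R, 0 < e -> exists us,
        [/\ forall u, u \in us -> elementary_on F T u,
            (energy P T (fun t x w => simple_value us t x w - psi t x w)%R <= e%:E)%E &
            (sqint P setT (fun w => simple_walsh W us w - J w)%R <= e%:E)%E]].

Lemma walsh_Lfun2 T psi J : walsh T psi J -> J \in Lfun P 2%:E.
Proof.
move=> [_ mJ /(_ 1 ltr01)[us [hus _ h]]].
have w2 := simple_walsh_Lfun2 hus.
have d2 : (fun w => simple_walsh W us w - J w) \in Lfun P 2%:E.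
  apply/Lfun2P; split; last by rewrite (le_lt_trans h) ?ltry.
  by apply: measurable_funB => //; have /Lfun2P[] := w2.
have := Lfun2B w2 d2; rewrite (_ : (fun w => _) = J)//.
by apply/funext => w; rewrite subKr.
Qed.

Lemma walshP T psi J : measurable_field T psi ->
  is_walsh_integral P F W T psi J <-> walsh T psi J.
Proof.
move=> mpsi; split.
  move=> [us [hus en [/Lfun2P[mJ _] /Lnorm2_cvg0 L]]]; split => // e e0.
  have [N1 _ h1] := (cvge0P (fun n => energy_ge0 _ _)).1 en e e0.
  have [N2 _ h2] := (cvge0P (fun n => sqint_ge0 _ _ _)).1 L e e0.
  exists (us (maxn N1 N2)); split => //.
  - by move=> u; exact: hus.
  - by apply: h1; exact: leq_maxl.
  - by apply: h2; exact: leq_maxr.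
move=> w; have J2 := walsh_Lfun2 w; move: w => [_ mJ H].
have e0 n : 0 < (n.+1%:R^-1 : R) by rewrite invr_gt0.
pose us n := sval (cid (H _ (e0 n))).
have usP n : [/\ forall u, u \in us n -> elementary_on F T u,
    (energy P T (fun t x w => simple_value (us n) t x w - psi t x w)%R <= (n.+1%:R^-1)%:E)%E &
    (sqint P setT (fun w => simple_walsh W (us n) w - J w)%R <= (n.+1%:R^-1)%:E)%E].
  by rewrite /us; case: cid.
exists us; split.
- by move=> n u; have [h _ _] := usP n; exact: h.
- apply: cvge0_inv => n; first exact: energy_ge0.
  by have [] := usP n.
- split => //; apply/Lnorm2_cvg0; apply: cvge0_inv => n; first exact: sqint_ge0.
  by have [] := usP n.
Qed.

Lemma walshD T psi chi J I : walsh T psi J -> walsh T chi I ->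
  walsh T (fun t x w => psi t x w + chi t x w) (fun w => J w + I w).
Proof.
move=> [mp mJ hp] [mc mI hc]; split.
- exact: measurable_fieldD.
- exact: measurable_funD.
move=> e e0; have e4 : 0 < e / 4 by rewrite divr_gt0.
have [us [hus us1 us2]] := hp _ e4; have [vs [hvs vs1 vs2]] := hc _ e4.
have ee : 2 * (e / 4) + 2 * (e / 4) = e by field.
exists (us ++ vs); split.
- by move=> u; rewrite mem_cat => /orP[/hus|/hvs].
- have mu := measurable_simple_value hus; have mv := measurable_simple_value hvs.
  rewrite (eq_energy T (chi := fun t x w => (simple_value us t x w - psi t x w) +
    (simple_value vs t x w - chi t x w))); last first.
    by move=> t x w; rewrite simple_value_cat; ring.
  rewrite -ee.
  exact: energyD_le (measurable_fieldB mu mp) (measurable_fieldB mv mc) us1 vs1.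
- have [/Lfun2P[mu _] /Lfun2P[mv _]] := (simple_walsh_Lfun2 hus, simple_walsh_Lfun2 hvs).
  rewrite (eq_sqint P (D := setT) (g := fun w => (simple_walsh W us w - J w) +
    (simple_walsh W vs w - I w))); last first.
    by move=> w _; rewrite simple_walsh_cat; congr (_ ^+ 2); ring.
  apply: (le_trans (sqintD _ measurableT (measurable_funB mu mJ) (measurable_funB mv mI))).
  rewrite -ee (_ : (2 * (e / 4) + 2 * (e / 4))%:E = 2%:E * (e / 4)%:E + 2%:E * (e / 4)%:E)%E//.
  by apply: leeD; rewrite lee_wpmul2l// lee_fin.
Qed.

Lemma walsh0 T : walsh T (fun _ _ _ => 0) (fun=> 0).
Proof.
split; [exact: measurable_cst|exact: measurable_cst|move=> e e0; exists [::]; split => //].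
- rewrite (eq_energy T (chi := simple_value [::])).
    by rewrite -(simple_isometry hF hW)// /sqint integral0_eq ?lee_fin ?ltW// => w _;
      rewrite /simple_walsh big_nil expr0n.
  by move=> t x w; rewrite subr0.
- by rewrite /sqint integral0_eq ?lee_fin ?ltW// => w _;
    rewrite /simple_walsh big_nil subr0 expr0n.
Qed.

Lemma walsh_sum T (psi : nat -> field) (J : nat -> Om -> R) m :
  (forall k, walsh T (psi k) (J k)) ->
  walsh T (fun t x w => \sum_(k < m) psi k t x w) (fun w => \sum_(k < m) J k w).
Proof.
move=> h; elim: m => [|m IH].
  under [X in walsh _ X _]eq_fun do under eq_fun do under eq_fun do rewrite big_ord0.
  under [X in walsh _ _ X]eq_fun do rewrite big_ord0.
  exact: walsh0.
under [X in walsh _ X _]eq_fun do under eq_fun do under eq_fun do rewrite big_ord_recr /=.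
under [X in walsh _ _ X]eq_fun do rewrite big_ord_recr /=.
exact: walshD.
Qed.

(** The simple approximants satisfy the isometry; passing to the limit costs four
    triangle inequalities for squared norms, whence the constant.  Continuity is enough
    for uniqueness and completeness. *)
Lemma walsh_contraction T psi chi J I (b : R) : walsh T psi J -> walsh T chi I ->
  (energy P T (fun t x w => psi t x w - chi t x w)%R <= b%:E)%E ->
  (sqint P setT (fun w => J w - I w)%R <= (16 * b)%:E)%E.
Proof.
move=> wp wc pc; have [mp mJ hp] := wp; have [mc mI hc] := wc.
(* The tolerances add up to 30 times the one chosen here. *)
apply/lee_addgt0Pr => e e0; have e30 : 0 < e / 30 by rewrite divr_gt0.
have [us [hus us1 us2]] := hp _ e30; have [vs [hvs vs1 vs2]] := hc _ e30.
have mu := measurable_simple_value hus; have mv := measurable_simple_value hvs.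
have [/Lfun2P[mU _] /Lfun2P[mV _]] := (simple_walsh_Lfun2 hus, simple_walsh_Lfun2 hvs).
have e1 := energy_triangle_le mu mp mc us1 pc.
rewrite energy_sym in vs1.
have e2 := energy_triangle_le mu mc mv e1 vs1.
(* The difference of two simple functions is simple. *)
pose ws := us ++ map (elementary_mul (fun=> -1)) vs.
have hws u : u \in ws -> elementary_on F T u.
  rewrite mem_cat => /orP[/hus//|/mapP[v /hvs hv ->]].
  exact: elementary_on_cst.
have e3 : (sqint P setT (fun w => simple_walsh W us w - simple_walsh W vs w)%R <=
    (2 * (2 * (e / 30) + 2 * b) + 2 * (e / 30))%:E)%E.
  apply: le_trans e2; rewrite (eq_sqint P (D := setT) (g := simple_walsh W ws)); last first.
    by move=> w _; rewrite simple_walsh_cat simple_walsh_mul mulN1r.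
  rewrite (simple_isometry hF hW hws) (eq_energy T (chi := (fun t x w =>
    simple_value us t x w - simple_value vs t x w)))// => t x w.
  by rewrite simple_value_cat simple_value_mul mulN1r.
rewrite sqint_sym in us2.
have e4 := sqint_triangle_le measurableT mJ mU mV us2 e3.
have e5 := sqint_triangle_le measurableT mJ mV mI e4 vs2.
apply: (le_trans e5); rewrite -EFinD lee_fin le_eqVlt; apply/orP; left; apply/eqP.
by field.
Qed.

Lemma walsh_closed T psi J : measurable_field T psi -> measurable_fun setT J ->
  (forall e : R, 0 < e -> exists chi I, [/\ walsh T chi I,
     (energy P T (fun t x w => chi t x w - psi t x w)%R <= e%:E)%E &
     (sqint P setT (fun w => I w - J w)%R <= e%:E)%E]) ->
  walsh T psi J.
Proof.
move=> mp mJ H; split => // e e0; have e4 : 0 < e / 4 by rewrite divr_gt0.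
have ee : 2 * (e / 4) + 2 * (e / 4) = e by field.
have [chi [I [[mc mI hc] cp IJ]]] := H _ e4.
have [us [hus us1 us2]] := hc _ e4; exists us; split => //.
- by rewrite -ee; exact: energy_triangle_le (measurable_simple_value hus) mc mp us1 cp.
- have /Lfun2P[mU _] := simple_walsh_Lfun2 hus.
  by rewrite -ee; exact: sqint_triangle_le measurableT mU mI mJ us2 IJ.
Qed.

(** Integrals of an approximating sequence form a Cauchy sequence, by contraction. *)
Lemma walsh_exists T psi : measurable_field T psi ->
  (forall e : R, 0 < e -> exists chi I, walsh T chi I /\
     (energy P T (fun t x w => chi t x w - psi t x w)%R <= e%:E)%E) ->
  exists J, walsh T psi J.
Proof.
move=> mp H; have e0 n : 0 < (n.+1%:R^-1 : R) by rewrite invr_gt0.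
pose chi n := sval (cid (H _ (e0 n))).
have H' n : exists I, walsh T (chi n) I /\
     (energy P T (fun t x w => chi n t x w - psi t x w)%R <= (n.+1%:R^-1)%:E)%E.
  by rewrite /chi; case: cid.
pose I n := sval (cid (H' n)).
have wI n : walsh T (chi n) (I n) by rewrite /I; case: cid => ? [].
have en n : (energy P T (fun t x w => chi n t x w - psi t x w)%R <= (n.+1%:R^-1)%:E)%E.
  by have [? []] := H' n.
have mI n : measurable_fun setT (I n) by have [] := wI n.
have mc n : measurable_field T (chi n) by have [] := wI n.
have inv_le (e : R) : 0 < e -> exists N, forall n, (N <= n)%N -> n.+1%:R^-1 <= e.
  move=> ep; have [N _ h] := near_infty_natSinv_lt (PosNum ep).
  by exists N => n Nn; apply: ltW; exact: h.
have [|J [mJ IJ]] := L2_complete (P := P) mI.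
  move=> e ep; have e64 : 0 < e / 64 by rewrite divr_gt0.
  have [N hN] := inv_le _ e64; exists N => n m Nn Nm.
  have em := en m; rewrite energy_sym in em.
  have h := energy_triangle_le (mc n) mp (mc m) (en n) em.
  apply: (le_trans (walsh_contraction (wI n) (wI m) h)); rewrite lee_fin.
  have := hN n Nn; have := hN m Nm.
  move: (n.+1%:R^-1 : R) (m.+1%:R^-1 : R) => x y; lra.
exists J; apply: walsh_closed => // e ep.
have [N hN] := inv_le e ep.
have [N2 _ hN2] := (cvge0P (fun n => sqint_ge0 _ _ _)).1 IJ e ep.
exists (chi (maxn N N2)), (I (maxn N N2)); split => //.
- by apply: (le_trans (en _)); rewrite lee_fin hN// leq_maxl.
- by apply: hN2; exact: leq_maxr.
Qed.

End walsh.

(** * Ito integrals against the coordinate processes *)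

(** Otherwise the iterated integral would be at least c times the measure of A. *)
Lemma exists_slice (d1 d2 d3 : measure_display) (T1 : measurableType d1)
    (T2 : measurableType d2) (T3 : measurableType d3) (R : realType)
    (m1 : {measure set T1 -> \bar R}) (m2 : {measure set T2 -> \bar R})
    (P : probability T3 R) (A : set T1) (f : T1 -> T2 -> T3 -> R) (c : R) :
  measurable A -> 0 <= c ->
  (\int[P]_w \int[m1]_(t in A) \int[m2]_x (f t x w ^+ 2)%:E < c%:E * m1 A)%E ->
  exists t w, A t /\ (\int[m2]_x (f t x w ^+ 2)%:E <= c%:E)%E.
Proof.
move=> mA c0; apply: contraPP => /forallNP H; apply/negP; rewrite -leNgt.
have {}H t w : A t -> (c%:E <= \int[m2]_x (f t x w ^+ 2)%:E)%E.
  move=> At; rewrite leNgt; apply/negP => /ltW h.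
  by have /forallNP/(_ w) := H t; apply.
rewrite -(probability_integral_cst P (c%:E * m1 A)%E).
apply: ge0_integral_mono => w _; rewrite mule_ge0//=.
rewrite -(integral_cst m1 mA c%:E); apply: ge0_integral_mono => t At.
by rewrite lee_fin c0 H.
Qed.

Section coordinates.
Context (R : realType) (d : nat) (dO : measure_display)
  (Om : measurableType dO) (P : probability Om R).
Variables (F : R -> set (set Om)) (W : R -> set (Rn R d) -> Om -> R).
Hypotheses (hF : filtration F) (hW : white_noise P F W).
Local Notation mes := (lebesgue_tuple R d).
Implicit Types (T : R) (X : R -> Om -> R) (f : Rn R d -> R).

Definition measurable_process T X :=
  measurable_fun (`[0, T] `*` setT) (fun p : measurableTypeR R * Om => X p.1 p.2).

Lemma measurable_field_tensor T X f : measurable_process T X ->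
  measurable_fun setT f -> measurable_field T (fun t x w => X t w * f x).
Proof.
move=> mX mf; apply: measurable_funM; last first.
  by apply: measurable_funTS; exact: (measurableT_comp mf (measurableT_comp measurable_snd measurable_fst)).
have m1 : measurable_fun (`[0, T] `*` setT `*` setT)
    (fun p : measurableTypeR R * Rn R d * Om => (p.1.1, p.2)).
  by apply: measurable_funTS; apply: measurable_fun_pair; [exact: (measurableT_comp measurable_fst measurable_fst)|exact: measurable_snd].
apply: (measurable_comp (F := `[0, T] `*` setT) _ _ mX m1).
- exact: measurableX.
- by move=> _ [[[t x] w] /= [[tT _] _] <-].
Qed.

Lemma energy_tensor T X f : measurable_fun setT f -> sqint mes setT f = 1%E ->
  energy P T (fun t x w => X t w * f x) =
  (\int[P]_w \int[lebesgue_measure]_(t in `[0%R, T]) ((X t w) ^+ 2)%:E)%E.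
Proof.
move=> mf f1; apply: eq_integral => w _; apply: eq_integral => t _.
by rewrite -[LHS]/(sqint mes setT (fun x => X t w * f x)) sqintZ// f1 mule1.
Qed.

Lemma energy_space T f (c : R) : 0 <= T -> sqint mes setT f = c%:E ->
  energy P T (fun _ x _ => f x) = (T * c)%:E.
Proof.
move=> T0 fc; rewrite /energy.
have mT : lebesgue_measure `[0%R, T] = T%:E.
  rewrite lebesgue_measure_itv/= lte_fin; case: ltP => h; first by rewrite oppr0 adde0.
  by rewrite (_ : T = 0)//; apply/le_anti; rewrite h.
have fc' : (\int[mes]_x (f x ^+ 2)%:E = c%:E)%E := fc.
under eq_integral do under eq_integral do rewrite fc'.
rewrite (_ : (fun w => _) = cst (T * c)%:E); last first.
  apply/funext => w; rewrite (integral_cst lebesgue_measure _ c%:E)//.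
  by rewrite -[X in (_ * X)%E]/(lebesgue_measure `[0%R, T]) mT -EFinM mulrC.
exact: probability_integral_cst.
Qed.

Lemma energy_bounded_mul T (c psi : R -> Rn R d -> Om -> R) (M : R) :
  measurable_field T c -> measurable_field T psi ->
  (forall t x w, `|c t x w| <= M) ->
  (energy P T (fun t x w => c t x w * psi t x w)%R <= (M ^+ 2)%:E * energy P T psi)%E.
Proof.
move=> mc mp cM; have [N NE] := energy_sqint d P T.
rewrite (NE _ mp) (NE (fun t x w => c t x w * psi t x w)); last exact: measurable_funM.
exact: (sqint_bounded_mul N (measurable_domain T) mp).
Qed.

(** Deterministic step functions in space, and the noise they integrate; the value at
    time 0 is subtracted because it vanishes only almost surely. *)
Definition step (cs : seq (R * set (Rn R d))) (x : Rn R d) : R :=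
  \sum_(p <- cs) p.1 * \1_(p.2) x.

Definition step_noise (cs : seq (R * set (Rn R d))) (t : R) (w : Om) : R :=
  \sum_(p <- cs) p.1 * (W t p.2 w - W 0 p.2 w).

Definition elementary_of (a b : R) (X : Om -> R) (p : R * set (Rn R d)) :=
  Elementary a b p.2 (fun w => p.1 * X w).

Lemma simple_value_of a b (X : Om -> R) cs t x w :
  simple_value (map (elementary_of a b X) cs) t x w =
  \1_(`]a, b]) t * X w * step cs x.
Proof.
rewrite /simple_value big_map /step mulr_sumr; apply: eq_bigr => p _ /=.
by ring.
Qed.

Lemma simple_walsh_of a b (X : Om -> R) cs w :
  simple_walsh W (map (elementary_of a b X) cs) w =
  X w * (step_noise cs b w - step_noise cs a w).
Proof.
rewrite /simple_walsh big_map /step_noise -sumrB mulr_sumr.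
by apply: eq_bigr => p _ /=; ring.
Qed.

Lemma elementary_of_on T a b (X : Om -> R) cs (M : R) : 0 <= a -> a < b -> b <= T ->
  (forall w, `|X w| <= M) -> measurable_wrt (F a) measurable X ->
  (forall p, p \in cs -> finite_borel p.2) ->
  forall u, u \in map (elementary_of a b X) cs -> elementary_on F T u.
Proof.
move=> a0 ab bT XM FX hcs u /mapP[p pcs ->]; split => //=.
- by rewrite a0.
- exact: hcs.
- by exists (`|p.1| * M) => w; rewrite normrM ler_wpM2l.
- apply: measurable_wrtM => //; first exact: (filtration_sigma hF).
  by apply/(measurable_wrtP _ (filtration_sigma hF a0)); exact: measurable_cst.
Qed.

Lemma measurable_step cs : (forall p, p \in cs -> finite_borel p.2) ->
  measurable_fun setT (step cs).
Proof.
elim: cs => [|p cs IH] h.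
  rewrite (_ : step [::] = cst 0); first exact: measurable_cst.
  by apply/funext => x; rewrite /step big_nil.
rewrite (_ : step _ = (fun x => p.1 * \1_(p.2) x + step cs x)); last first.
  by apply/funext => x; rewrite /step big_cons.
apply: measurable_funD; last by apply: IH => q qcs; apply: h; rewrite inE qcs orbT.
apply: measurable_funM => //.
by apply: measurable_indic; have [] := h p (mem_head _ _).
Qed.

(** Slicing the approximants of the integral of f at one instant and one outcome
    leaves deterministic step functions, so f is approximable by step functions. *)
Lemma walsh_step_dense f (J : Om -> R) : walsh P F W 1 (fun _ x _ => f x) J ->
  forall e : R, 0 < e -> exists cs, (forall p, p \in cs -> finite_borel p.2) /\
    (sqint mes setT (fun x => step cs x - f x)%R <= e%:E)%E.
Proof.
move=> [mf _ H] e e0; have e2 : 0 < e / 2 by rewrite divr_gt0.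
have [us [hus us1 _]] := H _ e2.
have mI : measurable (`[0, 1]%classic : set (measurableTypeR R)) by exact: measurable_itv.
have lt_e : (energy P 1 (fun t x w => simple_value us t x w - f x)%R <
    e%:E * lebesgue_measure `[0%R, 1%R])%E.
  apply: (le_lt_trans us1); rewrite lebesgue_measure_itv/= lte_fin ltr01 oppr0 adde0 mule1.
  by rewrite lte_fin ltr_pdivrMr// ltr_pMr// ltr1n.
have [t [w [_ h]]] := exists_slice mI (ltW e0) lt_e.
exists (map (fun u => (\1_(`]el_start u, el_end u]) t * el_coef u w, el_set u)) us).
split; first by move=> _ /mapP[u uus ->] /=; have [] := hus u uus.
apply: le_trans h; rewrite (eq_sqint _ (D := setT) (g := fun x => simple_value us t x w - f x))//.
move=> x _; rewrite /step big_map /simple_value; congr ((_ - _) ^+ 2).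
by apply: eq_bigr => u _ /=; rewrite mulrAC.
Qed.

Lemma walsh_step t cs : 0 <= t -> (forall p, p \in cs -> finite_borel p.2) ->
  walsh P F W t (fun _ x _ => step cs x) (step_noise cs t).
Proof.
move=> t0 hcs.
have mstep : measurable_field (Om := Om) t (fun _ x _ => step cs x).
  by apply: measurable_funTS; exact: (measurableT_comp (measurable_step hcs) (measurableT_comp measurable_snd measurable_fst)).
pose us := if 0 < t then map (elementary_of 0 t (fun=> 1)) cs else [::].
have hus u : u \in us -> elementary_on F t u.
  rewrite /us; case: ifPn => // tp; apply: (elementary_of_on (M := 1)) => //.
  - by move=> w; rewrite normr1.
  - by apply/(measurable_wrtP _ (filtration_sigma hF (lexx 0))); exact: measurable_cst.
have walshE w : simple_walsh W us w = step_noise cs t w.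
  rewrite /us; case: ifPn => [tp|].
    rewrite simple_walsh_of mul1r /step_noise -sumrB; apply: eq_bigr => p _.
    by rewrite subrr mulr0 subr0.
  rewrite -leNgt => tn; have -> : t = 0 by apply/le_anti; rewrite tn.
  rewrite /simple_walsh big_nil /step_noise big1// => p _.
  by rewrite subrr mulr0.
have mU : measurable_fun setT (simple_walsh W us).
  by have /Lfun2P[] := simple_walsh_Lfun2 hF hW hus.
split => //; first by rewrite (_ : step_noise cs t = simple_walsh W us)//; apply/funext.
move=> e e0; exists us; split => //; last first.
  by rewrite /sqint integral0_eq ?lee_fin ?ltW// => w _; rewrite walshE subrr expr0n.
rewrite /energy integral0_eq ?lee_fin ?ltW// => w _.
pose g s := (\int[mes]_x ((simple_value us s x w - step cs x) ^+ 2)%:E)%E.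
have g0 s : `]0, t]%classic s -> g s = 0%E.
  rewrite /= in_itv/= => /andP[s0 st]; rewrite /g integral0_eq// => x _.
  rewrite /us (lt_le_trans s0 st) simple_value_of indicE mem_set ?mulr1 ?mul1r ?subrr ?expr0n//.
  by rewrite /= in_itv/= s0 st.
rewrite -[LHS]/(\int[lebesgue_measure]_(s in `[0%R, t]) g s)%E.
rewrite -integral_itv_obnd_cbnd; last first.
  apply: (eq_measurable_fun (cst 0%E)); last exact: measurable_cst.
  by move=> s /set_mem/g0.
by apply: integral0_eq.
Qed.

Section one_coordinate.
Variables (f : Rn R d -> R) (b : R -> Om -> R).
Hypotheses (mf : measurable_fun setT f) (f1 : sqint mes setT f = 1%E).
Hypothesis hb : forall t, 0 <= t -> walsh P F W t (fun _ x _ => f x) (b t).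

Lemma measurable_coordinate_noise t : 0 <= t -> measurable_fun setT (b t).
Proof. by move=> /hb[]. Qed.

Lemma sqint_fin_le (h : Rn R d -> R) (e : R) : (sqint mes setT h <= e%:E)%E ->
  exists c : R, sqint mes setT h = c%:E /\ c <= e.
Proof.
move=> he; have hfin : sqint mes setT h \is a fin_num.
  by rewrite ge0_fin_numE ?sqint_ge0// (le_lt_trans he)// ltry.
by exists (fine (sqint mes setT h)); rewrite fineK//; split => //; rewrite -lee_fin fineK.
Qed.

(** The random variable b t is only some version of the integral of f over [0, t], so
    it is compared with the noise of a step function close to f.  By contraction the
    two are close at both ends of the interval, and the coefficient is bounded. *)
Lemma walsh_elementary_ito T a c (X : Om -> R) (M : R) :
  0 <= a -> a < c -> c <= T -> (forall w, `|X w| <= M) ->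
  measurable_wrt (F a) measurable X ->
  walsh P F W T (fun t x w => (\1_(`]a, c]) t * X w) * f x)
    (fun w => X w * (b c w - b a w)).
Proof.
move=> a0 ac cT XM FX; have c0 : 0 <= c := le_trans a0 (ltW ac).
have T0 : 0 <= T := le_trans c0 cT.
have mX := measurable_wrt_fun (filtration_sub hF a0) FX.
have mproc : measurable_process T (fun t w => \1_(`]a, c]) t * X w).
  apply: measurable_funTS; apply: measurable_funM.
  - by apply: measurableT_comp => //; exact: measurable_fst.
  - exact: (measurableT_comp mX measurable_snd).
split.
- exact: measurable_field_tensor.
- by apply: measurable_funM => //; apply: measurable_funB; exact: measurable_coordinate_noise.
move=> e e0.
(* The two endpoint errors contribute 2 * 16 * c each, and the energy contributes T;
   the last term makes K positive. *)
pose K := M ^+ 2 * (64 * c + T) + 1.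
have K0 : 0 < K by rewrite ltr_wpDl// mulr_ge0 ?sqr_ge0// addr_ge0// mulr_ge0.
pose del := e / K; have del0 : 0 < del by rewrite divr_gt0.
have Kdel : M ^+ 2 * (64 * c + T) * del <= e.
  rewrite -[leRHS](divfK (lt0r_neq0 K0)) -/del mulrC ler_wpM2l ?ltW//.
  by rewrite ltr_pwDr.
have [cs [hcs csf]] := walsh_step_dense (hb ler01) del0.
have [q [qE qdel]] := sqint_fin_le csf.
have q0 : 0 <= q by rewrite -lee_fin -qE sqint_ge0.
have en t : 0 <= t ->
    energy P t (fun _ x _ => step cs x - f x) = (t * q)%:E.
  by move=> t0; exact: energy_space.
have close t : 0 <= t ->
    (sqint P setT (fun w => step_noise cs t w - b t w)%R <= (16 * (t * q))%:E)%E.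
  move=> t0; apply: (walsh_contraction hF hW (walsh_step t0 hcs) (hb t0)).
  by rewrite en.
have mV t : 0 <= t -> measurable_fun setT (step_noise cs t).
  by move=> /walsh_step /(_ hcs)[].
have mB := measurable_coordinate_noise.
exists (map (elementary_of a c X) cs); split.
- exact: elementary_of_on XM FX hcs.
- rewrite (eq_energy P T (chi := fun t x w =>
    (\1_(`]a, c]) t * X w) * (step cs x - f x))); last first.
    by move=> t x w; rewrite simple_value_of mulrBr.
  apply: (le_trans (energy_bounded_mul (M := M) _ _ _)).
  + rewrite /measurable_field (_ : (fun p => _) =
      (fun p : measurableTypeR R * Rn R d * Om => (\1_(`]a, c]) p.1.1 * X p.2) * cst 1 p.1.2)).
      by apply: (measurable_field_tensor mproc); exact: measurable_cst.
    by apply/funext => p; rewrite mulr1.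
  + apply: measurable_funTS; apply: measurable_funB.
      exact: (measurableT_comp (measurable_step hcs) (measurableT_comp measurable_snd measurable_fst)).
    exact: (measurableT_comp mf (measurableT_comp measurable_snd measurable_fst)).
  + move=> t _ w; rewrite normrM indicE; case: (t \in _); rewrite ?normr1 ?normr0 ?mul1r ?mul0r//.
    exact: le_trans (XM w).
  rewrite en// -EFinM lee_fin; apply: le_trans Kdel.
  rewrite -mulrA ler_wpM2l ?sqr_ge0//; apply: ler_pM => //.
  by rewrite lerDr mulr_ge0.
- rewrite (eq_sqint P (D := setT) (g := fun w => X w * ((step_noise cs c w - b c w) -
    (step_noise cs a w - b a w)))); last first.
    by move=> w _; rewrite simple_walsh_of; congr (_ ^+ 2); ring.
  apply: (le_trans (sqint_bounded_mul P (M := M) _ _ _)) => //.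
    by do 2 (apply: measurable_funB; try exact: mV; try exact: mB).
  have h : (sqint P setT (fun w => (step_noise cs c w - b c w) -
      (step_noise cs a w - b a w))%R <= (64 * c * q)%:E)%E.
    rewrite (eq_sqint P (D := setT) (g := fun w => (step_noise cs c w - b c w) +
      (b a w - step_noise cs a w))); last by move=> w _; congr (_ ^+ 2); ring.
    apply: (le_trans (sqintD _ measurableT _ _)).
    + by apply: measurable_funB; [exact: mV|exact: mB].
    + by apply: measurable_funB; [exact: mB|exact: mV].
    have := close a a0; rewrite sqint_sym => ca; have cc := close c c0.
    apply: (@le_trans _ _ (2%:E * (16 * (c * q))%:E + 2%:E * (16 * (a * q))%:E)%E).
      by apply: leeD; rewrite lee_wpmul2l// lee_fin.
    rewrite -!EFinM -EFinD lee_fin.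
    have : a * q <= c * q by rewrite ler_wpM2r// ltW.
    lra.
  apply: (@le_trans _ _ ((M ^+ 2)%:E * (64 * c * q)%:E)%E).
    by rewrite lee_wpmul2l// lee_fin sqr_ge0.
  rewrite -EFinM lee_fin; apply: le_trans Kdel.
  rewrite -[leRHS]mulrA ler_wpM2l ?sqr_ge0//; apply: ler_pM => //.
  + by rewrite mulr_ge0.
  + by rewrite lerDl.
Qed.

Lemma ito_simple_cons (u : ito_elementary R Om) us t w :
  ito_simple_value (u :: us) t w =
  \1_(`]ie_start u, ie_end u]) t * ie_coef u w + ito_simple_value us t w.
Proof. by rewrite /ito_simple_value big_cons. Qed.

Lemma walsh_simple_ito T (us : seq (ito_elementary R Om)) :
  (forall u, u \in us -> ito_elementary_on F T u) ->
  walsh P F W T (fun t x w => ito_simple_value us t w * f x)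
    (ito_simple_integral b us).
Proof.
elim: us => [|u us IH] hus.
  rewrite (_ : (fun t x w => _) = (fun _ _ _ => 0)); last first.
    by apply/funext => t; apply/funext => x; apply/funext => w;
      rewrite /ito_simple_value big_nil mul0r.
  rewrite (_ : ito_simple_integral b [::] = (fun=> 0)); first exact: walsh0.
  by apply/funext => w; rewrite /ito_simple_integral big_nil.
have [/andP[a0 ac] cT [M XM] FX] := hus u (mem_head _ _).
have h1 := walsh_elementary_ito a0 ac cT XM FX.
rewrite (_ : (fun t x w => _) = (fun t x w =>
    (\1_(`]ie_start u, ie_end u]) t * ie_coef u w) * f x + ito_simple_value us t w * f x)); last first.
  by apply/funext => t; apply/funext => x; apply/funext => w;
    rewrite ito_simple_cons mulrDl.
rewrite (_ : ito_simple_integral b _ = (fun w =>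
    ie_coef u w * (b (ie_end u) w - b (ie_start u) w) + ito_simple_integral b us w)); last first.
  by apply/funext => w; rewrite /ito_simple_integral big_cons.
apply: (walshD hF hW h1); apply: IH => v vus.
by apply: hus; rewrite inE vus orbT.
Qed.

Lemma energy_ito T X Y :
  energy P T (fun t x w => X t w * f x - Y t w * f x) =
  (\int[P]_w \int[lebesgue_measure]_(t in `[0%R, T]) ((X t w - Y t w) ^+ 2)%:E)%E.
Proof.
rewrite -(energy_tensor T (fun t w => X t w - Y t w) mf f1).
by apply: eq_energy => t x w; rewrite mulrBl.
Qed.

Lemma ito_dist_ge0 T X Y : (0 <=
  \int[P]_w \int[lebesgue_measure]_(t in `[0%R, T]) ((X t w - Y t w) ^+ 2)%:E)%E.
Proof.
by apply: integral_ge0 => w _; apply: integral_ge0 => t _; rewrite lee_fin sqr_ge0.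
Qed.

(** On a simple process the two sums coincide, and the energy of X(t) f(x) is the
    squared norm of X because f is a unit vector; the rest is closedness. *)
Lemma ito_walsh T X (I : Om -> R) : measurable_process T X ->
  is_ito_integral P F b T X I -> walsh P F W T (fun t x w => X t w * f x) I.
Proof.
move=> mX [us [hus en [/Lfun2P[mI _] /Lnorm2_cvg0 L]]].
apply: walsh_closed => //; first exact: measurable_field_tensor.
move=> e e0.
have [N1 _ h1] := (cvge0P (fun n => ito_dist_ge0 _ _ _)).1 en e e0.
have [N2 _ h2] := (cvge0P (fun n => sqint_ge0 _ _ _)).1 L e e0.
exists (fun t x w => ito_simple_value (us (maxn N1 N2)) t w * f x),
  (ito_simple_integral b (us (maxn N1 N2))); split.
- by apply: walsh_simple_ito => u; exact: hus.
- by rewrite energy_ito; apply: h1; exact: leq_maxl.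
- by apply: h2; exact: leq_maxr.
Qed.

(** The approximating Ito sums are integrals of fields converging for the energy. *)
Lemma ito_exists T X : measurable_process T X ->
  (forall e : R, 0 < e -> exists us, (forall u, u \in us -> ito_elementary_on F T u) /\
     (\int[P]_w \int[lebesgue_measure]_(t in `[0%R, T])
        ((ito_simple_value us t w - X t w) ^+ 2)%:E <= e%:E)%E) ->
  exists I, is_ito_integral P F b T X I.
Proof.
move=> mX H; have mXf := measurable_field_tensor mX mf.
have [|J wJ] := walsh_exists hF hW mXf.
  move=> e e0; have [us [hus use]] := H e e0.
  exists (fun t x w => ito_simple_value us t w * f x), (ito_simple_integral b us).
  by split; [exact: walsh_simple_ito|rewrite energy_ito].
have e0 n : 0 < (n.+1%:R^-1 / 16 : R) by rewrite divr_gt0// invr_gt0.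
pose us n := sval (cid (H _ (e0 n))).
have usP n : (forall u, u \in us n -> ito_elementary_on F T u) /\
     (\int[P]_w \int[lebesgue_measure]_(t in `[0%R, T])
        ((ito_simple_value (us n) t w - X t w) ^+ 2)%:E <= (n.+1%:R^-1 / 16)%:E)%E.
  by rewrite /us; case: cid.
exists J, us; split.
- by move=> n; have [] := usP n.
- apply: cvge0_inv => n; first exact: ito_dist_ge0.
  have [_ /le_trans] := usP n; apply; rewrite lee_fin ler_pdivrMr//.
  by rewrite ler_peMr ?invr_ge0// ler1n.
- split; first exact: walsh_Lfun2 wJ.
  apply/Lnorm2_cvg0; apply: cvge0_inv => n; first exact: sqint_ge0.
  have [hus use] := usP n.
  apply: (le_trans (walsh_contraction hF hW (walsh_simple_ito hus) wJ
    (b := n.+1%:R^-1 / 16) _)).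
    by rewrite energy_ito.
  by rewrite lee_fin mulrC divfK.
Qed.

End one_coordinate.

End coordinates.

(** * Density of simple processes *)

Section lebesgue_mean.
Context (R : realType).
Local Notation leb := (@lebesgue_measure R).

(** The indicator of a ball, as a kernel in two variables: in this form the integral
    over the ball can be exchanged with the integral over its center. *)
Definition window (r t s : R) : R := \1_(`]-oo, r[) `|t - s|.

Lemma measurable_window (r : R) :
  measurable_fun setT (fun p : R * R => window r p.1 p.2).
Proof.
apply: (measurableT_comp (measurable_indic (measurable_itv _))).
by apply: measurableT_comp => //; exact: measurable_funB.
Qed.

Lemma window_ge0 (r t s : R) : 0 <= window r t s.
Proof. by rewrite /window indicE. Qed.

Lemma integral_window (r t : R) (g : R -> R) :
  (\int[leb]_s (window r t s * g s)%:E = \int[leb]_(s in ball t r) (g s)%:E)%E.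
Proof.
rewrite [RHS]integral_mkcond; apply: eq_integral => s _.
rewrite patchE /window indicE; case: ifPn => ts.
  rewrite mem_set ?mul1r// /= in_itv/=; exact: (set_mem ts).
rewrite memNset ?mul0r// => /=; rewrite in_itv/= => h.
by move/negP : ts; apply; exact: mem_set.
Qed.

(** Almost every point is a Lebesgue point, so the mean oscillation over shrinking
    windows tends to zero almost everywhere; boundedness allows integration. *)
Lemma mean_oscillation_cvg0 (f : R -> R) (M T : R) (h : nat -> R) :
  measurable_fun setT f -> (forall x, `|f x| <= M) ->
  (forall n, 0 < h n) -> h n @[n --> \oo] --> (0 : R) ->
  (\int[leb]_(t in `[0%R, T]) \int[leb]_s
     (window (2 * h n) t s * ((f s - f t) ^+ 2 / h n))%:E)%E @[n --> \oo] --> 0%E /\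
  forall n t, (\int[leb]_s (window (2 * h n) t s * ((f s - f t) ^+ 2 / h n))%:E <=
     (16 * M ^+ 2)%:E)%E.
Proof.
move=> mf fM h0 h_0.
have M0 : 0 <= M := le_trans (normr_ge0 _) (fM 0).
have dM s t : `|f s - f t| <= 2 * M.
  by rewrite (le_trans (ler_normB _ _))// mulr2n mulrDl mul1r lerD.
pose g n t := (\int[leb]_s (window (2 * h n) t s * ((f s - f t) ^+ 2 / h n))%:E)%E.
have r0 n : 0 < 2 * h n by rewrite mulr_gt0.
have mball t n : leb (ball t (2 * h n)) = (4 * h n)%:E.
  by rewrite lebesgue_measure_ball ?ltW//; congr EFin; rewrite -mulr_natr; ring.
have mB t n : measurable (ball t (2 * h n) : set R) by exact: measurable_ball.
have gE n t : g n t = (\int[leb]_(s in ball t (2 * h n)) ((f s - f t) ^+ 2 / h n)%:E)%E.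
  exact: integral_window.
have g0 n t : (0 <= g n t)%E.
  rewrite gE; apply: integral_ge0 => s _.
  by rewrite lee_fin divr_ge0 ?sqr_ge0// ltW.
have mfs D t : measurable_fun D (fun s => f s - f t).
  by apply: measurable_funTS; exact: measurable_funB.
have g_le n t : (g n t <= (16 * M ^+ 2)%:E)%E.
  rewrite gE; apply: (@le_trans _ _ (\int[leb]_(s in ball t (2 * h n)) (4 * M ^+ 2 / h n)%:E)%E).
    apply: ge0_integral_mono => s _.
    rewrite !lee_fin divr_ge0 ?sqr_ge0 ?(ltW (h0 n))//= ler_pM2r ?invr_gt0//.
    rewrite -(real_normK (num_real (f s - f t))).
    have -> : 4 * M ^+ 2 = (2 * M) ^+ 2 by ring.
    by rewrite lerXn2r ?nnegrE// mulr_ge0.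
  rewrite (le_trans (lexx _))// (integral_cst leb (mB t n) (4 * M ^+ 2 / h n)%:E).
  rewrite [X in (_ * X)%E]mball -EFinM lee_fin.
  rewrite le_eqVlt; apply/orP; left; apply/eqP; field.
  by rewrite gt_eqF.
have g_davg n t : (g n t <= (8 * M)%:E * davg f t (2 * h n))%E.
  rewrite gE /davg /iavg mball.
  have -> : ((8 * M)%:E * ((4 * h n)%:E^-1 *
      \int[leb]_(y in ball t (2 * h n)) `|((center (f t) \o f) y)%:E|) =
    (2 * M / h n)%:E * \int[leb]_(y in ball t (2 * h n)) `|((center (f t) \o f) y)%:E|)%E.
    rewrite muleA; congr (_ * _)%E; rewrite inver mulf_eq0 gt_eqF//= gt_eqF//.
    rewrite -EFinM; congr EFin; field.
    by rewrite gt_eqF.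
  rewrite -ge0_integralZl_EFin//.
  - apply: ge0_integral_mono => s _.
    rewrite /= -EFinM !lee_fin divr_ge0 ?sqr_ge0 ?(ltW (h0 n))//=.
    rewrite -(real_normK (num_real (f s - f t))) expr2.
    by rewrite [leRHS]mulrAC ler_pM2r ?invr_gt0//; apply: ler_wpM2r.
  - exact: mB.
  - by apply/measurable_EFinP; apply: measurableT_comp => //; exact: mfs.
  - by rewrite divr_ge0// ?mulr_ge0// ltW.
have locf : locally_integrable setT f.
  split => //; first exact: openT.
  move=> K _ cK.
  apply: (@le_lt_trans _ _ (\int[leb]_(x in K) M%:E)%E).
    apply: ge0_le_integral => //.
    + exact: compact_measurable.
    + by apply/measurable_EFinP; apply: measurableT_comp => //; exact: measurable_funTS.
    + by move=> x _; rewrite lee_fin.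
  rewrite integral_cst; last exact: compact_measurable.
  rewrite lte_mul_pinfty ?lee_fin//.
  by have := compact_finite_measure cK.
split; last by move=> n t; exact: g_le.
have mgn n : measurable_fun setT (g n).
  have mp : measurable_fun setT (fun p : R * R =>
      (window (2 * h n) p.1 p.2 * ((f p.2 - f p.1) ^+ 2 / h n))%:E).
    apply/measurable_EFinP; apply: measurable_funM; first exact: measurable_window.
    apply: measurable_funM => //; apply: measurable_funX; apply: measurable_funB.
    - exact: (measurableT_comp mf measurable_snd).
    - exact: (measurableT_comp mf measurable_fst).
  apply: (measurable_fun_fubini_tonelli_F (m2 := leb) _ mp).
  by move=> p; rewrite lee_fin mulr_ge0 ?window_ge0// divr_ge0 ?sqr_ge0// ltW.
have lT : (leb (`[0%R, T] : set (measurableTypeR R)) < +oo)%E.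
  by rewrite lebesgue_measure_itv/=; case: ifP => // _; rewrite ltry.
have ae0 : {ae leb, forall t : measurableTypeR R, `[0%R, T]%classic t ->
    g n t @[n --> \oo] --> 0%E}.
  apply: (negligibleS _ (lebesgue_differentiation locf)) => t /= + ft; apply => _.
  have cd : ((8 * M)%:E * davg f t (2 * h n))%E @[n --> \oo] --> 0%E.
    rewrite -(mule0 (8 * M)%:E); apply: cvgeZl => //.
    apply: ((cvge_at_rightP (davg f t) 0 0%R).1 ft (fun n => 2 * h n)); split => //.
    by rewrite -(mulr0 2); exact: cvgMr.
  apply: (squeeze_cvge _ (cvg_cst 0%E) cd).
  by apply: nearW => n; rewrite g0 g_davg.
apply: (@dominated_cvg0 _ (measurableTypeR R) R leb _ g (cst (16 * M ^+ 2)%:E)) => //.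
- by move=> n; exact: measurable_funTS (mgn n).
- apply: measurable_bounded_integrable => //.
  exact: bounded_cst.
- by move=> n t _; rewrite g0 g_le.
Qed.

End lebesgue_mean.

(** Sampling along the grid of mesh h.  In the cell j a time s_j is selected, and the
    simple process takes the value Y (s_j) on the cell j + 1, where it is known.  For
    a bad choice of s_j this may be far from Y, but the error averaged over s_j is a
    mean oscillation of Y, and some s_j is not worse than the average. *)
Section sampling.
Context (R : realType) (dO : measure_display) (Om : measurableType dO)
  (P : probability Om R) (F : R -> set (set Om)) (hF : filtration F)
  (T : R) (T0 : 0 < T) (Y : R -> Om -> R) (M : R).
Hypothesis mY : measurable_fun setT (fun p : measurableTypeR R * Om => Y p.1 p.2).
Hypothesis YM : forall t w, `|Y t w| <= M.
Hypothesis adY : forall t : R, 0 <= t <= T -> measurable_wrt (F t) measurable (Y t).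
Variable n : nat.
Local Notation leb := (@lebesgue_measure R).

Let h : R := T / n.+1%:R.

Let cell (j : nat) : set R := `]j%:R * h, j.+1%:R * h]%classic.

Let h0 : 0 < h. Proof. by rewrite divr_gt0. Qed.

Let nh : n.+1%:R * h = T.
Proof. by rewrite /h mulrCA divff ?mulr1// pnatr_eq0. Qed.

Let cellE j t : cell j t -> j%:R * h < t /\ t <= j.+1%:R * h.
Proof. by rewrite /cell /= in_itv/= => /andP[]. Qed.

Let measurable_cell j : measurable (cell j : set (measurableTypeR R)).
Proof. exact: measurable_itv. Qed.

Let cell_size j : leb (cell j) = h%:E.
Proof.
rewrite /cell lebesgue_measure_itv/= lte_fin ltr_pM2r// ltr_nat ltnSn.
by rewrite -EFinB -mulrBl -natrB// subSnn mul1r.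
Qed.

Let cell_index t : 0 < t <= T -> exists2 i, (i <= n)%N &
  forall k, \1_(cell k) t = (k == i)%:R :> R.
Proof.
move=> /andP[t0 tT].
have ex : exists k, t <= k.+1%:R * h by exists n; rewrite nh.
exists (ex_minn ex).
  by case: ex_minnP => i ti; apply; rewrite nh.
case: ex_minnP => i ti imin k; rewrite indicE; congr (_%:R); congr nat_of_bool.
apply/idP/eqP => [/set_mem/cellE[kt tk]|->].
  apply/eqP; rewrite eqn_leq (imin _ tk) andbT leqNgt; apply/negP => ik.
  have := lt_le_trans kt ti; rewrite ltr_pM2r// ltr_nat ltnS.
  by rewrite leqNgt ik.
apply/mem_set; rewrite /cell /= in_itv/= ti andbT ltNge; apply/negP => it.
case: i ti imin it => [|i] ti imin it; first by move: it; rewrite mul0r leNgt t0.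
by have := imin _ it; rewrite ltnn.
Qed.

Let cell_sub k t : (k <= n)%N -> cell k t -> 0 < t <= T.
Proof.
move=> kn /cellE[kt tk]; apply/andP; split.
  by apply: le_lt_trans kt; rewrite mulr_ge0// ltW.
by rewrite (le_trans tk)// -nh ler_pM2r// ler_nat.
Qed.

Let gap (s t : R) : \bar R := (\int[P]_w ((Y s w - Y t w) ^+ 2)%:E)%E.

Let gap_ge0 s t : (0 <= gap s t)%E.
Proof. by apply: integral_ge0 => w _; rewrite lee_fin sqr_ge0. Qed.

Let M0 : 0 <= M.
Proof. exact: le_trans (normr_ge0 _) (YM 0 point). Qed.

Let Yd s t w : (Y s w - Y t w) ^+ 2 <= 4 * M ^+ 2.
Proof.
have -> : 4 * M ^+ 2 = (2 * M) ^+ 2 by ring.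
rewrite -(real_normK (num_real _)) lerXn2r ?nnegrE ?mulr_ge0//.
by rewrite (le_trans (ler_normB _ _))// mulr2n mulrDl mul1r lerD.
Qed.

Let mYc (d' : measure_display) (T' : measurableType d') (a : T' -> measurableTypeR R)
    (b : T' -> Om) : measurable_fun setT a -> measurable_fun setT b ->
  measurable_fun setT (fun x => Y (a x) (b x)).
Proof.
move=> ma mb.
have mab : measurable_fun setT (fun x => (a x, b x)) by exact/measurable_fun_pair.
exact: (measurableT_comp mY mab).
Qed.

Let mYd : measurable_fun setT (fun p : measurableTypeR R * measurableTypeR R * Om =>
  ((Y p.1.1 p.2 - Y p.1.2 p.2) ^+ 2)%:E).
Proof.
apply/measurable_EFinP; apply: measurable_funX; apply: measurable_funB; apply: mYc => //.
  by apply: measurableT_comp.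
by apply: measurableT_comp.
Qed.

Let mYs s : measurable_fun setT (Y s).
Proof. exact: (mYc (measurable_cst s) (measurable_id (D := setT))). Qed.

Let gap_le s t : (gap s t <= (4 * M ^+ 2)%:E)%E.
Proof.
rewrite -(probability_integral_cst P (4 * M ^+ 2)%:E); apply: ge0_integral_mono => w _.
by rewrite !lee_fin sqr_ge0 Yd.
Qed.

Let measurable_gap : measurable_fun setT (fun p : measurableTypeR R * measurableTypeR R => gap p.1 p.2).
Proof.
by apply: (measurable_fun_fubini_tonelli_F (m2 := P) _ mYd) => p; rewrite lee_fin sqr_ge0.
Qed.

Let samples (s : nat -> R) : seq (ito_elementary R Om) :=
  [seq ItoElementary (j.+1%:R * h) (j.+2%:R * h) (Y (s j)) | j <- index_iota 0 n].

Let samples_on s : (forall j, cell j (s j)) ->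
  forall u, u \in samples s -> ito_elementary_on F T u.
Proof.
move=> cs u /mapP[j]; rewrite mem_index_iota /= => jn ->.
have [sj js] := cellE (cs j).
have sj0 : 0 <= s j by apply: le_trans (ltW sj); rewrite mulr_ge0// ltW.
split => /=.
- by rewrite mulr_ge0 ?ltW//= ltr_pM2r// ltr_nat.
- by rewrite -nh ler_pM2r// ler_nat.
- by exists M => w.
- move=> B mB; apply: (filtration_mono hF sj0 js); apply: adY => //.
  rewrite sj0 (le_trans js)// -nh ler_pM2r// ler_nat.
  exact: leqW.
Qed.

(** At most one cell contains t; at time 0 and on the first cell the simple process
    vanishes. *)
Let sample_error s t w : 0 <= t <= T ->
  (ito_simple_value (samples s) t w - Y t w) ^+ 2 <= \1_(`[0, h]%classic) t * M ^+ 2 +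
    \sum_(j < n) \1_(cell j.+1) t * (Y (s j) w - Y t w) ^+ 2.
Proof.
move=> /andP[t0 tT].
have -> : ito_simple_value (samples s) t w = \sum_(j < n) \1_(cell j.+1) t * Y (s j) w.
  by rewrite /ito_simple_value big_map big_mkord.
have [[th H]|[i H]] : (`[0, h]%classic t /\ forall k, \1_(cell k.+1) t = 0 :> R) \/
    exists i : 'I_n, forall k, \1_(cell k.+1) t = (k == i)%:R :> R.
  have [t_0|tn0] := eqVneq t 0.
    left; split; first by rewrite /= in_itv/= t0 t_0 ltW.
    move=> k; rewrite indicE memNset// => /cellE[+ _]; rewrite t_0.
    by rewrite ltNge mulr_ge0// ltW.
  have [|[|i] ni H] := @cell_index t; first by rewrite lt_neqAle eq_sym tn0 t0.
    left; split; last by move=> k; rewrite H.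
    have := H 0%N; rewrite eqxx indicE => /eqP; rewrite pnatr_eq1 eqb1 => /set_mem/cellE.
    by rewrite /= in_itv/= t0 mul1r => -[].
  by right; exists (Ordinal ni) => k; rewrite H.
- rewrite big1; last by move=> k _; rewrite H mul0r.
  rewrite big1; last by move=> k _; rewrite H mul0r.
  rewrite indicE mem_set// mul1r addr0 sub0r sqrrN -(real_normK (num_real _)).
  by rewrite lerXn2r ?nnegrE.
- rewrite (bigD1 i)//= big1 => [|k ki]; last first.
    by rewrite H val_eqE (negbTE ki) mul0r.
  rewrite (bigD1 i)//= big1 => [|k ki]; last first.
    by rewrite H val_eqE (negbTE ki) mul0r.
  by rewrite H eqxx !mul1r !addr0 lerDr mulr_ge0 ?sqr_ge0// indicE.
Qed.

Let sample_cost s : (\int[P]_w \int[leb]_(t in `[0%R, T])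
    ((ito_simple_value (samples s) t w - Y t w) ^+ 2)%:E <=
  (M ^+ 2 * h)%:E + \sum_(j < n) \int[leb]_t ((\1_(cell j.+1) t)%:E * gap (s j) t))%E.
Proof.
pose g0 (t : measurableTypeR R) (w : Om) : \bar R := (\1_(`[0, h]%classic) t * M ^+ 2)%:E.
pose gj j (t : measurableTypeR R) (w : Om) : \bar R :=
  (\1_(cell j.+1) t * (Y (s j) w - Y t w) ^+ 2)%:E.
pose G (p : measurableTypeR R * Om) := (g0 p.1 p.2 + \sum_(j < n) gj j p.1 p.2)%E.
have g00 t w : (0 <= g0 t w)%E by rewrite lee_fin mulr_ge0 ?sqr_ge0// indicE.
have gj0 j t w : (0 <= gj j t w)%E by rewrite lee_fin mulr_ge0 ?sqr_ge0// indicE.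
have mgj j : measurable_fun setT (fun p => gj j p.1 p.2).
  apply/measurable_EFinP; apply: measurable_funM.
    exact: (measurableT_comp (measurable_indic (measurable_cell j.+1)) measurable_fst).
  apply: measurable_funX; apply: measurable_funB => //.
  exact: (mYc (measurable_cst (s j)) measurable_snd).
have mg0 : measurable_fun setT (fun p => g0 p.1 p.2).
  apply/measurable_EFinP; apply: measurable_funM => //.
  exact: (measurableT_comp (measurable_indic (measurable_itv `[0, h])) measurable_fst).
have mG : measurable_fun setT G.
  by apply: emeasurable_funD => //; apply: emeasurable_sum.
have G0 p : (0 <= G p)%E by apply: adde_ge0 => //; apply: sume_ge0.
apply: (@le_trans _ _ (\int[P]_w \int[leb]_t G (t, w))%E).
  apply: ge0_integral_mono => w _; apply/andP; split.
    by apply: integral_ge0 => t _; rewrite lee_fin sqr_ge0.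
  rewrite integral_mulindic; apply: ge0_integral_mono => t _; apply/andP; split.
    by rewrite mule_ge0 ?lee_fin ?sqr_ge0// indicE.
  rewrite indicE; have [/set_mem tT|_] := boolP (t \in _); last by rewrite mul0e.
  rewrite mul1e /G /g0 /gj sumEFin -EFinD lee_fin; apply: sample_error.
  by move: tT; rewrite /= in_itv.
rewrite -(fubini_tonelli (m1 := leb) (m2 := P) _ mG G0).
have mcell j : measurable_fun setT (fun t : measurableTypeR R => (\1_(cell j) t)%:E).
  by apply/measurable_EFinP; apply: measurable_indic.
have gjE j t : (\int[P]_w gj j t w = (\1_(cell j.+1) t)%:E * gap (s j) t)%E.
  rewrite /gap -ge0_integralZl_EFin//.
  - by move=> w _; rewrite lee_fin sqr_ge0.
  - by apply/measurable_EFinP; apply: measurable_funX; exact: measurable_funB.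
have mgs j t : measurable_fun setT (gj j t) by exact: measurable_fun_pair2 (mgj j).
have E (t : measurableTypeR R) : (\int[P]_w G (t, w) =
    (\1_(`[0, h]%classic) t * M ^+ 2)%:E + \sum_(j < n) ((\1_(cell j.+1) t)%:E * gap (s j) t))%E.
  rewrite ge0_integralD//; last 3 first.
  - exact: measurable_fun_pair2 mg0.
  - by move=> w _; apply: sume_ge0.
  - by apply: emeasurable_sum => j; exact: mgs.
  congr (_ + _)%E; first exact: (probability_integral_cst P (\1_(`[0, h]%classic) t * M ^+ 2)%:E).
  rewrite ge0_integral_sum//; last by move=> j; exact: mgs.
  by apply: eq_bigr => j _; exact: gjE.
under eq_integral do rewrite E.
have mgapt j : measurable_fun setT (fun t : measurableTypeR R => (\1_(cell j.+1) t)%:E * gap (s j) t)%E.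
  by apply: emeasurable_funM => //; exact: measurable_fun_pair2 measurable_gap.
have gapt0 j (t : measurableTypeR R) : (0 <= (\1_(cell j.+1) t)%:E * gap (s j) t)%E.
  by rewrite mule_ge0// lee_fin indicE.
rewrite ge0_integralD//; last 4 first.
- by move=> t _; exact: (g00 t point).
- by apply/measurable_EFinP; apply: measurable_funM => //; apply: measurable_indic; exact: measurable_itv.
- by move=> t _; apply: sume_ge0.
- by apply: emeasurable_sum.
rewrite ge0_integral_sum//; apply: leeD => //.
under eq_integral do rewrite mulrC EFinM.
rewrite ge0_integralZl_EFin ?sqr_ge0//; last first.
  by apply/measurable_EFinP; apply: measurable_indic; exact: measurable_itv.
rewrite integral_indic//= setIT.
by rewrite lebesgue_measure_itv/= lte_fin h0 EFinN sube0 EFinM.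
Qed.

Let cost (t s : measurableTypeR R) (w : Om) : \bar R :=
  ((\1_(`[0, T]%classic) t)%:E *
   (window (2 * h) t s * ((Y s w - Y t w) ^+ 2 / h))%:E)%E.

Let cost_ge0 t s w : (0 <= cost t s w)%E.
Proof.
rewrite mule_ge0// lee_fin ?indicE// mulr_ge0 ?window_ge0//.
by rewrite divr_ge0 ?sqr_ge0// ltW.
Qed.

Let measurable_cost : measurable_fun setT
  (fun p : measurableTypeR R * measurableTypeR R * Om => cost p.1.1 p.1.2 p.2).
Proof.
apply: emeasurable_funM.
  apply/measurable_EFinP.
  apply: (measurableT_comp (measurable_indic (measurable_itv `[0, T]))
    (g := fun p : measurableTypeR R * measurableTypeR R * Om => p.1.1)).
  by apply: measurableT_comp.
apply/measurable_EFinP; apply: measurable_funM.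
  exact: (measurableT_comp (@measurable_window R (2 * h)) measurable_fst).
apply: measurable_funM => //; apply: measurable_funX.
by apply: measurable_funB; apply: mYc => //; apply: measurableT_comp.
Qed.

Let mean_cost t s : (\int[P]_w cost t s w =
  (\1_(`[0, T]%classic) t * window (2 * h) t s / h)%:E * gap s t)%E.
Proof.
rewrite /cost /gap -ge0_integralZl_EFin//.
- apply: eq_integral => w _; rewrite -!EFinM; congr EFin; ring.
- by move=> w _; rewrite lee_fin sqr_ge0.
- by apply/measurable_EFinP; apply: measurable_funX; exact: measurable_funB.
- by rewrite divr_ge0 ?mulr_ge0 ?window_ge0 ?indicE// ltW.
Qed.

(** A pair of times lies in at most one pair of consecutive cells, and is then less
    than 2 h apart. *)
Let cells_cost s t : (\sum_(j < n) (\1_(cell j) s * \1_(cell j.+1) t / h)%:E * gap s t <=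
  \int[P]_w cost t s w)%E.
Proof.
rewrite mean_cost -ge0_sume_distrl; last first.
  by move=> j _; rewrite lee_fin divr_ge0 ?mulr_ge0 ?indicE// ltW.
rewrite lee_wpmul2r// sumEFin lee_fin -mulr_suml ler_pM2r ?invr_gt0//.
have [sT|sT] := boolP (0 < s <= T); last first.
  rewrite big1 ?mulr_ge0 ?window_ge0 ?indicE// => j _.
  rewrite indicE memNset ?mul0r//; apply: contraNnot sT; exact/cell_sub/ltnW.
have [i _ Hi] := cell_index sT.
have [ni|ni] := leqP n i.
  rewrite big1 ?mulr_ge0 ?window_ge0 ?indicE// => j _.
  by rewrite Hi ltn_eqF ?mul0r// (leq_trans _ ni).
rewrite (bigD1 (Ordinal ni))//= big1 => [|k ki]; last first.
  by rewrite Hi -[i]/(val (Ordinal ni)) val_eqE (negbTE ki) mul0r.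
rewrite Hi eqxx mul1r addr0 indicE.
have [/set_mem ct|_] := boolP (t \in _); last first.
  by rewrite mulr_ge0 ?window_ge0 ?indicE.
have /andP[t0 tT] := cell_sub ni ct.
have cs : cell i s.
  by apply: set_mem; have := Hi i; rewrite eqxx indicE => /eqP; rewrite pnatr_eq1 eqb1.
rewrite indicE mem_set ?mul1r; last by rewrite /= in_itv/= (ltW t0).
rewrite /window indicE mem_set//= in_itv/=.
have [s1 s2] := cellE cs; have [t1 t2] := cellE ct.
move: s1 s2 t1 t2; rewrite -!natr1; move: (i%:R : R) => {Hi cs ct ni}i s1 s2 t1 t2.
by rewrite ltr_norml; apply/andP; split; nra.
Qed.

Let costE w : (\int[leb]_(t in `[0%R, T]) \int[leb]_s
    (window (2 * h) t s * ((Y s w - Y t w) ^+ 2 / h))%:E =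
  \int[leb]_t \int[leb]_s cost t s w)%E.
Proof.
rewrite integral_mulindic; apply: eq_integral => t _.
rewrite ge0_integralZl_EFin ?indicE//.
- by move=> s _; rewrite lee_fin mulr_ge0 ?window_ge0// divr_ge0 ?sqr_ge0// ltW.
- apply/measurable_EFinP; apply: measurable_funM.
    exact: measurable_fun_pair2 (@measurable_window R (2 * h)).
  apply: measurable_funM => //; apply: measurable_funX; apply: measurable_funB => //.
  exact: (mYc (measurable_id (D := setT)) (measurable_cst w)).
Qed.

Lemma measurable_mean_oscillation : measurable_fun setT (fun w =>
  \int[leb]_(t in `[0%R, T]) \int[leb]_s
    (window (2 * h) t s * ((Y s w - Y t w) ^+ 2 / h))%:E)%E.
Proof.
under eq_fun do rewrite costE.
by have [] := tonelli3 leb leb P measurable_cost (fun p => cost_ge0 p.1.1 p.1.2 p.2).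
Qed.

(** The slack h^2 in the choice of each sampling time adds up to at most T h; the
    remaining M^2 h comes from the first cell, where the simple process vanishes. *)
Lemma simple_sampling : exists us, (forall u, u \in us -> ito_elementary_on F T u) /\
  (\int[P]_w \int[leb]_(t in `[0%R, T])
      ((ito_simple_value us t w - Y t w) ^+ 2)%:E <=
    ((M ^+ 2 + T) * h)%:E + \int[P]_w \int[leb]_(t in `[0%R, T]) \int[leb]_s
      (window (2 * h) t s * ((Y s w - Y t w) ^+ 2 / h))%:E)%E.
Proof.
pose B j : \bar R := (\int[leb]_s \int[leb]_t
  ((\1_(cell j) s * \1_(cell j.+1) t / h)%:E * gap s t))%E.
have mcell j : measurable_fun setT (\1_(cell j) : measurableTypeR R -> R).
  by apply: measurable_indic.
have mB j : measurable_fun setT (fun p : measurableTypeR R * measurableTypeR R =>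
    (\1_(cell j) p.1 * \1_(cell j.+1) p.2 / h)%:E * gap p.1 p.2)%E.
  apply: emeasurable_funM => //; apply/measurable_EFinP; apply: measurable_funM => //.
  apply: measurable_funM.
    exact: (measurableT_comp (mcell j) measurable_fst).
  exact: (measurableT_comp (mcell j.+1) measurable_snd).
have B0 j s t : (0 <= (\1_(cell j) s * \1_(cell j.+1) t / h)%:E * gap s t)%E.
  by rewrite mule_ge0// lee_fin divr_ge0 ?mulr_ge0 ?indicE// ltW.
have sumB : (\sum_(j < n) B j <= \int[P]_w \int[leb]_(t in `[0%R, T]) \int[leb]_s
    (window (2 * h) t s * ((Y s w - Y t w) ^+ 2 / h))%:E)%E.
  under eq_integral do rewrite costE.
  have [<- _] := tonelli3 leb leb P measurable_cost (fun p => cost_ge0 p.1.1 p.1.2 p.2).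
  have mmc : measurable_fun setT (fun p : measurableTypeR R * measurableTypeR R =>
      \int[P]_w cost p.1 p.2 w)%E.
    apply: (measurable_fun_fubini_tonelli_F (m2 := P) _ measurable_cost) => p.
    exact: cost_ge0.
  have mc0 p : (0 <= \int[P]_w cost p.1 p.2 w)%E by apply: integral_ge0.
  rewrite /= (fubini_tonelli (m1 := leb) (m2 := leb) _ mmc mc0) /=.
  have mS : measurable_fun setT (fun p : measurableTypeR R * measurableTypeR R =>
      (\sum_(j < n) (\1_(cell j) p.1 * \1_(cell j.+1) p.2 / h)%:E * gap p.1 p.2)%E).
    by apply: emeasurable_sum.
  apply: (@le_trans _ _ (\int[leb]_s \int[leb]_t
      (\sum_(j < n) (\1_(cell j) s * \1_(cell j.+1) t / h)%:E * gap s t))%E).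
    rewrite /B -ge0_integral_sum//; last 2 first.
    - by move=> j; exact: (measurable_fun_fubini_tonelli_F (m2 := leb) _ (mB j) (fun p => B0 j p.1 p.2)).
    - by move=> j s _; apply: integral_ge0.
    apply: ge0_integral_mono => s _; rewrite sume_ge0 => [|j _]; last exact: integral_ge0.
    rewrite -ge0_integral_sum ?lexx// => j.
    exact: measurable_fun_pair2 (mB j).
  apply: ge0_integral_mono => s _; rewrite integral_ge0 => [|t _]; last exact: sume_ge0.
  by apply: ge0_integral_mono => t _; rewrite cells_cost andbT; exact: sume_ge0.
have BE j : B j = (\int[leb]_(s in cell j) ((h^-1)%:E *
    \int[leb]_t ((\1_(cell j.+1) t)%:E * gap s t)))%E.
  rewrite integral_mulindic; apply: eq_integral => s _.
  have mt : measurable_fun setT (fun t : measurableTypeR R => (\1_(cell j.+1) t)%:E * gap s t)%E.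
    apply: emeasurable_funM; last exact: measurable_fun_pair2 measurable_gap.
    exact/measurable_EFinP.
  rewrite muleA -EFinM -ge0_integralZl_EFin//.
  - by apply: eq_integral => t _; rewrite muleA -EFinM; congr (_%:E * _)%E; ring.
  - by move=> t _; rewrite mule_ge0// lee_fin indicE.
  - by rewrite mulr_ge0 ?indicE// invr_ge0 ltW.
have Bfin j : B j \is a fin_num.
  rewrite ge0_fin_numE; last by apply: integral_ge0 => s _; exact: integral_ge0.
  rewrite BE; apply: (@le_lt_trans _ _ (\int[leb]_(s in cell j) (4 * M ^+ 2)%:E)%E).
    apply: ge0_integral_mono => s _; apply/andP; split.
      rewrite mule_ge0 ?lee_fin ?invr_ge0 ?(ltW h0)//.
      by apply: integral_ge0 => t _; rewrite mule_ge0// lee_fin indicE.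
    rewrite lee_pdivrMl// -integral_mulindic.
    apply: (@le_trans _ _ (\int[leb]_(t in cell j.+1) (4 * M ^+ 2)%:E)%E).
      by apply: ge0_integral_mono => t _; rewrite gap_ge0 gap_le.
    by rewrite (integral_cst leb (measurable_cell j.+1)) [X in (_ * X)%E]cell_size muleC.
  by rewrite (integral_cst leb (measurable_cell j)) [X in (_ * X)%E]cell_size -EFinM ltry.
have hs j : exists2 s, cell j s &
    (\int[leb]_t ((\1_(cell j.+1) t)%:E * gap s t) <= B j + (h * h)%:E)%E.
  have B0' : 0 <= fine (B j).
    by apply: fine_ge0; apply: integral_ge0 => s _; apply: integral_ge0.
  have [|s cs ps] := @exists_le_mean _ (measurableTypeR R) R leb (cell j)
      (fun s => (\int[leb]_t ((\1_(cell j.+1) t)%:E * gap s t))%E) h (fine (B j)) (h * h)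
      (measurable_cell j) (cell_size j) h0 (mulr_gt0 h0 h0) B0'.
    by rewrite fineK// -BE.
  by exists s => //; rewrite EFinD fineK in ps.
pose s j := sval (cid2 (hs j)).
have cs j : cell j (s j) by rewrite /s; case: cid2.
have sB j : (\int[leb]_t ((\1_(cell j.+1) t)%:E * gap (s j) t) <= B j + (h * h)%:E)%E.
  by rewrite /s; case: cid2.
exists (samples s); split; first exact: samples_on.
apply: (le_trans (sample_cost s)).
rewrite mulrDl EFinD -addeA leeD2l//.
apply: (@le_trans _ _ (\sum_(j < n) (B j + (h * h)%:E))%E).
  by apply: lee_sum => j _; exact: sB.
rewrite big_split/= addeC; apply: leeD => //.
rewrite sumEFin lee_fin sumr_const card_ord -mulr_natl mulrA ler_pM2r// -nh.
by rewrite ler_pM2r// ler_nat.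
Qed.

End sampling.

Section density.
Context (R : realType) (dO : measure_display) (Om : measurableType dO)
  (P : probability Om R).
Local Notation leb := (@lebesgue_measure R).

Let cylinder (T : R) : set (measurableTypeR R * Om) := `[0, T] `*` setT.

Let measurable_cylinder T : measurable (cylinder T).
Proof. by apply: measurableX => //; exact: measurable_itv. Qed.

Let integral_cylinder T (u : R -> Om -> \bar R) w :
  (\int[leb]_(t in `[0%R, T]) u t w =
   \int[leb]_t ((fun p => u p.1 p.2) \_ (cylinder T)) (t, w))%E.
Proof.
rewrite integral_mkcond; apply: eq_integral => t _; rewrite !patchE.
have -> : ((t, w) \in cylinder T) = (t \in `[0, T]%classic); last by [].
by apply/idP/idP => /set_mem tT; apply/mem_set => //; case: tT.
Qed.

Let cylinder_ge0 T (u : R -> Om -> \bar R) : (forall t w, 0 <= u t w)%E ->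
  forall p, (0 <= ((fun p => u p.1 p.2) \_ (cylinder T)) p)%E.
Proof. by move=> u0 p; rewrite patchE; case: ifP. Qed.

Lemma measurable_time_integral T (u : R -> Om -> \bar R) :
  measurable_fun (cylinder T) (fun p => u p.1 p.2) -> (forall t w, 0 <= u t w)%E ->
  measurable_fun setT (fun w => \int[leb]_(t in `[0%R, T]) u t w)%E.
Proof.
move=> mu u0; under eq_fun do rewrite integral_cylinder.
have mu' := (measurable_restrictT _ (measurable_cylinder T)).1 mu.
have := measurable_fun_fubini_tonelli_G (m1 := leb) _ mu' (cylinder_ge0 T u0).
by rewrite /fubini_G.
Qed.

Lemma measurable_time_section T (u : R -> Om -> \bar R) w :
  measurable_fun (cylinder T) (fun p => u p.1 p.2) ->
  measurable_fun (`[0, T]%classic : set (measurableTypeR R)) (u ^~ w).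
Proof.
move=> /(measurable_restrictT _ (measurable_cylinder T)).1 mu.
apply/(measurable_restrictT _ (measurable_itv `[0, T])).
have := measurable_fun_pair1 w mu.
congr measurable_fun; apply/funext => t; rewrite !patchE.
have -> : ((t, w) \in cylinder T) = (t \in `[0, T]%classic); last by [].
by apply/idP/idP => /set_mem tT; apply/mem_set => //; case: tT.
Qed.

Lemma iterated_dominated_cvg0 T (u : nat -> R -> Om -> \bar R) (g : R -> Om -> \bar R) :
  (forall n, measurable_fun (cylinder T) (fun p => u n p.1 p.2)) ->
  measurable_fun (cylinder T) (fun p => g p.1 p.2) ->
  (forall n t w, 0 <= u n t w <= g t w)%E ->
  (\int[P]_w \int[leb]_(t in `[0%R, T]) g t w < +oo)%E ->
  (forall t w, 0 <= t <= T -> g t w \is a fin_num -> u n t w @[n --> \oo] --> 0%E) ->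
  (\int[P]_w \int[leb]_(t in `[0%R, T]) u n t w)%E @[n --> \oo] --> 0%E.
Proof.
move=> mu mg ug goo uc.
have u0 n t w : (0 <= u n t w)%E by case/andP: (ug n t w).
have g0 t w : (0 <= g t w)%E by case/andP: (ug 0%N t w) => /le_trans; exact.
have G0 w : (0 <= \int[leb]_(t in `[0%R, T]) g t w)%E by exact: integral_ge0.
have iG : P.-integrable setT (fun w => \int[leb]_(t in `[0%R, T]) g t w)%E.
  apply/integrableP; split; first exact: measurable_time_integral.
  by under eq_integral do rewrite gee0_abs//.
apply: (dominated_cvg0 measurableT _ iG) => //.
- by move=> n; exact: measurable_time_integral.
- move=> n w _; rewrite integral_ge0//=.
  by apply: ge0_integral_mono => t _.
have := integrable_ae measurableT iG; apply: filterS => w /(_ I) Gw _.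
have ig : leb.-integrable (`[0, T]%classic : set (measurableTypeR R)) (g ^~ w).
  apply/integrableP; split; first exact: measurable_time_section.
  by under eq_integral do rewrite gee0_abs//; rewrite -ge0_fin_numE.
apply: (@dominated_cvg0 _ (measurableTypeR R) R leb _ _ _ (measurable_itv `[0, T]) _ ig) => //.
- by move=> n; exact: measurable_time_section.
have mI : measurable (`[0, T]%classic : set (measurableTypeR R)) by exact: measurable_itv.
have := integrable_ae mI ig.
apply: negligibleS => t /= + gt; apply => tT.
by apply: uc; [move: tT; rewrite /= in_itv|exact: gt].
Qed.

Lemma ge0_iterated_le T (u v : R -> Om -> \bar R) (a b : R) :
  measurable_fun (cylinder T) (fun p => u p.1 p.2) ->
  measurable_fun (cylinder T) (fun p => v p.1 p.2) ->
  (forall t w, 0 <= u t w)%E -> (forall t w, 0 <= v t w)%E ->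
  (\int[P]_w \int[leb]_(t in `[0%R, T]) u t w <= a%:E)%E ->
  (\int[P]_w \int[leb]_(t in `[0%R, T]) v t w <= b%:E)%E ->
  (\int[P]_w \int[leb]_(t in `[0%R, T]) (u t w + v t w) <= (a + b)%:E)%E.
Proof.
move=> mu mv u0 v0 ua vb.
have mI : measurable (`[0, T]%classic : set (measurableTypeR R)) by exact: measurable_itv.
have E w : (\int[leb]_(t in `[0%R, T]) (u t w + v t w) =
    \int[leb]_(t in `[0%R, T]) u t w + \int[leb]_(t in `[0%R, T]) v t w)%E.
  by apply: (@ge0_integralD _ (measurableTypeR R) R leb _ mI) => //;
    exact: measurable_time_section.
under eq_integral do rewrite E.
rewrite ge0_integralD//; first by rewrite EFinD leeD.
- by move=> w _; exact: integral_ge0.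
- exact: measurable_time_integral.
- by move=> w _; exact: integral_ge0.
- exact: measurable_time_integral.
Qed.

Lemma measurable_ito_simple (F : R -> set (set Om)) (hF : filtration F) T us :
  (forall u, u \in us -> ito_elementary_on F T u) ->
  measurable_fun setT (fun p : measurableTypeR R * Om => ito_simple_value us p.1 p.2).
Proof.
elim: us => [|u us IH] hus.
  rewrite (_ : (fun p => _) = cst 0); first exact: measurable_cst.
  by apply/funext => p; rewrite /ito_simple_value big_nil.
under eq_fun do rewrite /ito_simple_value big_cons.
apply: measurable_funD; last by apply: IH => v vus; apply: hus; rewrite inE vus orbT.
have [/andP[a0 _] _ _ mX] := hus u (mem_head _ _).
apply: measurable_funM.
  exact: (measurableT_comp (measurable_indic (measurable_itv `]ie_start u, ie_end u])) measurable_fst).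
apply: measurableT_comp => // _ B mB; rewrite setTI.
exact: (filtration_sub hF a0 (mX _ mB)).
Qed.

(** Truncation at a high level changes the process little, and makes it bounded; a
    truncated process is sampled along a fine grid. *)
Lemma simple_process_dense (F : R -> set (set Om)) (hF : filtration F) T (X : R -> Om -> R) :
  0 < T -> measurable_fun (cylinder T) (fun p => X p.1 p.2) ->
  (forall t : R, 0 <= t <= T -> measurable_wrt (F t) measurable (X t)) ->
  (\int[P]_w \int[leb]_(t in `[0%R, T]) (X t w ^+ 2)%:E < +oo)%E ->
  forall e : R, 0 < e -> exists us, (forall u, u \in us -> ito_elementary_on F T u) /\
    (\int[P]_w \int[leb]_(t in `[0%R, T]) ((ito_simple_value us t w - X t w) ^+ 2)%:E <=
     e%:E)%E.
Proof.
move=> T0 mX adX Xoo e e0.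
pose clip (N : nat) (x : R) := Num.max (- N%:R) (Num.min x N%:R).
have mclip N : measurable_fun setT (clip N).
  by apply: measurable_maxr => //; apply: measurable_minr.
pose Y N t w : R := ((fun p => clip N (X p.1 p.2)) \_ (cylinder T)) (t, w).
have YE N t w : 0 <= t <= T -> Y N t w = clip N (X t w).
  by move=> tT; rewrite /Y patchE mem_set//; split => //=; rewrite in_itv.
have clipN N x : `|clip N x| <= N%:R.
  rewrite ler_norml /clip; apply/andP; split; first by rewrite le_max lexx.
  by rewrite ge_max ge_min lexx orbT andbT lerNl (le_trans _ (ler0n _ N))// lerNl oppr0.
have YM N t w : `|Y N t w| <= N%:R.
  by rewrite /Y patchE; case: ifP => // _; rewrite normr0.
have mY N : measurable_fun setT (fun p : measurableTypeR R * Om => Y N p.1 p.2).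
  rewrite (_ : (fun p => _) = (fun p => clip N (X p.1 p.2)) \_ (cylinder T)); last first.
    by apply/funext => -[].
  apply/(measurable_restrictT _ (measurable_cylinder T)).
  exact: measurableT_comp (mclip N) mX.
have adY N t : 0 <= t <= T -> measurable_wrt (F t) measurable (Y N t).
  move=> tT; rewrite (_ : Y N t = clip N \o X t); last by apply/funext => w; exact: YE.
  move=> B mB; rewrite comp_preimage; apply: adX => //.
  by rewrite -[X in measurable X]setTI; exact: mclip.
have [N hN] : exists N, (\int[P]_w \int[leb]_(t in `[0%R, T]) ((Y N t w - X t w) ^+ 2)%:E <=
    (e / 4)%:E)%E.
  have X2 t w : (0 <= (X t w ^+ 2)%:E)%E by rewrite lee_fin sqr_ge0.
  have mX2 : measurable_fun (cylinder T) (fun p => (X p.1 p.2 ^+ 2)%:E).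
    by apply/measurable_EFinP; exact: measurable_funX.
  have mYX N : measurable_fun (cylinder T) (fun p => ((clip N (X p.1 p.2) - X p.1 p.2) ^+ 2)%:E).
    apply/measurable_EFinP; apply: measurable_funX; apply: measurable_funB => //.
    exact: measurableT_comp (mclip N) mX.
  have clipB N x : (clip N x - x) ^+ 2 <= x ^+ 2.
    have := ler0n R N; rewrite /clip; move: (N%:R : R) => m m0.
    case: (leP x m) => h1; last first.
      have h : 0 <= m * (x - m) by rewrite mulr_ge0 ?subr_ge0// ltW.
      by rewrite (max_idPr _); nra.
    case: (leP (- m) x) => h2; first by rewrite subrr expr0n sqr_ge0.
    have h : 0 <= m * (- m - x) by rewrite mulr_ge0 ?subr_ge0// ltW.
    nra.
  have c0 : (\int[P]_w \int[leb]_(t in `[0%R, T]) ((clip N (X t w) - X t w) ^+ 2)%:E)%E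
      @[N --> \oo] --> 0%E.
    apply: (iterated_dominated_cvg0 (g := fun t w => (X t w ^+ 2)%:E) mYX mX2).
    - by move=> N t w; rewrite !lee_fin sqr_ge0 clipB.
    - exact: Xoo.
    - move=> t w _ _; apply: cvg_near_cst.
      near=> N; have XN : `|X t w| <= N%:R by near: N; exact: nbhs_infty_ger.
      move: XN; rewrite ler_norml /clip => /andP[h1 h2].
      by rewrite (min_idPl h2) (max_idPr h1) subrr expr0n.
  have c00 N : (0 <= \int[P]_w \int[leb]_(t in `[0%R, T]) ((clip N (X t w) - X t w) ^+ 2)%:E)%E.
    by apply: integral_ge0 => w _; apply: integral_ge0 => t _; rewrite lee_fin sqr_ge0.
  have [N _ /(_ N (leqnn N)) hN] := (cvge0P c00).1 c0 _ (divr_gt0 e0 (ltr0n _ 4)).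
  exists N; apply: le_trans hN; apply: ge0_integral_mono => w _.
  rewrite integral_ge0/= => [|t _]; last by rewrite lee_fin sqr_ge0.
  apply: ge0_integral_mono => t tT; rewrite lee_fin sqr_ge0 YE ?lexx//.
have h0 n : 0 < T / n.+1%:R by rewrite divr_gt0.
have h_0 : T / n.+1%:R @[n --> \oo] --> (0 : R).
  by rewrite -(mulr0 T); apply: cvgMr; exact: cvg_harmonic.
have [n hn1 hn2] : exists2 n, (\int[P]_w \int[leb]_(t in `[0%R, T]) \int[leb]_s
   (window (2 * (T / n.+1%:R)) t s * ((Y N s w - Y N t w) ^+ 2 / (T / n.+1%:R)))%:E <=
    (e / 8)%:E)%E & (N%:R ^+ 2 + T) * (T / n.+1%:R) <= e / 8.
  pose A n w := (\int[leb]_(t in `[0%R, T]) \int[leb]_s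
     (window (2 * (T / n.+1%:R)) t s * ((Y N s w - Y N t w) ^+ 2 / (T / n.+1%:R)))%:E)%E.
  have A0 n w : (0 <= A n w)%E.
    apply: integral_ge0 => t _; apply: integral_ge0 => s _.
    by rewrite lee_fin mulr_ge0 ?window_ge0// divr_ge0 ?sqr_ge0// ltW.
  have mo w : A n w @[n --> \oo] --> 0%E /\ forall n, (A n w <= (16 * N%:R ^+ 2 * T)%:E)%E.
    have mYw : measurable_fun setT (Y N ^~ w : measurableTypeR R -> R).
      exact: measurable_fun_pair1 (mY N).
    have [c b] := mean_oscillation_cvg0 T mYw (fun t => YM N t w) h0 h_0.
    split=> // n.
    apply: (@le_trans _ _ (\int[leb]_(t in `[0%R, T]) (16 * N%:R ^+ 2)%:E)%E).
      apply: ge0_integral_mono => t _; rewrite b andbT.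
      apply: integral_ge0 => s _.
      by rewrite lee_fin mulr_ge0 ?window_ge0// divr_ge0 ?sqr_ge0// ltW.
    have mI : measurable (`[0, T]%classic : set (measurableTypeR R)) by exact: measurable_itv.
    rewrite (integral_cst leb mI (16 * N%:R ^+ 2)%:E) [X in (_ * X)%E]lebesgue_measure_itv/=.
    by rewrite lte_fin T0 sube0 -EFinM.
  have c1 : (\int[P]_w A n w)%E @[n --> \oo] --> 0%E.
    apply: (@dominated_cvg0 _ _ _ P _ _ (cst (16 * N%:R ^+ 2 * T)%:E)) => //.
    - by move=> n; exact: (@measurable_mean_oscillation _ _ _ P _ T0 (Y N) (mY N) n).
    - exact: finite_measure_integrable_cst.
    - by move=> n w _; rewrite A0 (mo w).2.
    - by apply: aeW => w _; exact: (mo w).1.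
  have c2 : (N%:R ^+ 2 + T) * (T / n.+1%:R) @[n --> \oo] --> (0 : R).
    by rewrite -(mulr0 (N%:R ^+ 2 + T)); apply: cvgMr.
  have [n1 _ H1] := (cvge0P (fun n => integral_ge0 _ (fun w _ => A0 n w))).1 c1 _ (divr_gt0 e0 (ltr0n _ 8)).
  have /cvgrPdist_le /(_ _ (divr_gt0 e0 (ltr0n _ 8))) [n2 _ H2] := c2.
  exists (maxn n1 n2); first exact: H1 (leq_maxl _ _).
  have := H2 _ (leq_maxr n1 n2); rewrite sub0r normrN; apply: le_trans; exact: ler_norm.
have [us [hus use]] := simple_sampling P hF T0 (mY N) (YM N) (@adY N) n.
exists us; split => //.
have uY : (\int[P]_w \int[leb]_(t in `[0%R, T]) ((ito_simple_value us t w - Y N t w) ^+ 2)%:E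
    <= (e / 4)%:E)%E.
  apply: (le_trans use); apply: (@le_trans _ _ ((e / 8)%:E + (e / 8)%:E)%E).
    by apply: leeD => //; rewrite lee_fin.
  by rewrite -EFinD lee_fin; lra.
have mYX : measurable_fun (cylinder T) (fun p => Y N p.1 p.2 - X p.1 p.2).
  by apply: measurable_funB => //; exact: measurable_funTS (mY N).
have muY : measurable_fun (cylinder T) (fun p => ito_simple_value us p.1 p.2 - Y N p.1 p.2).
  by apply: measurable_funTS; apply: measurable_funB => //; exact: measurable_ito_simple hus.
have sq0 (c x : R) : 0 <= c -> (0 <= (c * x ^+ 2)%:E)%E.
  by move=> c0; rewrite lee_fin mulr_ge0 ?sqr_ge0.
apply: (@le_trans _ _ (\int[P]_w \int[leb]_(t in `[0%R, T])
   ((2 * (ito_simple_value us t w - Y N t w) ^+ 2)%:E + (2 * (Y N t w - X t w) ^+ 2)%:E))%E).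
  apply: ge0_integral_mono => w _; rewrite integral_ge0/= => [|t _]; last by rewrite lee_fin sqr_ge0.
  apply: ge0_integral_mono => t _; rewrite -EFinD !lee_fin sqr_ge0/=.
  move: (ito_simple_value us t w) (Y N t w) (X t w) => a b c.
  have := sqr_ge0 (a - 2 * b + c); nra.
have twice (u : R -> Om -> R) (a : R) : measurable_fun (cylinder T) (fun p => u p.1 p.2) ->
    (\int[P]_w \int[leb]_(t in `[0%R, T]) (u t w ^+ 2)%:E <= a%:E)%E ->
    (\int[P]_w \int[leb]_(t in `[0%R, T]) (2 * u t w ^+ 2)%:E <= (2 * a)%:E)%E.
  move=> mu ua.
  have mu2 : measurable_fun (cylinder T) (fun p => (u p.1 p.2 ^+ 2)%:E).
    by apply/measurable_EFinP; exact: measurable_funX.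
  have u0 t w : (0 <= (u t w ^+ 2)%:E)%E by rewrite lee_fin sqr_ge0.
  have := ge0_iterated_le mu2 mu2 u0 u0 ua ua.
  rewrite -[in (a + a)](mulr1 a) -mulrDr mulrC; apply: le_trans.
  by rewrite le_eqVlt; apply/orP; left; apply/eqP; apply: eq_integral => w _;
    apply: eq_integral => t _; rewrite -EFinD mulr2n mulrDl mul1r.
have -> : e = 2 * (e / 4) + 2 * (e / 4) by lra.
have m2 (u : R -> Om -> R) : measurable_fun (cylinder T) (fun p => u p.1 p.2) ->
  measurable_fun (cylinder T) (fun p => (2 * u p.1 p.2 ^+ 2)%:E).
  by move=> mu; apply/measurable_EFinP; apply: measurable_funM => //; exact: measurable_funX.
apply: (ge0_iterated_le (m2 (fun t w => ito_simple_value us t w - Y N t w) muY)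
  (m2 (fun t w => Y N t w - X t w) mYX)).
- by move=> t w; exact: sq0.
- by move=> t w; exact: sq0.
- exact: (twice (fun t w => ito_simple_value us t w - Y N t w) _ muY uY).
- exact: (twice (fun t w => Y N t w - X t w) _ mYX hN).
Unshelve. all: by end_near.
Qed.

End density.

(** * Coordinates in the space of square integrable functions *)

Lemma has_int_dot (d : measure_display) (T : measurableType d) (R : realType)
    (mu : {measure set T -> \bar R}) (f g : T -> R) :
  f \in Lfun mu 2%:E -> g \in Lfun mu 2%:E ->
  has_int mu setT (fun x => f x * g x) (\int[mu]_x (f x * g x))%R.
Proof.
move=> f2 g2; rewrite /Rintegral; apply: integrable_has_int => //.
by apply/Lfun1_integrable; exact: (Lfun2_mul_Lfun1 f2 g2).
Qed.

Lemma has_int_uniq (d : measure_display) (T : measurableType d) (R : realType)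
    (mu : {measure set T -> \bar R}) D (f : T -> R) (r s : R) :
  has_int mu D f r -> has_int mu D f s -> r = s.
Proof. by move=> [_ h] [_]; rewrite h => -[]. Qed.

(** Cauchy-Schwarz for a unit vector u: the distance of h to its projection on u has a
    nonnegative square. *)
Lemma dot_sqr_le (d : measure_display) (T : measurableType d) (R : realType)
    (mu : {measure set T -> \bar R}) (h u : T -> R) :
  h \in Lfun mu 2%:E -> u \in Lfun mu 2%:E -> (\int[mu]_x (u x * u x))%R = 1 ->
  (((\int[mu]_x (h x * u x))%R ^+ 2)%:E <= sqint mu setT h)%E.
Proof.
move=> h2 u2 u1; set a := (\int[mu]_x (h x * u x))%R.
have [[hh hu] uu] := (has_int_dot h2 h2, has_int_dot h2 u2, has_int_dot u2 u2).
rewrite u1 in uu.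
have [_ hE] : has_int mu setT (fun x => h x ^+ 2) (\int[mu]_x (h x * h x))%R.
  by apply: eq_has_int hh => // x _; rewrite expr2.
have [_ E] : has_int mu setT (fun x => (h x - a * u x) ^+ 2)
    ((\int[mu]_x (h x * h x))%R - (2 * a * a - a ^+ 2 * 1)).
  have := has_intB measurableT hh (has_intB measurableT
    (has_intZ measurableT (2 * a) hu) (has_intZ measurableT (a ^+ 2) uu)).
  by apply: eq_has_int => // x _; ring.
have := sqint_ge0 mu setT (fun x => h x - a * u x).
by rewrite /sqint E hE !lee_fin; move: (Rintegral _ _ _) => q; lra.
Qed.

Section orthonormal_family.
Context (d : measure_display) (T : measurableType d) (R : realType).
Variables (mu : {measure set T -> \bar R}) (e : nat -> T -> R).
Hypothesis e2 : forall k, e k \in Lfun mu 2%:E.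
Hypothesis orthonormal : forall i j, (\int[mu]_x (e i x * e j x))%R = (i == j)%:R.

Local Notation coef f k := (\int[mu]_x (f x * e k x))%R.

Local Notation proj f m := (fun x => \sum_(k < m) coef f k * e k x).

Let residual_int f m : f \in Lfun mu 2%:E ->
  has_int mu setT (fun x => (f x - proj f m x) ^+ 2)
    ((\int[mu]_x (f x * f x))%R - \sum_(k < m) coef f k ^+ 2) /\
  forall j, (m <= j)%N -> has_int mu setT (fun x => (f x - proj f m x) * e j x) (coef f j).
Proof.
move=> f2; elim: m => [|m [IH1 IH2]].
  split=> [|j _].
    rewrite big_ord0 subr0; have := has_int_dot f2 f2; apply: eq_has_int => // x _.
    by rewrite big_ord0 subr0 expr2.
  have := has_int_dot f2 (e2 j); apply: eq_has_int => // x _.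
  by rewrite big_ord0 subr0.
have he i j := has_int_dot (e2 i) (e2 j).
have step x : f x - proj f m.+1 x = (f x - proj f m x) - coef f m * e m x.
  by rewrite big_ord_recr/= opprD addrA.
split=> [|j mj].
  have := has_intB measurableT IH1 (has_intB measurableT
    (has_intZ measurableT (2 * coef f m) (IH2 m (leqnn m)))
    (has_intZ measurableT (coef f m ^+ 2) (he m m))).
  rewrite orthonormal eqxx big_ord_recr/= mulr1.
  have -> : forall a b c : R, a - b - (2 * c * c - c ^+ 2) = a - (b + c ^+ 2) by move=> *; ring.
  by apply: eq_has_int => // x _; rewrite step; ring.
have := has_intB measurableT (IH2 j (ltnW mj)) (has_intZ measurableT (coef f m) (he m j)).
rewrite orthonormal ltn_eqF// mulr0 subr0.
by apply: eq_has_int => // x _; rewrite step; ring.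
Qed.

(** Pythagoras: subtracting the projection on one more basis vector removes the square
    of the corresponding coefficient. *)
Lemma residualE f m : f \in Lfun mu 2%:E ->
  sqint mu setT (fun x => f x - proj f m x)%R =
  ((\int[mu]_x (f x * f x))%R - \sum_(k < m) coef f k ^+ 2)%:E.
Proof. by move=> /(residual_int m)[[_]]. Qed.

Lemma sqint_normE f : f \in Lfun mu 2%:E ->
  sqint mu setT f = (\int[mu]_x (f x * f x))%:E.
Proof.
move=> f2; have [_ <-] := has_int_dot f2 f2.
by apply: eq_integral => x _; rewrite expr2.
Qed.

End orthonormal_family.

(** The sum of the squares has a finite integral, so it is finite almost everywhere
    and its terms tend to zero. *)
Lemma fast_sqint_cvg0 (d : measure_display) (T : measurableType d) (R : realType)
    (mu : {measure set T -> \bar R}) (g : nat -> T -> R) :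
  (forall j, measurable_fun setT (g j)) ->
  (forall j, (sqint mu setT (g j) <= (1 / (2 ^ j.+1)%:R)%:E)%E) ->
  {ae mu, forall x, g j x @[j --> \oo] --> (0 : R)}.
Proof.
move=> mg gj.
have mg2 j := measurable_sqr (mg j).
have g20 j x : (0 <= (g j x ^+ 2)%:E)%E by rewrite lee_fin sqr_ge0.
have ig : mu.-integrable setT (fun x => \sum_(0 <= j <oo) (g j x ^+ 2)%:E)%E.
  apply/integrableP; split; first exact: ge0_emeasurable_sum.
  rewrite (eq_integral (fun x => \sum_(0 <= j <oo) (g j x ^+ 2)%:E))%E => [|x _]; last first.
    by rewrite gee0_abs//; apply: nneseries_ge0.
  rewrite integral_nneseries//.
  apply: (@le_lt_trans _ _ 1%:E); last exact: ltry.
  apply: le_trans (epsilon_trick0 xpredT ler01); apply: lee_nneseries => [j _ _|j _].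
    exact: integral_ge0.
  exact: gj.
apply: filterS (integrable_ae measurableT ig) => x /(_ I) xfin.
have /nnseries_is_cvg/cvg_series_cvg_0 g2 : (\sum_(0 <= j <oo) (g j x ^+ 2)%:E < +oo)%E.
  by rewrite -ge0_fin_numE//; exact: nneseries_ge0.
have {}g2 := g2 (fun j => sqr_ge0 _).
apply/cvgrPdist_lt => r r0.
have /cvgrPdist_lt /(_ _ (exprn_gt0 2 r0)) := g2; apply: filterS => j.
rewrite !sub0r !normrN ger0_norm ?sqr_ge0// => h.
by rewrite -(@ltr_pXn2r _ 2) ?nnegrE ?(ltW r0)// real_normK// num_real.
Qed.

(** * Measurable selection of a representative *)

Section assembling.
Context (R : realType).
Implicit Types (c E : nat -> R) (j n m : nat).

Definition negligible_tail c j m :=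
  forall n, \sum_(m <= k < n) c k ^+ 2 <= 1 / (2 ^ j.+1)%:R.

(** The number of terms has to depend on the coefficients, but does so through
    countably many inequalities between them, hence measurably. *)
Definition cutoff c j : nat :=
  if pselect (exists m, `[< negligible_tail c j m >]) is left H then ex_minn H else 0.

(** The superior limit is measurable without any assumption of convergence. *)
Definition assemble c E : R :=
  fine (limn_esup (fun j => (\sum_(k < cutoff c j) c k * E k)%:E)).

Lemma assemble_cvg c E (l : R) :
  (\sum_(k < cutoff c j) c k * E k) @[j --> \oo] --> l -> assemble c E = l.
Proof.
move=> cl; have /cvg_limn_einf_sup[_ h] :
    (\sum_(k < cutoff c j) c k * E k)%:E @[j --> \oo] --> l%:E.
  by apply/fine_cvgP; split; [exact: nearW|exact: cl].
by rewrite /assemble h.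
Qed.

Lemma cutoffP c j m : negligible_tail c j m -> negligible_tail c j (cutoff c j).
Proof.
move=> cm; rewrite /cutoff; case: pselect => [H|[]]; first by case: ex_minnP => p /asboolP.
by exists m; exact/asboolP.
Qed.

(** Split according to the countably many values of N. *)
Lemma measurable_select (d : measure_display) (T : measurableType d)
    (N : T -> nat) (f : nat -> T -> R) :
  (forall m, measurable [set y | N y = m]) -> (forall m, measurable_fun setT (f m)) ->
  measurable_fun setT (fun y => f (N y) y).
Proof.
move=> mN mf _ B mB; rewrite setTI.
rewrite (_ : _ @^-1` _ = \bigcup_m ([set y | N y = m] `&` f m @^-1` B)); last first.
  by apply/seteqP; split => y /= => [fB|[m _ [<-]]]//; exists (N y).
apply: bigcup_measurable => m _; apply: measurableI => //.
by rewrite -[X in measurable X]setTI; exact: mf.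
Qed.

Lemma measurable_cutoff (d : measure_display) (T : measurableType d)
    (c : nat -> T -> R) j m :
  (forall k, measurable_fun setT (c k)) -> measurable [set y | cutoff (c ^~ y) j = m].
Proof.
move=> mc.
have mt p : measurable [set y | negligible_tail (c ^~ y) j p].
  rewrite (_ : [set y | _] = \bigcap_n [set y | \sum_(p <= k < n) c k y ^+ 2 <= 1 / (2 ^ j.+1)%:R]).
    apply: bigcap_measurableType => n _.
    rewrite -[X in measurable X]setTI.
    apply: (measurable_fun_le measurableT) => //.
    by apply: measurable_sum => k; exact: measurable_funX.
  by apply/seteqP; split => y /= h n => [_|]; [exact: h|exact: (h n I)].
have first_index p : measurable ([set y | negligible_tail (c ^~ y) j p] `&`
    \bigcap_(q in [set q | (q < p)%N]) ~` [set y | negligible_tail (c ^~ y) j q]).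
  by apply: measurableI => //; apply: bigcap_measurableType => q _; exact: measurableC.
(* The default value 0 is also taken when no tail is below the threshold. *)
pose never := \bigcap_p ~` [set y | negligible_tail (c ^~ y) j p].
have mnever : measurable never.
  by apply: bigcap_measurableType => q _; exact: measurableC.
rewrite (_ : [set y | _] = ([set y | negligible_tail (c ^~ y) j m] `&`
    \bigcap_(q in [set q | (q < m)%N]) ~` [set y | negligible_tail (c ^~ y) j q])
    `|` (if m is 0%N then never else set0)).
  by apply: measurableU => //; case: m.
apply/seteqP; split => y /=.
  rewrite /cutoff; case: pselect => [H|H].
    case: ex_minnP => p /asboolP hp pmin <-; left; split => // q /= qp hq.
    by have := pmin q (asboolT hq); rewrite leqNgt qp.
  by move=> <-; right => p _ hp; apply: H; exists p; exact/asboolP.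
rewrite /cutoff => -[[hm mmin]|]; case: pselect => [H|H].
- case: ex_minnP => p /asboolP hp pmin; apply/eqP; rewrite eqn_leq pmin ?(asboolT hm)//=.
  by rewrite leqNgt; apply/negP => pm; exact: (mmin p pm).
- by case: H; exists m; exact/asboolP.
- by have [p /asboolP hp] := H; case: m => // hn; case: (hn p I).
- by case: m.
Qed.

Lemma measurable_assemble (d : measure_display) (T : measurableType d)
    (c E : nat -> T -> R) : (forall k, measurable_fun setT (c k)) ->
  (forall k, measurable_fun setT (E k)) ->
  measurable_fun setT (fun y => assemble (c ^~ y) (E ^~ y)).
Proof.
move=> mc mE; apply: (measurableT_comp (fine_measurable measurableT)).
apply: measurable_fun_limn_esup => j; apply/measurable_EFinP.
apply: (measurable_select (N := fun y => cutoff (c ^~ y) j)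
  (f := fun m y => \sum_(k < m) c k y * E k y)).
- by move=> m; exact: measurable_cutoff.
- by move=> m; apply: measurable_sum => k; exact: measurable_funM.
Qed.

End assembling.

Section assembled_representative.
Context (d : measure_display) (T : measurableType d) (R : realType).
Variables (mu : {measure set T -> \bar R}) (e : nat -> T -> R).
Hypothesis e2 : forall k, e k \in Lfun mu 2%:E.
Hypothesis orthonormal : forall i j, (\int[mu]_x (e i x * e j x))%R = (i == j)%:R.

(** At the cutoffs the squared distances to f are dominated by a geometric series,
    since a squared tail is the squared distance of f to the partial sum. *)
Lemma assemble_ae (f : T -> R) (c : nat -> R) : f \in Lfun mu 2%:E ->
  (forall k, c k = (\int[mu]_x (f x * e k x))%R) ->
  sqint mu setT (fun x => f x - \sum_(k < m) c k * e k x)%R @[m --> \oo] --> 0%E ->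
  {ae mu, forall x, assemble c (e ^~ x) = f x}.
Proof.
move=> f2 cE c0.
pose r m := (\int[mu]_x (f x * f x))%R - \sum_(k < m) c k ^+ 2.
have rE m : sqint mu setT (fun x => f x - \sum_(k < m) c k * e k x)%R = (r m)%:E.
  have := residualE e2 orthonormal m f2.
  under eq_bigr do rewrite -cE.
  by move=> <-; apply: eq_sqint => x _; congr ((_ - _) ^+ 2); apply: eq_bigr => k _; rewrite cE.
have r0 m : 0 <= r m by rewrite -lee_fin -rE; exact: sqint_ge0.
have rD m n : (m <= n)%N -> r m = \sum_(m <= k < n) c k ^+ 2 + r n.
  move=> mn; rewrite /r -!(big_mkord xpredT (fun k => c k ^+ 2)).
  by rewrite [X in _ = _ + (_ - X)](big_cat_nat (n := m))//=; ring.
have r_small : forall a : R, 0 < a -> exists m, r m <= a.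
  move=> a a0; have [m _ /(_ m (leqnn m)) rm] := (cvge0P (fun m => sqint_ge0 _ _ _)).1 c0 a a0.
  by exists m; rewrite -lee_fin -rE.
have thr0 j : 0 < (1 / (2 ^ j.+1)%:R : R) by rewrite divr_gt0// ltr0n expn_gt0.
have cut j : negligible_tail c j (cutoff c j).
  have [m rm] := r_small _ (thr0 j).
  apply: (cutoffP (m := m)) => n; have [mn|/ltnW nm] := leqP m n.
    by apply: le_trans rm; rewrite (rD _ _ mn) lerDl.
  by rewrite big_geq// ltW.
have rcut j : r (cutoff c j) <= 1 / (2 ^ j.+1)%:R.
  apply/ler_addgt0Pr => a a0; have [m rm] := r_small a a0.
  have := cut j m; have [mn|/ltnW nm] := leqP (cutoff c j) m.
    by rewrite (rD _ _ mn) => h; exact: lerD.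
  move=> _; rewrite -[leLHS]add0r; apply: lerD; first exact: ltW.
  by apply: le_trans rm; rewrite (rD _ _ nm) lerDr; apply: sumr_ge0 => k _; exact: sqr_ge0.
pose g j x := f x - \sum_(k < cutoff c j) c k * e k x.
have [mf _] := (Lfun2P mu f).1 f2.
have mg j : measurable_fun setT (g j).
  apply: measurable_funB => //; apply: measurable_sum => k; apply: measurable_funM => //.
  by have /Lfun2P[] := e2 k.
have gj j : (sqint mu setT (g j) <= (1 / (2 ^ j.+1)%:R)%:E)%E by rewrite rE lee_fin.
apply: filterS (fast_sqint_cvg0 mg gj) => x gx; apply: assemble_cvg.
rewrite -[X in _ --> X](subr0 (f x)).
have -> : (fun j => \sum_(k < cutoff c j) c k * e k x) = (fun j => f x - g j x).
  by apply/funext => j; rewrite /g subKr.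
by apply: cvgB => //; exact: cvg_cst.
Qed.

End assembled_representative.

Section L2_classes.
Context (R : realType) (d : nat).
Local Notation mes := (lebesgue_tuple R d).
Implicit Types f g : L2 R d.

Lemma L2_Lfun f : (f : Rn R d -> R) \in Lfun mes 2%:E.
Proof.
rewrite inE; apply/andP; split; rewrite inE /=; last exact: Lebesgue_finite.
exact: (measurable_funPT (repr (LebesgueSpace.sort f))).
Qed.

Lemma measurable_L2 f : measurable_fun setT (f : Rn R d -> R).
Proof. by have /Lfun2P[] := L2_Lfun f. Qed.

Lemma L2norm_sqr f : (L2norm f ^+ 2)%E = sqint mes setT f.
Proof. exact: Lnorm2_sqr. Qed.

(** A coordinate is a Lipschitz functional, by the Cauchy-Schwarz inequality. *)
Lemma L2dot_open (u : L2 R d) (a : R) : L2dot u u = 1 ->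
  L2open [set f | a < L2dot f u].
Proof.
move=> u1 f /= af; exists ((L2dot f u - a) / 2); first by rewrite divr_gt0// subr_gt0.
move=> g gf.
have [f2 [g2 u2]] := (L2_Lfun f, (L2_Lfun g, L2_Lfun u)).
have h2 : (fun x => f x - g x) \in Lfun mes 2%:E.
  have [[mf ff] [mg fg]] := ((Lfun2P _ _).1 f2, (Lfun2P _ _).1 g2).
  apply/Lfun2P; split; first exact: measurable_funB.
  by rewrite -Lnorm2_lty; apply: lt_trans (ltry ((L2dot f u - a) / 2)); exact: gf.
have r0 : 0 < (L2dot f u - a) / 2 by rewrite divr_gt0// subr_gt0.
have hu : (\int[mes]_x ((f x - g x) * u x))%R = L2dot f u - L2dot g u.
  apply: (has_int_uniq (has_int_dot h2 u2)).
  have := has_intB measurableT (has_int_dot f2 u2) (has_int_dot g2 u2).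
  by apply: eq_has_int => // x _; rewrite mulrBl.
have := dot_sqr_le h2 u2 u1; rewrite hu.
move/ltW : gf; rewrite /L2norm Lnorm2_le ?(ltW r0)// => gf le.
have {gf le} := le_trans le (gf : (sqint mes setT (fun x => f x - g x)%R <= _)%E).
rewrite lee_fin => le.
have : `|L2dot f u - L2dot g u| <= (L2dot f u - a) / 2.
  by rewrite -(@ler_pXn2r _ 2) ?nnegrE ?(ltW r0)// real_normK// num_real.
by rewrite ler_norml => /andP[_ h] /=; move: af h; rewrite /=; lra.
Qed.

(** Coordinates pull open rays, which generate the Borel sets of the line, back to
    open sets. *)
Lemma measurable_L2dot (u : L2 R d) (B : set R) : L2dot u u = 1 -> measurable B ->
  L2borel R d [set f | B (L2dot f u)].
Proof.
move=> u1 mB.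
have E : (measurable : set (set (measurableTypeR R))) = <<s @RGenOInfty.G R >>.
  exact: RGenOInfty.measurableE.
have mB' : <<s @RGenOInfty.G R >> B by rewrite -E.
have sL : sigma_algebra setT (L2borel R d) by exact: smallest_sigma_algebra.
have sI := sigma_algebra_image (fun f => L2dot f u) sL.
have : image_set_system setT (fun f => L2dot f u) (L2borel R d) B.
  apply: (smallest_sub sI _ mB') => _ [a ->]; rewrite /image_set_system /= setTI.
  apply: sub_sigma_algebra; have := L2dot_open (a := a) u1.
  by congr L2open; apply/seteqP; split => f /=; rewrite in_itv/= andbT.
by rewrite /image_set_system /= setTI.
Qed.

End L2_classes.

(** * Expansion of an integrand in the basis *)

Section integrand.
Context (R : realType) (d : nat) (dO : measure_display)
  (Om : measurableType dO) (P : probability Om R).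
Variables (F : R -> set (set Om)) (hF : filtration F).
Variables (e : nat -> L2 R d) (he : orthonormal_basis e).
Variables (T : R) (phi : R -> Om -> L2 R d) (hphi : PT_tilde P F T phi).
Local Notation mes := (lebesgue_tuple R d).
Local Notation leb := (@lebesgue_measure R).

Definition coordinate k t w : R := L2dot (phi t w) (e k).

Let e2 k : (e k : Rn R d -> R) \in Lfun mes 2%:E. Proof. exact: L2_Lfun. Qed.

Let orthonormal i j : (\int[mes]_x (e i x * e j x))%R = (i == j)%:R.
Proof. by have [+ _] := he; exact. Qed.

Let ee k : L2dot (e k) (e k) = 1.
Proof. by have [-> _] := he; rewrite eqxx. Qed.

Lemma sqint_basis k : sqint mes setT (e k) = 1%E.
Proof. by rewrite sqint_normE// orthonormal eqxx. Qed.

Let cvg_expansion (f : L2 R d) :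
  sqint mes setT (fun x => f x - \sum_(k < m) L2dot f (e k) * e k x)%R @[m --> \oo] --> 0%E.
Proof. by have [_ /(_ f) /Lnorm2_cvg0] := he. Qed.

Lemma measurable_coordinate_process k : measurable_process T (coordinate k).
Proof.
move=> _ B mB; have [+ _ _] := hphi.
by move=> /(_ _ (measurable_L2dot (ee k) mB)).
Qed.

Lemma coordinate_adapted k (t : R) : 0 <= t <= T ->
  measurable_wrt (F t) measurable (coordinate k t).
Proof.
move=> tT B mB; have [_ + _] := hphi.
by move=> /(_ t tT _ (measurable_L2dot (ee k) mB)).
Qed.

Let normsq t w : R := (\int[mes]_x (phi t w x * phi t w x))%R.

Let normsqE t w : (L2norm (phi t w) ^+ 2)%E = (normsq t w)%:E.
Proof. by rewrite L2norm_sqr sqint_normE//; exact: L2_Lfun. Qed.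

Let normsq_fin : (\int[P]_w \int[leb]_(t in `[0%R, T]) (normsq t w)%:E < +oo)%E.
Proof.
have [_ _] := hphi; congr (_ < _)%E; apply: eq_integral => w _.
by apply: eq_integral => t _; rewrite normsqE.
Qed.

Let residual m t w : R := normsq t w - \sum_(k < m) coordinate k t w ^+ 2.

Let residual_sqint m t w :
  sqint mes setT (fun x => phi t w x - \sum_(k < m) coordinate k t w * e k x)%R =
  (residual m t w)%:E.
Proof. by rewrite (residualE e2 orthonormal)//; exact: L2_Lfun. Qed.

Let residual_ge0 m t w : 0 <= residual m t w.
Proof. by rewrite -lee_fin -residual_sqint; exact: sqint_ge0. Qed.

Let residual_cvg0 t w : residual m t w @[m --> \oo] --> (0 : R).
Proof.
have := cvg_expansion (phi t w); under eq_fun do rewrite residual_sqint.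
by move=> /fine_cvgP[].
Qed.

Let measurable_normsq : measurable_process T normsq.
Proof.
apply: (measurable_fun_cvg (h := fun m p => \sum_(k < m) coordinate k p.1 p.2 ^+ 2)).
  move=> m; apply: measurable_sum => k; apply: measurable_funX.
  exact: measurable_coordinate_process.
move=> [t w] _ /=.
have -> : (fun m => \sum_(k < m) coordinate k t w ^+ 2) = (fun m => normsq t w - residual m t w).
  by apply/funext => m; rewrite /residual subKr.
rewrite -[X in _ --> X]subr0; apply: cvgB; [exact: cvg_cst|exact: residual_cvg0].
Qed.

Lemma coordinate_sqint_lty k :
  (\int[P]_w \int[leb]_(t in `[0%R, T]) (coordinate k t w ^+ 2)%:E < +oo)%E.
Proof.
apply: le_lt_trans normsq_fin; apply: ge0_integral_mono => w _.
rewrite integral_ge0/= => [|t _]; last by rewrite lee_fin sqr_ge0.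
apply: ge0_integral_mono => t _; rewrite lee_fin sqr_ge0/= -normsqE L2norm_sqr.
by apply: dot_sqr_le; [exact: L2_Lfun|exact: e2|rewrite orthonormal eqxx].
Qed.

(** The residuals tend to zero pointwise and are dominated by the squared norm of the
    integrand, which has a finite integral. *)
Lemma integral_residual_cvg0 :
  (\int[P]_w \int[leb]_(t in `[0%R, T]) (residual m t w)%:E)%E @[m --> \oo] --> 0%E.
Proof.
apply: (iterated_dominated_cvg0 (u := fun m t w => (residual m t w)%:E)
  (g := fun t w => (normsq t w)%:E)) => //.
- move=> m; apply/measurable_EFinP; apply: measurable_funB; first exact: measurable_normsq.
  by apply: measurable_sum => k; apply: measurable_funX; exact: measurable_coordinate_process.
- by apply/measurable_EFinP; exact: measurable_normsq.
- move=> m t w; rewrite !lee_fin residual_ge0 /residual gerDl oppr_le0.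
  by apply: sumr_ge0 => k _; exact: sqr_ge0.
- by move=> t w _ _; apply/fine_cvgP; split; [exact: nearW|exact: residual_cvg0].
Qed.

Lemma measurable_field_space (psi : R -> Rn R d -> Om -> R) t w :
  measurable_field T psi -> 0 <= t <= T ->
  measurable_fun setT (fun x : Rn R d => psi t x w).
Proof.
move=> mpsi tT.
have mt : measurable_fun setT (fun x : Rn R d => (t : measurableTypeR R, x, w)).
  by apply: measurable_fun_pair => //; exact: measurable_fun_pair.
apply: (measurable_comp (@measurable_domain R d dO Om T) _ mpsi mt).
by move=> _ [x _ <-]; split => //; split => //=; rewrite in_itv.
Qed.

(** The energy of the remainder is the integral of the residuals, whatever the
    representative. *)
Lemma energy_expansion_cvg0 (psi : R -> Rn R d -> Om -> R) :
  measurable_field T psi -> represents T phi psi ->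
  energy P T (fun t x w => psi t x w - \sum_(k < m) coordinate k t w * e k x)%R
    @[m --> \oo] --> 0%E.
Proof.
move=> mpsi rpsi; rewrite (_ : (fun m => _) = (fun m =>
    \int[P]_w \int[leb]_(t in `[0%R, T]) (residual m t w)%:E)%E).
  exact: integral_residual_cvg0.
apply/funext => m; apply: eq_integral => w _; apply: eq_integral => t /set_mem.
rewrite /= in_itv/= => tT; rewrite -residual_sqint.
have mS : measurable_fun setT (fun x => \sum_(k < m) coordinate k t w * e k x).
  by apply: measurable_sum => k; apply: measurable_funM => //; exact: measurable_L2.
apply: ae_eq_sqint.
- by apply: measurable_funB => //; exact: measurable_field_space.
- by apply: measurable_funB => //; exact: measurable_L2.
- by apply: filterS (rpsi t w tT) => x /= h /h ->.
Qed.

Definition assembled t x w : R := assemble (fun k => coordinate k t w) (fun k => e k x).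

Lemma assembled_represents : represents T phi assembled.
Proof.
move=> t w tT; have := assemble_ae e2 orthonormal (L2_Lfun (phi t w)) (fun k => erefl)
  (cvg_expansion (phi t w)).
by apply: filterS => x <-.
Qed.

Lemma measurable_assembled : measurable_field T assembled.
Proof.
pose D : set (measurableTypeR R * Om) := `[0, T] `*` setT.
have mD : measurable D by apply: measurableX => //; exact: measurable_itv.
pose c k (p : measurableTypeR R * Rn R d * Om) :=
  ((fun q => coordinate k q.1 q.2) \_ D) (p.1.1, p.2).
have mc k : measurable_fun setT (c k).
  apply: (measurableT_comp (f := (fun q => coordinate k q.1 q.2) \_ D)
    (g := fun p : measurableTypeR R * Rn R d * Om => (p.1.1, p.2))).
    by apply/(measurable_restrictT _ mD); exact: measurable_coordinate_process.
  by apply: measurable_fun_pair => //; apply: measurableT_comp.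
have mE k : measurable_fun setT (fun p : measurableTypeR R * Rn R d * Om => e k p.1.2).
  by apply: (measurableT_comp (measurable_L2 (e k))); apply: measurableT_comp.
apply: eq_measurable_fun (measurable_funTS (measurable_assemble mc mE)).
move=> [[t x] w] /set_mem[[/= tT _] _].
by rewrite /assembled; congr assemble; apply/funext => k; rewrite /c patchE mem_set.
Qed.

(** Measurability with respect to the sigma-algebra at time t is the measurability of
    the assembling map once more, over the probability space carrying that smaller
    sigma-algebra. *)
Lemma assembled_PT : PT P F T assembled.
Proof.
split; first exact: measurable_assembled.
  move=> t x tT.
  have t0 : 0 <= t by case/andP: tT.
  apply/(measurable_wrtP _ (filtration_sigma hF t0)).
  apply: measurable_assemble => k; last exact: measurable_cst.
  by apply/(measurable_wrtP _ (filtration_sigma hF t0)); exact: coordinate_adapted.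
apply: le_lt_trans normsq_fin.
rewrite le_eqVlt; apply/orP; left; apply/eqP.
apply: eq_integral => w _; apply: eq_integral => t /set_mem.
rewrite /= in_itv/= => tT; rewrite -normsqE L2norm_sqr.
apply: ae_eq_sqint (assembled_represents w tT).
- exact: measurable_field_space measurable_assembled tT.
- exact: measurable_L2.
Qed.

End integrand.

(** * The two integrals coincide *)

Theorem proposition6 (R : realType) (d : nat) (dO : measure_display)
    (Om : measurableType dO) (P : probability Om R)
    (F : R -> set (set Om)) (W : R -> set (Rn R d) -> Om -> R)
    (e : nat -> L2 R d) (beta : nat -> R -> Om -> R) (T : R)
    (hF : filtration F) (hW : white_noise P F W)
    (hbeta : cylindrical_wiener_of P F W e beta) (hT : 0 < T)
    (phi : R -> Om -> L2 R d) (hphi : PT_tilde P F T phi) :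
  [/\ exists I, is_cylindrical_integral P F e beta T phi I,
      exists J, is_walsh_integral_L2 P F W T phi J &
      forall I J, is_cylindrical_integral P F e beta T phi I ->
        is_walsh_integral_L2 P F W T phi J ->
        I = J %[ae P]].
Proof.
have [he wbeta] := hbeta.
pose c := coordinate e phi.
have mc k : measurable_process T (c k) by exact: (measurable_coordinate_process he hphi).
have me k := measurable_L2 (e k).
have e1 k := sqint_basis he k.
have wb k (t : R) : 0 <= t -> walsh P F W t (fun _ x _ => e k x) (beta k t).
  move=> t0; apply/(walshP hF hW); last exact: wbeta.
  apply: measurable_funTS.
  by apply: (measurableT_comp (me k)); apply: measurableT_comp.
have ito_term k Ik : is_ito_integral P F (beta k) T (c k) Ik ->
    walsh P F W T (fun t x w => c k t w * e k x) Ik.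
  exact: (ito_walsh hF hW (me k) (e1 k) (wb k) (mc k)).
have ex_ito k : exists Ik, is_ito_integral P F (beta k) T (c k) Ik.
  apply: (ito_exists hF hW (me k) (e1 k) (wb k) (mc k)).
  apply: (simple_process_dense (P := P) hF hT (mc k)).
    by move=> t; exact: (coordinate_adapted he hphi).
  exact: (coordinate_sqint_lty he hphi).
(* Partial sums of the Ito integrals are Walsh integrals of the partial expansions. *)
have expansion psi (J : Om -> R) (I : nat -> Om -> R) : PT P F T psi -> represents T phi psi ->
    walsh P F W T psi J -> (forall k, is_ito_integral P F (beta k) T (c k) (I k)) ->
    sqint P setT (fun w => \sum_(k < m) I k w - J w)%R @[m --> \oo] --> 0%E.
  move=> [mpsi _ _] rpsi wJ iI; apply/cvge0P => [m|r r0]; first exact: sqint_ge0.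
  have := (cvge0P (fun m => energy_ge0 _ _ _)).1 (energy_expansion_cvg0 he hphi mpsi rpsi) (r / 16).
  rewrite divr_gt0// => /(_ isT); apply: filterS => m Em.
  rewrite sqint_sym (le_trans (walsh_contraction hF hW wJ (walsh_sum hF hW m (fun k => ito_term k _ (iI k))) Em))//.
  by rewrite lee_fin mulrC divfK.
pose I k := sval (cid (ex_ito k)).
have iI k : is_ito_integral P F (beta k) T (c k) (I k) by rewrite /I; case: cid.
pose psi := assembled e phi.
have Ppsi : PT P F T psi by exact: assembled_PT.
have rpsi : represents T phi psi by exact: assembled_represents.
have [J wJ] : exists J, walsh P F W T psi J.
  have [mpsi _ _] := Ppsi; apply: (walsh_exists hF hW mpsi) => r r0.
  have [m _ /(_ m (leqnn m)) Em] := (cvge0P (fun m => energy_ge0 _ _ _)).1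
    (energy_expansion_cvg0 he hphi mpsi rpsi) r r0.
  exists (fun t x w => \sum_(k < m) c k t w * e k x), (fun w => \sum_(k < m) I k w).
  split; first exact: (walsh_sum hF hW m (fun k => ito_term k _ (iI k))).
  by rewrite energy_sym.
split.
- exists J, I; split => //; split; first exact: walsh_Lfun2 wJ.
  exact: ((Lnorm2_cvg0 P (fun m w => \sum_(k < m) I k w - J w)).2 (expansion psi J I Ppsi rpsi wJ iI)).
- exists J, psi; split => //; have [mpsi _ _] := Ppsi.
  exact/(walshP hF hW).
move=> I' J' [Ik [iIk [/Lfun2P[mI' _] /Lnorm2_cvg0 LI]]] [chi [Pchi rchi wchi]].
have [mchi _ _] := Pchi.
have wJ' : walsh P F W T chi J' by exact/(walshP hF hW).
have NJ := expansion chi J' Ik Pchi rchi wJ' iIk.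
have [_ mJ' _] := wJ'.
apply: sqint_eq0 => //; apply/eqP; rewrite eq_le sqint_ge0 andbT.
apply/lee_addgt0Pr => r r0; rewrite add0e.
have r4 : 0 < r / 4 by rewrite divr_gt0.
have [m1 _ h1] := (cvge0P (fun m => sqint_ge0 _ _ _)).1 LI _ r4.
have [m2 _ h2] := (cvge0P (fun m => sqint_ge0 _ _ _)).1 NJ _ r4.
pose m := maxn m1 m2.
have mS : measurable_fun setT (fun w => \sum_(k < m) Ik k w).
  by apply: measurable_sum => k; have [_ + _] := ito_term k _ (iIk k); exact.
have h1m := h1 m (leq_maxl _ _); rewrite /= sqint_sym in h1m.
have := sqint_triangle_le measurableT mI' mS mJ' h1m (h2 m (leq_maxr _ _)).
by rewrite (_ : 2 * (r / 4) + 2 * (r / 4) = r)//; lra.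
Qed.
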